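(* Let $\mathfrak g$ be a classical simple Lie algebra (type A, B, C or D) over an algebraically closed field of characteristic zero and let $\mathbf e$ be an almost principal nilpotent pair in $\mathfrak g$. Then the centralizer $Z(\mathbf e)$ is an abelian Lie algebra.
   Context: A nilpotent pair in a semisimple Lie algebra $\mathfrak g$ is a pair $\mathbf e=(e_1,e_2)$ of commuting nilpotent elements of $\mathfrak g$ for which there exists a pair $(h_1,h_2)$ of commuting semisimple elements of $\mathfrak g$ with rational eigenvalues in the adjoint action and $[h_i,e_j]=\delta_{i,j}e_j$. $Z(\mathbf e)=\{x\in\mathfrak g:[x,e_1]=[x,e_2]=0\}$. A nilpotent pair is almost principal if $\dim Z(\mathbf e)=\mathrm{rk}\,\mathfrak g+1$. *)

(* Defs.v *)
From HB Require Import structures.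
From mathcomp Require Import all_boot all_order all_algebra.

Set Implicit Arguments.
Unset Strict Implicit.
Unset Printing Implicit Defensive.

Import GRing.Theory.
Local Open Scope ring_scope.

HB.mixin Record Vector_isLie (K : fieldType) L of Vector K L := {
  bracket : L -> L -> L;
  bracket_linearl : forall (a : K) (x y z : L),
    bracket (a *: x + y) z = a *: bracket x z + bracket y z;
  bracket_linearr : forall (a : K) (x y z : L),
    bracket x (a *: y + z) = a *: bracket x y + bracket x z;
  bracketxx : forall x : L, bracket x x = 0;
  bracket_jacobi : forall x y z : L,
    bracket x (bracket y z) + bracket y (bracket z x)
      + bracket z (bracket x y) = 0
}.

#[short(type="lieAlgType")]
HB.structure Definition LieAlgebra (K : fieldType) :=
  {L of Vector_isLie K L & Vector K L}.

HB.instance Definition _ (K : fieldType) (L : lieAlgType K) (x : L) :=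
  GRing.isLinear.Build K L L _ (bracket x) (fun a => bracket_linearr a x).

Section LieTheory.

Variables (K : fieldType) (L : lieAlgType K).
Implicit Types (x y h : L) (e : L * L) (H : {vspace L}).

Definition ad x : 'End(L) := linfun (bracket x).

Lemma adE x y : ad x y = bracket x y.
Proof. by rewrite lfunE. Qed.

Lemma bracketC x y : bracket y x = - bracket x y.
Proof.
have addl u v w : bracket (u + v) w = bracket u w + bracket v w.
  by have := bracket_linearl 1 u v w; rewrite !scale1r.
apply/eqP; rewrite -addr_eq0; apply/eqP.
have := bracketxx (x + y).
by rewrite addl !linearD /= !bracketxx add0r addr0 addrC.
Qed.

(* Nilpotent and semisimple elements are taken in the adjoint sense, the
   intrinsic one in a semisimple Lie algebra. *)
Definition nilpotent_elt x : Prop :=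
  exists n, forall y, iter n (bracket x) y = 0.

(* Diagonalizability of [ad x], which is semisimplicity when [K] is
   algebraically closed. *)
Definition semisimple_elt x : Prop :=
  exists2 b : seq L, basis_of fullv b
    & forall v, v \in b -> exists a : K, bracket x v = a *: v.

Definition rational_eigenvalues x : Prop :=
  forall a : K, passmx.leigenvalue (ad x) a -> exists q : rat, a = ratr q.

Definition abelian_subspace H : Prop :=
  {in H &, forall x y, bracket x y = 0}.

Definition toral H : Prop :=
  abelian_subspace H /\ {in H, forall x, semisimple_elt x}.

(* A maximal toral subalgebra: this is the notion of Cartan subalgebra for
   semisimple [L] over an algebraically closed field of characteristic zero. *)
Definition cartan_subalgebra H : Prop :=
  toral H /\ forall H', toral H' -> (H <= H')%VS -> H' = H.

Definition has_rank (r : nat) : Prop :=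
  exists2 H, cartan_subalgebra H & \dim H = r.

Definition centralizer e : {vspace L} := (lker (ad e.1) :&: lker (ad e.2))%VS.

Lemma mem_centralizer e x :
  reflect (bracket x e.1 = 0 /\ bracket x e.2 = 0) (x \in centralizer e).
Proof.
rewrite memv_cap !memv_ker !adE (bracketC x e.1) (bracketC x e.2) !oppr_eq0.
by apply: (iffP andP) => -[/eqP -> /eqP ->].
Qed.

Definition nilpotent_pair e : Prop :=
  [/\ bracket e.1 e.2 = 0, nilpotent_elt e.1, nilpotent_elt e.2
    & exists h1 h2 : L,
      [/\ bracket h1 h2 = 0,
          semisimple_elt h1 /\ semisimple_elt h2,
          rational_eigenvalues h1 /\ rational_eigenvalues h2,
          bracket h1 e.1 = e.1 /\ bracket h1 e.2 = 0
        & bracket h2 e.1 = 0 /\ bracket h2 e.2 = e.2]].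

Definition almost_principal_nilpotent_pair e : Prop :=
  nilpotent_pair e
  /\ exists2 r, has_rank r & \dim (centralizer e) = r.+1.

Definition isomorphic_to_matrix_lie n (P : pred 'M[K]_n) : Prop :=
  exists f : {linear L -> 'M[K]_n},
    [/\ injective f,
        forall A, A \in P <-> exists x, f x = A
      & forall x y, f (bracket x y) = f x *m f y - f y *m f x].

End LieTheory.

Section ClassicalLie.

Variable K : fieldType.

Definition sl_mx n : pred 'M[K]_n := [pred A | \tr A == 0].

Definition so_mx n : pred 'M[K]_n := [pred A | A^T == - A].

Definition symp_form l : 'M[K]_(l + l) := block_mx 0 1%:M (- 1%:M) 0.

Definition sp_mx l : pred 'M[K]_(l + l) :=
  [pred A | A^T *m symp_form l + symp_form l *m A == 0].

End ClassicalLie.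

(* All simple algebras of the four families, up to the usual coincidences in
   low rank; so_2 and so_4 are not simple, whence [3 <= l] in type D. *)
Variant classical_simple (K : fieldType) (L : lieAlgType K) : Prop :=
| TypeA l of (1 <= l)%N & isomorphic_to_matrix_lie L (@sl_mx K l.+1)
| TypeB l of (1 <= l)%N & isomorphic_to_matrix_lie L (@so_mx K (l.*2.+1))
| TypeC l of (1 <= l)%N & isomorphic_to_matrix_lie L (@sp_mx K l)
| TypeD l of (3 <= l)%N & isomorphic_to_matrix_lie L (@so_mx K l.*2).

(* Main.v *)
From HB Require Import structures.
Require Import Defs.
From mathcomp Require Import all_boot all_order all_algebra all_fingroup.
From mathcomp Require Import ring lra zify.

(** Realise [L] by matrices and diagonalise [h1] and [h2] simultaneously, so that
    the basis vectors have rational weights [(X s, Y s)] and [e1], [e2], and the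
    Gram matrix of the form, are bihomogeneous.  For any subspace [A] of the
    algebra stable under [ad e1] and [ad e2], the leading terms of the degree-0 part
    of [A] under [exp (s ad e1) exp (t ad e2)] lie in [A] and in the centralizer
    [Z]; since [dim Z] is the rank plus one, counting pairs of opposite weights
    forces the weights to be simple, except for orthogonal algebras, where the
    weight zero may be double.

    For simple weights, [e1], [e2] and the form are partial permutation matrices up
    to scalars, and the monomials [e1^i e2^j] order the basis.  The elements of [Z]
    supported on pairs [P <= R] form an abelian subalgebra, the core, of
    codimension at most one in [Z].  If [Z] is not abelian, everything in [Z]
    commuting with the core lies in the core.  This applies to explicit kernel
    elements ([E_QP] with [P] a source and [Q] a sink, bivectors of two sinks, and
    bivectors near a sink), which pins down the shape of the diagram until one of
    them has a degree that no element of the core can have.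

    When the weight zero is double, either an isotropic basis of the zero weight
    space leads back to partial permutation matrices, or an orthogonal basis splits
    off a self-dual [e1]-chain [R] (up to exchanging [e1] and [e2]).  The elements
    of [Z] then decompose into those preserving the splitting and those exchanging
    the two parts; the latter are few enough to be listed.  In the remaining case
    two elements of negative degree exceed the dimension of [Z]. *)

Set Implicit Arguments.
Unset Strict Implicit.
Unset Printing Implicit Defensive.

Import Order.TTheory GRing.Theory Num.Theory.
Local Open Scope ring_scope.

(** * Leading terms under two commuting nilpotent endomorphisms *)

(** Codimension one of the core is used in two ways. A quotient of dimension at most one has a
    single degree, so a homogeneous element of [Z] outside the core forces all other degrees of [Z]
    into the core, where degrees are natural numbers. Moreover an element [z] of the core commutes
    with the core, so [ad z] cannot have two opposite nonzero eigenvalues on [Z]. The whole algebra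
    has with each eigenvalue its opposite, and Engel's theorem carries it over to [Z]; hence the
    degree-zero part of the core commutes with [Z]. Kernel elements on which the core acts only
    through diagonal entries then commute with the core.

    With a form, an element of [Z] times a monomial stays in the algebra only for even total degree,
    so the short argument for full matrices must be replaced by bivectors. The bivector of a sink
    with itself vanishes for a symmetric form, so a source need not lie below its own dual sink;
    that shape needs a separate comparison of signs. When a double zero weight splits orthogonally,
    the core is only known to have codimension at most two, and contradictions need three elements
    independent modulo the core. *)

Section Symbol.

Variables (K : fieldType) (vT : vectType K).
Hypothesis char0 : [pchar K] =i pred0.

(** Each [v] in [T] contributes its last nonzero [iter k N v], an eigenvector of [H] for the
    eigenvalue [k]; [W] is the sum over [k] of the images under [N^k] of [T :&: ker N^(k+1)]. The
    eigenvalues are distinct in characteristic zero, so the sum is direct, and rank-nullity gives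
    its dimension. *)
Lemma symbol_step (N H : 'End(vT)) (T : {vspace vT}) m :
  (forall v, H (N v) = N (H v) + N v) -> (T <= lker H)%VS ->
  (forall v, v \in T -> iter m N v = 0) ->
  exists W : {vspace vT}, [/\ (W <= lker N)%VS, \dim W = \dim T
    & forall A, (T <= A)%VS -> (N @: A <= A)%VS -> (W <= A)%VS].
Proof.
move=> HN.
(* [q m] is the product of [H - k] for [k < m]. Requiring that it kill [W] keeps the eigenvalues of
   [W] below [m], apart from the layer of eigenvalue [m] added next. *)
pose q := fix q m : 'End(vT) :=
  if m is k.+1 then ((H - k%:R *: \1%VF) \o q k)%VF else \1%VF.
pose p := fix p m : 'End(vT) := if m is k.+1 then (N \o p k)%VF else \1%VF.
have pE k v : p k v = iter k N v.
  by elim: k => [|k IH] /=; rewrite ?id_lfunE // comp_lfunE IH.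
have HNk k v : H v = 0 -> H (iter k N v) = k%:R *: iter k N v.
  move=> Hv; elim: k => [|k IH] /=; first by rewrite Hv scale0r.
  by rewrite HN IH linearZ /= -natr1 scalerDl scale1r.
suff main : (T <= lker H)%VS -> (forall v, v \in T -> iter m N v = 0) ->
  exists W : {vspace vT}, [/\ (W <= lker N)%VS, \dim W = \dim T,
    forall A, (T <= A)%VS -> (N @: A <= A)%VS -> (W <= A)%VS
    & (W <= lker (q m))%VS].
  by move=> TH TN; have [W [*]] := main TH TN; exists W.
elim: m T => [|m IH] T TH TN.
  have -> : T = 0%VS.
    by apply/eqP; rewrite -subv0; apply/subvP=> v /TN /= ->; rewrite mem0v.
  by exists 0%VS; split=> [||A _ _|]; rewrite ?sub0v.
have [||W [WN dW WA Wq]] := IH (T :&: lker (p m))%VS.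
- exact: subv_trans (capvSl _ _) TH.
- by move=> v /memv_capP[_]; rewrite memv_ker pE => /eqP.
have qH k v : H v = m%:R *: v -> q k v = (\prod_(i < k) (m%:R - i%:R)) *: v.
  move=> Hv; elim: k => [|k IHk] /=; first by rewrite id_lfunE big_ord0 scale1r.
  rewrite comp_lfunE IHk linearZ /= big_ord_recr /= -scalerA; congr (_ *: _).
  by rewrite !lfunE /= !lfunE /= !lfunE /= Hv scalerBl lfunE.
have WmP w : w \in (p m @: T)%VS -> exists2 v, v \in T & w = iter m N v.
  by case/memv_imgP=> v Tv ->; exists v; rewrite ?pE.
have HW w : w \in (p m @: T)%VS -> H w = m%:R *: w.
  case/WmP=> v Tv ->; apply: HNk.
  by apply/eqP; rewrite -memv_ker; apply: (subvP TH).
exists (W + p m @: T)%VS; split.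
- rewrite subv_add WN /=; apply/subvP=> w /WmP[v Tv ->].
  by rewrite memv_ker -iterS TN.
- rewrite dimv_disjoint_sum ?dW ?limg_ker_dim //.
  apply/eqP; rewrite -subv0; apply/subvP=> w /memv_capP[Ww Pw].
  have := subvP Wq _ Ww; rewrite memv_ker (qH _ _ (HW _ Pw)) scaler_eq0 memv0.
  case/orP=> // /eqP /eqP; rewrite prodf_seq_eq0 => /hasP[i _ /=].
  rewrite -natrB ?(ltnW (ltn_ord i)) // ((pcharf0P K).1 char0) subn_eq0.
  by rewrite leqNgt ltn_ord.
- move=> A TA NA; rewrite subv_add WA //=; last exact: subv_trans (capvSl _ _) TA.
  apply/subvP=> w /WmP[v Tv ->].
  elim: (m) => [|k IHk] /=; first exact: (subvP TA).
  by apply: (subvP NA); apply: memv_img.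
- rewrite /= subv_add; apply/andP; split; apply/subvP=> w Ww; rewrite memv_ker comp_lfunE.
    by have := subvP Wq _ Ww; rewrite memv_ker => /eqP ->; rewrite linear0.
  rewrite (qH _ _ (HW _ Ww)) linearZ /= !lfunE /= !lfunE /= !lfunE /= HW // lfunE /=.
  by rewrite subrr scaler0.
Qed.

(* Leading terms of [exp (s N1) exp (t N2) T] as [s, t] tend to infinity; this
   replaces a limit of conjugates of a Cartan subalgebra. *)
Lemma symbol_ker (N1 N2 H1 H2 : 'End(vT)) (T A : {vspace vT}) m :
  (forall v, H1 (N1 v) = N1 (H1 v) + N1 v) ->
  (forall v, H2 (N2 v) = N2 (H2 v) + N2 v) ->
  (forall v, H2 (N1 v) = N1 (H2 v)) ->
  (forall v, N2 (N1 v) = N1 (N2 v)) ->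
  (forall v, iter m N1 v = 0) -> (forall v, iter m N2 v = 0) ->
  (T <= lker H1)%VS -> (T <= lker H2)%VS ->
  (T <= A)%VS -> (N1 @: A <= A)%VS -> (N2 @: A <= A)%VS ->
  (\dim T <= \dim (A :&: (lker N1 :&: lker N2)))%N.
Proof.
move=> H11 H22 H21 N21 N1m N2m TH1 TH2 TA AN1 AN2.
have [W1 [W1N dW1 W1A]] := symbol_step H11 TH1 (fun v _ => N1m v).
(* [ker H2] is itself stable under [N1] and contains [T], so it contains the leading terms; [ker N1]
   plays the same part for [W2]. *)
have W1H2 : (W1 <= lker H2)%VS.
  apply: W1A => //; apply/subvP=> w /memv_imgP[v Hv ->].
  by move: Hv; rewrite !memv_ker H21 => /eqP ->; rewrite linear0.
have [W2 [W2N dW2 W2A]] := symbol_step H22 W1H2 (fun v _ => N2m v).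
rewrite -dW1 -dW2; apply: dimvS; rewrite !subv_cap W2N andbT.
rewrite W2A ?W1A //=; apply: W2A => //.
apply/subvP=> w /memv_imgP[v Hv ->].
by move: Hv; rewrite !memv_ker -N21 => /eqP ->; rewrite linear0.
Qed.

End Symbol.

(** * Bigraded matrices and commuting partial injections *)

Section Homogeneous.

Variables (K : fieldType) (n : nat) (U V : zmodType).
Variables (X : 'I_n -> U) (Y : 'I_n -> V).
Implicit Types (A B : 'M[K]_n) (p : U) (q : V).

(** Degrees lie in arbitrary abelian groups: besides the rational weights, the diagonal entries of a
    diagonal matrix serve as a grading with values in [K], whose homogeneous matrices are the
    eigenvectors of its commutator. *)
Definition homog p q A :=
  forall s t, A s t != 0 -> X s = X t + p /\ Y s = Y t + q.

Definition hcomp p q A : 'M[K]_n :=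
  \matrix_(s, t) if (X s == X t + p) && (Y s == Y t + q) then A s t else 0.

Lemma hcomp_is_linear p q : linear (hcomp p q).
Proof.
move=> a A B; apply/matrixP=> s t; rewrite !mxE.
by case: ifP => _ //; rewrite mulr0 addr0.
Qed.

HB.instance Definition _ p q :=
  GRing.isLinear.Build K 'M[K]_n 'M[K]_n _ (hcomp p q) (hcomp_is_linear p q).

Lemma hcomp_homog p q A : homog p q (hcomp p q A).
Proof.
by move=> s t; rewrite mxE; case: ifP => [/andP[/eqP -> /eqP ->]|]; rewrite ?eqxx.
Qed.

Lemma homog_hcomp p q A : homog p q A -> hcomp p q A = A.
Proof.
move=> hA; apply/matrixP=> s t; rewrite mxE; case: ifP => // /negP nst.
have [//|/eqP A_neq0] := A s t =P 0.
by have [Xs Ys] := hA _ _ A_neq0; case: nst; rewrite Xs Ys !eqxx.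
Qed.

Lemma homog_hcomp0 p q p' q' A :
  homog p q A -> (p, q) != (p', q') -> hcomp p' q' A = 0.
Proof.
move=> hA neq; apply/matrixP=> s t; rewrite !mxE; case: ifP => // /andP[/eqP Xs /eqP Ys].
have [//|/eqP A_neq0] := A s t =P 0; have [Xs' Ys'] := hA _ _ A_neq0.
case/eqP: neq; congr (_, _).
  by apply: (addrI (X t)); rewrite -Xs -Xs'.
by apply: (addrI (Y t)); rewrite -Ys -Ys'.
Qed.

Definition degrees : seq (U * V) :=
  undup [seq (X u.1 - X u.2, Y u.1 - Y u.2) | u <- enum {: 'I_n * 'I_n}].

Lemma sum_hcomp A : \sum_(d <- degrees) hcomp d.1 d.2 A = A.
Proof.
apply/matrixP=> s t; rewrite summxE.
have d_in : (X s - X t, Y s - Y t) \in degrees.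
  by rewrite mem_undup; apply/mapP; exists (s, t); rewrite ?mem_enum.
rewrite (bigD1_seq _ d_in) ?undup_uniq //= mxE.
rewrite (addrC (X t)) (addrC (Y t)) !subrK !eqxx /= big1 ?addr0 // => -[p q] /= neq.
rewrite mxE; case: ifP => // /andP[/eqP Xs /eqP Ys]; case/eqP: neq.
by rewrite Xs Ys (addrC (X t)) (addrC (Y t)) !addrK.
Qed.

Lemma mulmx_neq0 A B s t :
  (A *m B) s t != 0 -> exists2 u, A s u != 0 & B u t != 0.
Proof.
rewrite mxE => AB; have [u ABu|AB0] := pickP (fun u => A s u * B u t != 0).
  by move: ABu; rewrite mulf_eq0 negb_or => /andP[]; exists u.
by case/eqP: AB; apply: big1 => u _; apply/eqP; have := AB0 u; move/negbFE.
Qed.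

Lemma homogM p q p' q' A B :
  homog p q A -> homog p' q' B -> homog (p' + p) (q' + q) (A *m B).
Proof.
move=> hA hB s t /mulmx_neq0[u /hA[-> ->] /hB[-> ->]].
by rewrite !addrA.
Qed.

Lemma homog1 : homog 0 0 1%:M.
Proof.
move=> s t; rewrite mxE; have [->|_] := eqVneq s t; last by rewrite eqxx.
by rewrite !addr0.
Qed.

Lemma homogX p q A m : homog p q A -> homog (p *+ m) (q *+ m) (A ^+ m).
Proof.
move=> hA; elim: m => [|m IH]; first by rewrite !mulr0n expr0; exact: homog1.
by rewrite exprS !mulrSr; apply: homogM.
Qed.

Lemma hcompMl p q p' q' A B : homog p' q' A ->
  hcomp (p + p') (q + q') (A *m B) = A *m hcomp p q B.
Proof.
move=> hA; apply/matrixP=> s t; rewrite !mxE.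
rewrite [RHS](eq_bigr (fun u => if (X s == X t + (p + p')) && (Y s == Y t + (q + q'))
  then A s u * B u t else 0)); last first.
  move=> u _; rewrite ?mxE; have [->|/eqP A_neq0] := A s u =P 0.
    by rewrite !mul0r if_same.
  have [-> ->] := hA _ _ A_neq0; rewrite !addrA !(inj_eq (addIr _)).
  by case: ifP; rewrite ?mulr0.
by case: ifP => // _; rewrite big1.
Qed.

Lemma hcompMr p q p' q' A B : homog p' q' B ->
  hcomp (p + p') (q + q') (A *m B) = hcomp p q A *m B.
Proof.
move=> hB; apply/matrixP=> s t; rewrite !mxE.
rewrite [RHS](eq_bigr (fun u => if (X s == X t + (p + p')) && (Y s == Y t + (q + q'))
  then A s u * B u t else 0)); last first.
  move=> u _; rewrite ?mxE; have [->|/eqP B_neq0] := B u t =P 0.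
    by rewrite !mulr0 if_same.
  have [-> ->] := hB _ _ B_neq0; rewrite !(addrAC _ _ p) !(addrAC _ _ q) !addrA.
  by case: ifP; rewrite ?mul0r.
by case: ifP => // _; rewrite big1.
Qed.

Lemma hcomp_comm p q p' q' A B : homog p' q' B ->
  A *m B = B *m A -> hcomp p q A *m B = B *m hcomp p q A.
Proof. by move=> hB AB; rewrite -(hcompMl _ _ _ hB) -(hcompMr _ _ _ hB) AB. Qed.

End Homogeneous.

(** * Partial permutation matrices up to scalars *)

Section PartialInjections.

Variables (K : fieldType) (n : nat).
Implicit Types (A B : 'M[K]_n) (P Q R : 'I_n).

Definition pinj A :=
  (forall R R' P, A R P != 0 -> A R' P != 0 -> R = R') /\
  (forall R P P', A R P != 0 -> A R P' != 0 -> P = P').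

Lemma mulmx_coluniq A B R M P :
  pinj B -> B M P != 0 -> (A *m B) R P = A R M * B M P.
Proof.
move=> [cu _] BMP; rewrite mxE (bigD1 M) //= big1 ?addr0 // => u neq.
have [->|/eqP Bu] := B u P =P 0; first by rewrite mulr0.
by rewrite (cu _ _ _ BMP Bu) eqxx in neq.
Qed.

Lemma mulmx_rowuniq A B R M P :
  pinj A -> A R M != 0 -> (A *m B) R P = A R M * B M P.
Proof.
move=> [_ ru] ARM; rewrite mxE (bigD1 M) //= big1 ?addr0 // => u neq.
have [->|/eqP Au] := A R u =P 0; first by rewrite mul0r.
by rewrite (ru _ _ _ ARM Au) eqxx in neq.
Qed.

Lemma pinjM A B : pinj A -> pinj B -> pinj (A *m B).
Proof.
move=> [cA rA] [cB rB]; split=> [R R' P|R P P'] /mulmx_neq0[u Au Bu] /mulmx_neq0[v Av Bv].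
  by move: Av; rewrite -(cB _ _ _ Bu Bv) => /(cA _ _ _ Au).
by move: Bv; rewrite -(rA _ _ _ Au Av) => /(rB _ _ _ Bu).
Qed.

Lemma pinjX A m : pinj A -> pinj (A ^+ m).
Proof.
move=> pA; elim: m => [|m IH]; last by rewrite exprS; apply: pinjM.
rewrite expr0 -idmxE; split=> [R R' P|R P P']; rewrite !mxE.
  case: (R =P P) => [->|_]; last by rewrite eqxx.
  by case: (R' =P P) => [->|_]; last by rewrite eqxx.
case: (R =P P) => [->|_]; last by rewrite eqxx.
by case: (P =P P') => [->|_]; last by rewrite eqxx.
Qed.

End PartialInjections.

(** Partial injectivity is required instead of simple weights, so that the record also covers a
    double zero weight whose basis has been adapted to [e1] and [e2]. *)
Record grid (K : fieldType) n (X Y : 'I_n -> rat) (e1 e2 : 'M[K]_n) : Prop := Grid {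
  grid_h1 : homog X Y 1 0 e1;
  grid_h2 : homog X Y 0 1 e2;
  grid_comm : e1 *m e2 = e2 *m e1;
  grid_p1 : pinj e1;
  grid_p2 : pinj e2 }.

Lemma gridC (K : fieldType) n (X Y : 'I_n -> rat) (e1 e2 : 'M[K]_n) : grid X Y e1 e2 -> grid Y X e2 e1.
Proof.
case=> h1 h2 c p1 p2; split=> //.
  by move=> s t /h2[].
by move=> s t /h1[].
Qed.

(** * The order defined by the monomials in [e1] and [e2] *)

Section Grid.

Variables (K : fieldType) (n : nat) (X Y : 'I_n -> rat) (e1 e2 : 'M[K]_n).
Hypothesis G : grid X Y e1 e2.
Implicit Types (P Q R M : 'I_n) (i j k l : nat).

(* Columns index the source: [e1^i e2^j] sends the [P]-th basis vector to a multiple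
   of the [R]-th one, and [ple i j P R] says that this multiple is nonzero. *)
Definition mono i j : 'M[K]_n := e1 ^+ i *m e2 ^+ j.

Definition ple i j P R := mono i j R P != 0.

Lemma monoE i j : mono i j = e1 ^+ i *m e2 ^+ j. Proof. by []. Qed.
Lemma pleE i j P R : ple i j P R = (mono i j R P != 0). Proof. by []. Qed.

Lemma monoD i j k l : mono (i + k) (j + l) = mono i j *m mono k l.
Proof.
have cX : GRing.comm (e2 ^+ j) (e1 ^+ k).
  by apply: commrX; apply/commr_sym/commrX/(grid_comm G).
by rewrite /mono !mulmxE !exprD !mulrA -[in RHS](mulrA (e1 ^+ i)) cX !mulrA.
Qed.

Lemma mono10 : mono 1 0 = e1. Proof. by rewrite /mono expr0 expr1 mulmx1. Qed.
Lemma mono01 : mono 0 1 = e2. Proof. by rewrite /mono expr0 expr1 mul1mx. Qed.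
Lemma mono00 : mono 0 0 = 1%:M. Proof. by rewrite /mono !expr0 mulmx1. Qed.

Lemma pinj_mono i j : pinj (mono i j).
Proof. by apply: pinjM; apply: pinjX; case: G. Qed.

Lemma homog_mono i j : homog X Y i%:R j%:R (mono i j).
Proof.
have := homogM (homogX (m := i) (grid_h1 G)) (homogX (m := j) (grid_h2 G)).
by rewrite !mul0rn addr0 add0r.
Qed.

Lemma ple_deg i j P R : ple i j P R -> X R = X P + i%:R /\ Y R = Y P + j%:R.
Proof. exact: homog_mono. Qed.

Lemma ple00 P R : ple 0 0 P R = (P == R).
Proof.
by rewrite /ple mono00 mxE (eq_sym P); case: (R == P); rewrite ?oner_neq0 ?eqxx.
Qed.

Lemma ple_trans i j k l P M R : ple i j P M -> ple k l M R -> ple (k + i) (l + j) P R.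
Proof.
rewrite /ple => PM MR; rewrite monoD (mulmx_coluniq _ _ (pinj_mono _ _) PM).
by rewrite mulf_neq0.
Qed.

Lemma ple_split i j k l P R :
  ple (k + i) (l + j) P R -> exists2 M, ple i j P M & ple k l M R.
Proof. by rewrite /ple monoD => /mulmx_neq0[M]; exists M. Qed.

Lemma ple_splitle i j k l P R : (k <= i)%N -> (l <= j)%N ->
  ple i j P R -> exists2 M, ple k l P M & ple (i - k) (j - l) M R.
Proof.
by move=> ki lj PR; apply: ple_split; rewrite (subnK ki) (subnK lj).
Qed.

Lemma ple_tgt i j P R R' : ple i j P R -> ple i j P R' -> R = R'.
Proof. exact: (pinj_mono i j).1. Qed.

Lemma ple_src i j P P' R : ple i j P R -> ple i j P' R -> P = P'.
Proof. exact: (pinj_mono i j).2. Qed.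

(** Paths can be divided: the longer path from [P] passes through the only basis vector that
    [e1^i e2^j] can reach from [P]. *)
Lemma ple_from i j k l P Q R : (i <= k)%N -> (j <= l)%N ->
  ple i j P Q -> ple k l P R -> ple (k - i) (l - j) Q R.
Proof.
by move=> ik jl PQ /(ple_splitle ik jl)[M /(ple_tgt PQ) <-].
Qed.

Lemma ple_to i j k l P Q R : (i <= k)%N -> (j <= l)%N ->
  ple i j Q R -> ple k l P R -> ple (k - i) (l - j) P Q.
Proof.
move=> ik jl QR PR.
have := ple_splitle (leq_subr i k) (leq_subr j l) PR.
by rewrite (subKn ik) (subKn jl) => -[M PM /(ple_src QR) ->].
Qed.

(* [gen P]: nothing is mapped to [P]; [sink Q]: [Q] is mapped to zero. *)
Definition gen P := [forall s, (e1 P s == 0) && (e2 P s == 0)].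
Definition sink Q := [forall s, (e1 s Q == 0) && (e2 s Q == 0)].

Lemma genP P i j M : gen P -> ple i j M P -> [/\ i = 0%N, j = 0%N & M = P].
Proof.
move/forallP=> gP MP; case: i j MP => [|i] [|j] MP.
- by move: MP; rewrite ple00 => /eqP.
- move: MP; rewrite -[0%N]/(0 + 0)%N -[j.+1]/(1 + j)%N => /ple_split[N _].
  by rewrite /ple mono01; have /andP[_ /eqP ->] := gP N; rewrite eqxx.
- move: MP; rewrite -[i.+1]/(1 + i)%N -[0%N]/(0 + 0)%N => /ple_split[N _].
  by rewrite /ple mono10; have /andP[/eqP -> _] := gP N; rewrite eqxx.
move: MP; rewrite -[i.+1]/(1 + i)%N -[j.+1]/(0 + j.+1)%N => /ple_split[N _].
by rewrite /ple mono10; have /andP[/eqP -> _] := gP N; rewrite eqxx.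
Qed.

Lemma sinkP Q i j M : sink Q -> ple i j Q M -> [/\ i = 0%N, j = 0%N & M = Q].
Proof.
move/forallP=> sQ QM; case: i j QM => [|i] [|j] QM.
- by move: QM; rewrite ple00 => /eqP.
- move: QM; rewrite -[0%N]/(0 + 0)%N -addn1 => /ple_split[N + _].
  by rewrite /ple mono01; have /andP[_ /eqP ->] := sQ N; rewrite eqxx.
- move: QM; rewrite -addn1 -[0%N]/(0 + 0)%N => /ple_split[N + _].
  by rewrite /ple mono10; have /andP[/eqP -> _] := sQ N; rewrite eqxx.
move: QM; rewrite -(addn1 i) -(addn0 j.+1) => /ple_split[N + _].
by rewrite /ple mono10; have /andP[/eqP -> _] := sQ N; rewrite eqxx.
Qed.

Lemma gen_below R : exists P i j, gen P /\ ple i j P R.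
Proof.
(* Induction on the number of basis vectors of smaller total weight. *)
pose lower R := [pred s | X s + Y s < X R + Y R].
elim: {R}_.+1 {-2}R (ltnSn #|lower R|) => // m IH R; rewrite ltnS => cR.
have [gR|] := boolP (gen R); first by exists R, 0%N, 0%N; rewrite ple00.
rewrite negb_forall => /existsP[s]; rewrite negb_and => esR.
have {esR} [i [j sR ij]] : exists i, exists2 j, ple i j s R & (0 < i + j)%N.
  by case/orP: esR; [exists 1%N, 0%N|exists 0%N, 1%N];
     rewrite // /ple ?mono10 ?mono01.
have [Xs Ys] := ple_deg sR.
have sm : X s + Y s < X R + Y R.
  rewrite Xs Ys addrACA -natrD ltrDl ltr0n //.
have /IH[P [k [l [gP Ps]]]] : (#|lower s| < m)%N.
  apply: leq_trans cR; apply: proper_card; apply/properP; split.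
    by apply/subsetP=> u; rewrite !inE => /lt_trans -> //.
  by exists s; rewrite !inE // ltxx.
by exists P, (i + k)%N, (j + l)%N; split=> //; apply: ple_trans sR.
Qed.

Lemma sink_above R : exists Q i j, sink Q /\ ple i j R Q.
Proof.
pose upper R := [pred s | X R + Y R < X s + Y s].
elim: {R}_.+1 {-2}R (ltnSn #|upper R|) => // m IH R; rewrite ltnS => cR.
have [sR|] := boolP (sink R); first by exists R, 0%N, 0%N; rewrite ple00.
rewrite negb_forall => /existsP[s]; rewrite negb_and => esR.
have {esR} [i [j sR ij]] : exists i, exists2 j, ple i j R s & (0 < i + j)%N.
  by case/orP: esR; [exists 1%N, 0%N|exists 0%N, 1%N];
     rewrite // /ple ?mono10 ?mono01.
have [Xs Ys] := ple_deg sR.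
have sm : X R + Y R < X s + Y s.
  rewrite Xs Ys addrACA -natrD ltrDl ltr0n //.
have /IH[Q [k [l [sQ Qs]]]] : (#|upper s| < m)%N.
  apply: leq_trans cR; apply: proper_card; apply/properP; split.
    by apply/subsetP=> u; rewrite !inE; apply: lt_trans.
  by exists s; rewrite !inE // ltxx.
by exists Q, (k + i)%N, (l + j)%N; split=> //; apply: ple_trans Qs.
Qed.

(* The exponents are determined by the weights, so that the order is decidable. *)
Definition below P R :=
  ple (Num.truncn (X R - X P)) (Num.truncn (Y R - Y P)) P R.

Lemma belowP P R : reflect (exists i j, ple i j P R) (below P R).
Proof.
apply: (iffP idP) => [PR|[i [j PR]]]; first by eexists _, _; apply: PR.
rewrite /below; have [-> ->] := ple_deg PR.
by rewrite (addrC (X P)) (addrC (Y P)) !addrK !natrK.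
Qed.

End Grid.

Lemma monoC (K : fieldType) n (X Y : 'I_n -> rat) (e1 e2 : 'M[K]_n) i j : grid X Y e1 e2 ->
  mono e2 e1 j i = mono e1 e2 i j.
Proof.
move=> G; rewrite /mono !mulmxE; apply/esym.
by apply: commrX; apply/commr_sym/commrX/commr_sym/(grid_comm G).
Qed.

Lemma pleC (K : fieldType) n (X Y : 'I_n -> rat) (e1 e2 : 'M[K]_n) i j P R : grid X Y e1 e2 ->
  ple e2 e1 j i P R = ple e1 e2 i j P R.
Proof. by move=> G; rewrite /ple (monoC _ _ G). Qed.

Lemma belowC (K : fieldType) n (X Y : 'I_n -> rat) (e1 e2 : 'M[K]_n) P R : grid X Y e1 e2 ->
  below Y X e2 e1 P R = below X Y e1 e2 P R.
Proof. by move=> G; rewrite /below (pleC _ _ _ _ G). Qed.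

Lemma genC (K : fieldType) n (e1 e2 : 'M[K]_n) P : gen e2 e1 P = gen e1 e2 P.
Proof. by apply: eq_forallb => s; rewrite andbC. Qed.

Lemma sinkC (K : fieldType) n (e1 e2 : 'M[K]_n) P : sink e2 e1 P = sink e1 e2 P.
Proof. by apply: eq_forallb => s; rewrite andbC. Qed.

(** * Commutators with graded matrices and Engel's argument *)

Section AdMatrix.

Variables (K : fieldType) (n : nat).
Implicit Types (A B e : 'M[K]_n).

Definition admx e A := e *m A - A *m e.

Lemma admx_is_linear e : linear (admx e).
Proof.
move=> a A B; rewrite /admx mulmxDr mulmxDl -scalemxAr -scalemxAl scalerBr.
by rewrite opprD addrACA.
Qed.

HB.instance Definition _ e :=
  GRing.isLinear.Build K 'M[K]_n 'M[K]_n _ (admx e) (admx_is_linear e).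

Lemma admxE e A s t : admx e A s t = (e *m A) s t - (A *m e) s t.
Proof. by rewrite [LHS]mxE [X in _ + X]mxE. Qed.

Lemma admx_eq0 e A : (admx e A == 0) = (e *m A == A *m e).
Proof. by rewrite subr_eq0. Qed.

Lemma admx_jacobi e f A : admx e (admx f A) = admx (admx e f) A + admx f (admx e A).
Proof.
rewrite /admx !mulmxBl !mulmxBr !mulmxA !opprB.
move: (e *m f *m A) (e *m A *m f) (f *m A *m e) (A *m f *m e) (f *m e *m A) (A *m e *m f).
move=> a b c d u v; rewrite (addrACA (a - u)) !subrKA (addrACA a (- b)) (addrACA a (- c)).
by rewrite (addrC (- b)).
Qed.

Lemma admxC e f A : e *m f = f *m e -> admx e (admx f A) = admx f (admx e A).
Proof.
by move=> ef; rewrite admx_jacobi [admx e f]/admx ef subrr /admx mul0mx mulmx0 subrr add0r.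
Qed.

(** Commutation with [e] raises the first degree of an entry by one, while all differences of
    weights lie strictly between [-D] and [D]. *)
Lemma admx_nilpotent (X : 'I_n -> rat) (V : zmodType) (Y : 'I_n -> V) e :
  homog X Y 1 0 e -> exists m, forall A, iter m (admx e) A = 0.
Proof.
move=> he; pose D := (\sum_(u : 'I_n * 'I_n) Num.bound (X u.1 - X u.2))%N.
have HD s t : `|X s - X t| < D%:R.
  apply: lt_le_trans (archi_boundP (normr_ge0 _)) _.
  rewrite /Num.bound normr_id -/(Num.bound (X s - X t)) ler_nat.
  by rewrite /D (bigD1 (s, t)) //= leq_addr.
have low k A s t : iter k (admx e) A s t != 0 -> k%:R - D%:R < X s - X t.
  elim: k s t => [|k IH] s t.
    by move=> _; have := HD s t; rewrite ltr_norml sub0r => /andP[].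
  rewrite iterS admxE => neq0; set B := iter k _ _ in neq0 IH.
  have [/mulmx_neq0[u /he[Xs _] /IH]|/negbNE/eqP eB0] := boolP ((e *m B) s t != 0).
    by rewrite Xs -natr1; lra.
  have /mulmx_neq0[u /IH Bu /he[Xu _]] : (B *m e) s t != 0.
    by apply: contra_neq neq0 => ->; rewrite eB0 subrr.
  by move: Bu; rewrite Xu -natr1; lra.
exists (D + D)%N => A; apply/matrixP=> s t; rewrite mxE; apply/eqP.
apply/negP=> /negP /low; rewrite natrD addrK => Dlt.
by have := HD s t; rewrite ltr_norml => /andP[_ /(lt_trans Dlt)]; rewrite ltxx.
Qed.

End AdMatrix.

Lemma nilpotent_ker (K : fieldType) (vT : vectType K) (N : 'End(vT)) (W : {vspace vT}) m :
  (W != 0)%VS -> (N @: W <= W)%VS -> (forall v, iter m N v = 0) ->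
  (W :&: lker N != 0)%VS.
Proof.
move=> Wn0 NW Nm; apply/negP=> /eqP W0.
have inj v : v \in W -> N v = 0 -> v = 0.
  move=> Wv Nv; apply/eqP; rewrite -memv0 -W0 memv_cap Wv memv_ker Nv.
  by rewrite eqxx.
have Wi k v : v \in W -> iter k N v \in W.
  by move=> Wv; elim: k => //= k IH; apply: (subvP NW); apply: memv_img.
have inji k v : v \in W -> iter k N v = 0 -> v = 0.
  by move=> Wv; elim: k => //= k IH /inj Nk; apply/IH/Nk/Wi.
case/eqP: Wn0; apply/eqP; rewrite -subv0; apply/subvP=> v Wv.
by rewrite (inji m v Wv (Nm v)) mem0v.
Qed.

Lemma nilpotent_ker2 (K : fieldType) (vT : vectType K) (N1 N2 : 'End(vT))
    (W : {vspace vT}) m1 m2 :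
  (W != 0)%VS -> (N1 @: W <= W)%VS -> (N2 @: W <= W)%VS ->
  (forall v, N2 (N1 v) = N1 (N2 v)) ->
  (forall v, iter m1 N1 v = 0) -> (forall v, iter m2 N2 v = 0) ->
  exists v, [/\ v \in W, v != 0, N1 v = 0 & N2 v = 0].
Proof.
move=> Wn0 W1 W2 N12 N1m N2m.
have W2' : (N2 @: (W :&: lker N1) <= W :&: lker N1)%VS.
  apply/subvP=> w /memv_imgP[v /memv_capP[Wv]]; rewrite memv_ker => /eqP N1v ->.
  rewrite memv_cap memv_ker -N12 N1v linear0 eqxx andbT.
  by apply: (subvP W2); apply: memv_img.
have W' := nilpotent_ker (nilpotent_ker Wn0 W1 N1m) W2' N2m.
have vW := memv_pick (W :&: lker N1 :&: lker N2)%VS.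
exists (vpick (W :&: lker N1 :&: lker N2)); rewrite vpick0.
by move: vW; rewrite !memv_cap !memv_ker => /andP[/andP[-> /eqP ->] /eqP ->].
Qed.

(** * The core of a centralizer *)

Lemma sum_comm (K : fieldType) n (U V : zmodType) (X : 'I_n -> U) (Y : 'I_n -> V)
    (A B : 'M[K]_n) :
  (forall p q, B *m hcomp X Y p q A = hcomp X Y p q A *m B) -> B *m A = A *m B.
Proof.
move=> H; rewrite -[A](sum_hcomp X Y) mulmx_sumr mulmx_suml.
by apply: eq_bigr => d _.
Qed.

Section OffSupport.

Variables (K : fieldType) (n : nat) (S : rel 'I_n).

(** A support condition becomes the kernel of a linear map, so that the matrices supported on [S]
    form a [vspace]. As for [ple], the source comes first in [S]. *)
Definition offpart (A : 'M[K]_n) : 'M[K]_n :=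
  \matrix_(R, P) if S P R then 0 else A R P.

Lemma offpart_is_linear : linear offpart.
Proof.
move=> a A B; apply/matrixP=> s t; rewrite !mxE.
by case: ifP => _ //; rewrite mulr0 addr0.
Qed.

HB.instance Definition _ :=
  GRing.isLinear.Build K 'M[K]_n 'M[K]_n _ offpart offpart_is_linear.

Lemma offpart_eq0 (A : 'M[K]_n) : reflect (forall R P, A R P != 0 -> S P R) (offpart A == 0).
Proof.
apply: (iffP eqP) => [/matrixP A0 R P|SA].
  by have := A0 R P; rewrite !mxE; case: ifP => // _ ->; rewrite eqxx.
apply/matrixP=> R P; rewrite !mxE; case: ifP => // nS.
by have [//|/eqP /SA] := A R P =P 0; rewrite nS.
Qed.

End OffSupport.

Section Core.

Variables (K : fieldType) (n : nat) (X Y : 'I_n -> rat) (e1 e2 : 'M[K]_n).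
Hypothesis G : grid X Y e1 e2.
Variable Z : {vspace 'M[K]_n}.
Hypothesis Zcomm : forall A, A \in Z -> A *m e1 = e1 *m A /\ A *m e2 = e2 *m A.
Hypothesis Zcomp : forall p q A, A \in Z -> hcomp X Y p q A \in Z.

Local Notation mono := (mono e1 e2).
Local Notation ple := (ple e1 e2).
Local Notation below := (below X Y e1 e2).
Local Notation gen := (gen e1 e2).
Local Notation sink := (sink e1 e2).
Local Notation homog := (homog X Y).

Definition core : {vspace 'M[K]_n} := (Z :&: lker (linfun (@offpart K n below)))%VS.

Lemma coreP A : reflect (A \in Z /\ forall R P, A R P != 0 -> below P R) (A \in core).
Proof.
rewrite memv_cap memv_ker lfunE /=.
by apply: (iffP andP) => [[ZA /offpart_eq0]|[ZA /offpart_eq0]].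
Qed.

Lemma core_hcomp p q A : A \in core -> hcomp X Y p q A \in core.
Proof.
case/coreP=> ZA bA; apply/coreP; split=> [|R P]; first exact: Zcomp.
by rewrite mxE; case: ifP => _; [apply: bA|rewrite eqxx].
Qed.

Lemma Zmono A i j : A \in Z -> A *m mono i j = mono i j *m A.
Proof.
move=> /Zcomm[A1 A2]; rewrite monoE !mulmxE.
by apply: commrM; apply: commrX.
Qed.

(* Homogeneous core elements are [e1^i e2^j] times this diagonal matrix, whose
   entries are constant along the order ([core_coef], [core_coef_const]). *)
Definition coef i j (A : 'M[K]_n) P : K := \sum_R A R P / mono i j R P.

Section HomogeneousCore.

Variables (i j : nat) (A : 'M[K]_n).
Hypothesis cA : A \in core.
Hypothesis hA : homog i%:R j%:R A.

Lemma core_ple R P : A R P != 0 -> ple i j P R.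
Proof.
move=> A_neq0; have /coreP[_ /(_ _ _ A_neq0)] := cA.
case/(belowP G)=> k [l kl]; have [Xk Yl] := ple_deg G kl.
have [] := hA A_neq0; rewrite Xk Yl => /addrI /eqP + /addrI /eqP.
by rewrite !eqr_nat => /eqP <- /eqP <-.
Qed.

Lemma core_coef R P : A R P = mono i j R P * coef i j A P.
Proof.
have [PR|] := boolP (ple i j P R); last first.
  by move=> nPR; move: (nPR) => /negbNE/eqP->; rewrite mul0r;
     apply/eqP; apply: contraR nPR => /core_ple.
rewrite /coef (bigD1 R) //= big1 ?addr0 => [|R' neq]; first by rewrite mulrC divfK.
have [/core_ple PR'|/negbNE/eqP ->] := boolP (A R' P != 0); last by rewrite mul0r.
by rewrite (ple_tgt G PR PR') eqxx in neq.
Qed.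

(** Commutation of [A] with [mono k l] is read on the entry from [P] to [N]. The path from [M] to
    [N] matters: where [mono i j] kills [M], the coefficient at [M] is zero by convention. *)
Lemma core_coef_const k l P M N :
  ple k l P M -> ple i j M N -> coef i j A P = coef i j A M.
Proof.
move=> PM MN; have PN := ple_trans G PM MN.
have PN' := PN; rewrite addnC (addnC j) in PN'.
have [R PR RN] := ple_split G PN'.
have ZA : A \in Z by case/coreP: cA.
have := congr1 (fun B : 'M_n => B N P) (Zmono k l ZA) => /=.
rewrite (mulmx_coluniq _ _ (pinj_mono G _ _) PM).
rewrite (mulmx_rowuniq _ _ (pinj_mono G _ _) RN) !core_coef.
have := congr1 (fun B : 'M_n => B N P) (monoD G i j k l) => /=.
have := congr1 (fun B : 'M_n => B N P) (monoD G k l i j) => /=.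
rewrite addnC (addnC l) => ->.
rewrite (mulmx_coluniq _ _ (pinj_mono G _ _) PR).
rewrite (mulmx_coluniq _ _ (pinj_mono G _ _) PM) => e.
rewrite [RHS]mulrA e [LHS]mulrAC => /mulfI H.
by apply/esym/H; rewrite mulf_neq0.
Qed.

End HomogeneousCore.

Lemma homog_core_nat p q A : A \in core -> homog p q A ->
  A = 0 \/ exists i j, p = i%:R /\ q = j%:R.
Proof.
move=> /coreP[_ bA] hA.
case: (pickP (fun u : 'I_n * 'I_n => A u.1 u.2 != 0)) => [[R P] /= A_neq0|A0].
  right; have /(belowP G)[i [j /(ple_deg G)]] := bA _ _ A_neq0.
  have [-> ->] := hA _ _ A_neq0 => -[/addrI -> /addrI ->].
  by exists i, j.
left; apply/matrixP=> R P; rewrite mxE; apply/eqP.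
by have := A0 (R, P); move/negbFE.
Qed.

(** On homogeneous elements, constancy of the coefficients along paths makes either product equal to
    the monomial of the added exponents times the product of the two coefficients, which is
    symmetric. *)
Lemma core_abelian A B : A \in core -> B \in core -> A *m B = B *m A.
Proof.
have key A' B' i j k l : A' \in core -> homog i%:R j%:R A' ->
    B' \in core -> homog k%:R l%:R B' ->
    forall R P, (A' *m B') R P = mono (i + k) (j + l) R P * (coef i j A' P * coef k l B' P).
  move=> cA hA cB hB R P; rewrite (monoD G).
  have -> : (A' *m B') R P = (A' *m mono k l) R P * coef k l B' P.
    rewrite !mxE mulr_suml; apply: eq_bigr => M _.
    by rewrite (core_coef cB hB) mulrA.
  rewrite mulrA; congr (_ * _).
  have [M PM|nM] := pickP (ple k l P).
    rewrite !(mulmx_coluniq _ _ (pinj_mono G _ _) PM) (core_coef cA hA).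
    rewrite [RHS]mulrAC; congr (_ * _).
    have [MR|/negbNE/eqP ->] := boolP (ple i j M R); last by rewrite !mul0r.
    by rewrite (core_coef_const cA hA PM MR).
  rewrite !mxE !big1 ?mul0r // => M _; have /negbFE/eqP -> := nM M;
    by rewrite mulr0.
move=> cA cB; apply: (@sum_comm _ _ _ _ X Y) => p q; apply/esym.
apply: (@sum_comm _ _ _ _ X Y) => p' q'.
have cA' := core_hcomp p' q' cA; have cB' := core_hcomp p q cB.
have hA := @hcomp_homog _ _ _ _ X Y p' q' A.
have hB := @hcomp_homog _ _ _ _ X Y p q B.
have [->|[i [j [ep eq]]]] := homog_core_nat cA' hA; first by rewrite mul0mx mulmx0.
have [->|[k [l [ep' eq']]]] := homog_core_nat cB' hB; first by rewrite mul0mx mulmx0.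
rewrite {}ep {}eq {}ep' {}eq' in cA' hA cB' hB *.
apply/matrixP=> R P; rewrite (key _ _ _ _ _ _ cA' hA cB' hB).
by rewrite (key _ _ _ _ _ _ cB' hB cA' hA) addnC (addnC l) (mulrC (coef i j _ P)).
Qed.

Hypothesis Zdim : (\dim Z <= (\dim core).+1)%N.

Lemma core_codim1 y z : y \in Z -> y \notin core -> z \in Z ->
  exists a, z - a *: y \in core.
Proof.
move=> Zy ncy Zz.
have coreZ : (core <= Z)%VS by apply: capvSl.
have eZ : (core + <[y]> = Z)%VS.
  apply/eqP; rewrite eqEdim subv_add coreZ -memvE Zy /=.
  apply: leq_trans Zdim _; rewrite ltn_neqAle dimvS ?addvSl // andbT.
  apply: contra ncy => /eqP dim_eq.
  have /eqP -> : (core == core + <[y]>)%VS by rewrite eqEdim addvSl dim_eq /=.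
  by apply: (subvP (addvSr _ _)); apply: memv_line.
move: Zz; rewrite -eZ => /memv_addP[c cc [w /vlineP[a ->] ->]].
by exists a; rewrite addrK.
Qed.

Hypothesis nonabelian : exists A B, [/\ A \in Z, B \in Z & A *m B != B *m A].

(** Otherwise [Z] would be spanned by the abelian core and one element commuting with it, hence
    abelian. *)
Lemma core_of_central y : y \in Z -> (forall A, A \in core -> A *m y = y *m A) ->
  y \in core.
Proof.
move=> Zy yC; apply/negPn/negP=> ncy.
case: nonabelian => A [B [ZA ZB]] /eqP; apply.
have [a cA] := core_codim1 Zy ncy ZA; have [b cB] := core_codim1 Zy ncy ZB.
rewrite -(subrK (a *: y) A) -(subrK (b *: y) B).
move: (A - _) (B - _) cA cB => A' B' cA cB.
rewrite !mulmxDl !mulmxDr -!scalemxAl -!scalemxAr (core_abelian cA cB) (yC _ cA) (yC _ cB).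
rewrite -!addrA; congr (_ + _); rewrite addrCA; congr (_ + (_ + _)).
by rewrite !scalerA mulrC.
Qed.

(** The quotient of [Z] by the core is graded and spanned by the class of [x], so it has no other
    degree. *)
Lemma core_other x p q y p' q' : x \in Z -> x \notin core -> homog p q x ->
  y \in Z -> homog p' q' y -> (p, q) != (p', q') -> y \in core.
Proof.
move=> Zx ncx hx Zy hy neq; have [a cya] := core_codim1 Zx ncx Zy.
have := core_hcomp p' q' cya; rewrite linearB linearZ /=.
by rewrite (homog_hcomp0 hx neq) scaler0 subr0 (homog_hcomp hy).
Qed.

Lemma core_nonneg y p q : y \in core -> homog p q y -> y != 0 ->
  (0 <= p) && (0 <= q).
Proof.
move=> cy hy y0; have [y0'|[i [j [-> ->]]]] := homog_core_nat cy hy.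
  by rewrite y0' eqxx in y0.
by rewrite !ler0n.
Qed.

(* [y] and [y'] would be independent modulo the core, which has codimension 1. *)
Lemma core_opposite z y y' a : [pchar K] =i pred0 -> z \in core -> y \in Z -> y' \in Z ->
  a != 0 -> y != 0 -> y' != 0 ->
  admx z y = a *: y -> admx z y' = - a *: y' -> False.
Proof.
move=> char0 cz Zy Zy' a0 y0 y0' zy zy'.
have [cy|ncy] := boolP (y \in core).
  move: zy; rewrite /admx (core_abelian cz cy) subrr => /esym/eqP.
  by rewrite scaler_eq0 (negPf a0) (negPf y0).
have [b cb] := core_codim1 Zy ncy Zy'.
have : admx z (y' - b *: y) = 0 by rewrite /admx (core_abelian cz cb) subrr.
rewrite linearB linearZ /= zy zy' => /eqP; rewrite subr_eq0 => /eqP eq1.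
have eq2 : y' = - b *: y.
  apply: (scalerI (a := - a)); first by rewrite oppr_eq0.
  by rewrite eq1 !scalerA mulrNN mulrC.
have : admx z y' = a *: y' by rewrite {1}eq2 linearZ /= zy scalerA mulrC -scalerA -eq2.
move/eqP; rewrite zy' -subr_eq0 -scalerBl scaler_eq0 (negPf y0') orbF -opprD oppr_eq0.
by rewrite -mulr2n -mulr_natl mulf_eq0 (negPf a0) orbF ((pcharf0P K).1 char0).
Qed.

(* Two paths [P -> M -> R] and [P -> T -> R], one through [c] then [x], the other
   through [x] then [c], whose contributions to [[x, c]] differ. *)
Record failure x p q c i j P T M R : Prop := Failure {
  fail_x : x \in Z;
  fail_nx : x \notin core;
  fail_hx : homog p q x;
  fail_c : c \in core;
  fail_hc : homog i%:R j%:R c;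
  fail_gen : gen P;
  fail_PT : x T P != 0;
  fail_PM : ple i j P M;
  fail_MR : x R M != 0;
  fail_TR : ple i j T R;
  fail_coef : coef i j c P != coef i j c T }.

(** A homogeneous [x] outside the core fails to commute with some homogeneous [c] of the core, by
    [core_of_central]. As [x] commutes with the monomials, an entry where [x *m c] and [c *m x]
    differ can only come from two different coefficients of [c]. *)
Lemma nonabelian_failure : exists x p q c i j P T M R, failure x p q c i j P T M R.
Proof.
have [x0 Zx0 ncx0] : exists2 x, x \in Z & x \notin core.
  case: nonabelian => A [B [ZA ZB AB]].
  have [cA|] := boolP (A \in core); last by exists A.
  have [cB|] := boolP (B \in core); last by exists B.
  by case/eqP: AB; apply: core_abelian.
have [x [p [q [Zx ncx hx]]]] : exists x p q, [/\ x \in Z, x \notin core & homog p q x].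
  have [/hasP[d _ ncd]|/hasPn all_c] :=
    boolP (has (fun d => hcomp X Y d.1 d.2 x0 \notin core) (degrees X Y)).
    exists (hcomp X Y d.1 d.2 x0), d.1, d.2.
    by split; [apply: Zcomp| |apply: hcomp_homog].
  case/negP: ncx0; rewrite -(sum_hcomp X Y x0) big_seq.
  by apply: memv_suml => d /all_c /negPn.
have [c0 cc0 xc0] : exists2 c, c \in core & x *m c != c *m x.
  case: (boolP [forall k : 'I_(\dim core), x *m (vbasis core)`_k == (vbasis core)`_k *m x]).
    move/forallP=> xb; case/negP: ncx; apply: core_of_central => // A.
    move/coord_vbasis=> ->; rewrite mulmx_suml mulmx_sumr; apply: eq_bigr => k _.
    by rewrite -scalemxAl -scalemxAr (eqP (xb k)).
  rewrite negb_forall => /existsP[k xb]; exists (vbasis core)`_k => //.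
  by apply: vbasis_mem; apply: mem_nth; rewrite size_tuple.
have [c [i [j [cc hc xc]]]] : exists c i j,
    [/\ c \in core, homog i%:R j%:R c & x *m c != c *m x].
  have [/hasP[d _ xd]|/hasPn all_c] := boolP (has (fun d =>
      x *m hcomp X Y d.1 d.2 c0 != hcomp X Y d.1 d.2 c0 *m x) (degrees X Y)).
    have hd := @hcomp_homog _ _ _ _ X Y d.1 d.2 c0.
    have cd := core_hcomp d.1 d.2 cc0.
    have [d0|[i [j [ei ej]]]] := homog_core_nat cd hd.
      by rewrite d0 mulmx0 mul0mx eqxx in xd.
    by exists (hcomp X Y d.1 d.2 c0), i, j; rewrite -ei -ej.
  case/eqP: xc0; rewrite -[c0](sum_hcomp X Y) mulmx_sumr mulmx_suml.
  by rewrite big_seq [RHS]big_seq; apply: eq_bigr => d /all_c /negPn/eqP.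
have [[R0 P0] /= xcRP] : exists u : 'I_n * 'I_n, (x *m c) u.1 u.2 != (c *m x) u.1 u.2.
  apply/existsP; rewrite -negb_forall; apply: contra xc => /forallP eqx.
  by apply/eqP/matrixP=> R P; apply/eqP: (eqx (R, P)).
have eR : (x *m c) R0 P0 = (x *m mono i j) R0 P0 * coef i j c P0.
  rewrite !mxE mulr_suml; apply: eq_bigr => M _.
  by rewrite (core_coef cc hc) mulrA.
have eL T : ple i j T R0 -> (c *m x) R0 P0 = coef i j c T * (mono i j *m x) R0 P0.
  move=> TR; rewrite (mulmx_rowuniq _ _ (pinj_mono G _ _) TR).
  rewrite mxE (bigD1 T) //= big1 ?addr0 => [|T' neq].
    by rewrite (core_coef cc hc) mulrA (mulrC (coef _ _ _ _)).
  rewrite (core_coef cc hc).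
  have [TR'|/negbNE/eqP ->] := boolP (ple i j T' R0); last by rewrite !mul0r.
  by rewrite (ple_src G TR TR') eqxx in neq.
have xm : x *m mono i j = mono i j *m x by apply: Zmono.
have xm0 : (mono i j *m x) R0 P0 != 0.
  apply: contraNneq xcRP => xm0; rewrite eR xm xm0 mul0r.
  have [T TR|nT] := pickP (ple i j ^~ R0); first by rewrite (eL T) // xm0 mulr0.
  rewrite mxE big1 // => T _; rewrite (core_coef cc hc).
  by have := nT T; move=> /negbFE/eqP ->; rewrite !mul0r.
have [T0 TR0 xTP0] := mulmx_neq0 xm0.
have [M0 xRM0 PM0] : exists2 M, x R0 M != 0 & ple i j P0 M.
  by apply: mulmx_neq0; rewrite xm.
have neq0 : coef i j c P0 != coef i j c T0.
  by apply: contraNneq xcRP => eq_c; rewrite eR (eL _ TR0) xm eq_c mulrC.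
have [P [k [l [gP PP0]]]] := gen_below G P0.
have xkl : x *m mono k l = mono k l *m x by apply: Zmono.
have [T TT0 xTP] : exists2 T, ple k l T T0 & x T P != 0.
  by apply: mulmx_neq0; rewrite -xkl (mulmx_coluniq _ _ (pinj_mono G _ _) PP0) mulf_neq0.
have cP := core_coef_const cc hc PP0 PM0.
have cT := core_coef_const cc hc TT0 TR0.
have := ple_trans G PP0 PM0; rewrite addnC (addnC j) => /(ple_split G)[M PM MM0].
have := ple_trans G TT0 TR0; rewrite addnC (addnC j) => /(ple_split G)[R TR RR0].
exists x, p, q, c, i, j, P, T, M, R; split=> //; last by rewrite cP cT.
have : (x *m mono i j) R P != 0.
  by rewrite xm (mulmx_rowuniq _ _ (pinj_mono G _ _) TR) mulf_neq0.
by rewrite (mulmx_coluniq _ _ (pinj_mono G _ _) PM); apply: contraNneq => ->; rewrite mul0r.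
Qed.

End Core.

(** * Full matrix algebras *)

Section Centralizer.

Variables (K : fieldType) (n : nat).
Implicit Types (e A B : 'M[K]_n) (g : {vspace 'M[K]_n}).

Definition centr g e1 e2 : {vspace 'M[K]_n} :=
  (g :&: (lker (linfun (admx e1)) :&: lker (linfun (admx e2))))%VS.

Lemma centrP g e1 e2 A :
  reflect [/\ A \in g, A *m e1 = e1 *m A & A *m e2 = e2 *m A] (A \in centr g e1 e2).
Proof.
rewrite !memv_cap !memv_ker !lfunE /= !admx_eq0 !(eq_sym (_ *m A)).
by apply: (iffP and3P) => -[Ag /eqP A1 /eqP A2]; split=> //; apply/eqP.
Qed.

Lemma centr_comm g e1 e2 A : A \in centr g e1 e2 ->
  A *m e1 = e1 *m A /\ A *m e2 = e2 *m A.
Proof. by case/centrP. Qed.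

Lemma centrC g e1 e2 : centr g e2 e1 = centr g e1 e2.
Proof. by rewrite /centr [(lker _ :&: _)%VS]capvC. Qed.

Lemma centr_hcomp g e1 e2 (U V : zmodType) (X : 'I_n -> U) (Y : 'I_n -> V) p1 q1 p2 q2 :
  homog X Y p1 q1 e1 -> homog X Y p2 q2 e2 ->
  (forall p q A, A \in g -> hcomp X Y p q A \in g) ->
  forall p q A, A \in centr g e1 e2 -> hcomp X Y p q A \in centr g e1 e2.
Proof.
move=> h1 h2 hg p q A /centrP[Ag A1 A2]; apply/centrP.
by split; [apply: hg|apply: hcomp_comm h1 _|apply: hcomp_comm h2 _].
Qed.

(* Engel: [ad e1] and [ad e2] are nilpotent on the [a]-eigenspace of [ad z]. *)
Lemma opposite_exists g e1 e2 (X Y : 'I_n -> rat) z a B :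
  homog X Y 1 0 e1 -> homog X Y 0 1 e2 -> e1 *m e2 = e2 *m e1 ->
  (forall A, A \in g -> admx e1 A \in g) -> (forall A, A \in g -> admx e2 A \in g) ->
  z *m e1 = e1 *m z -> z *m e2 = e2 *m z ->
  B \in g -> B != 0 -> admx z B = a *: B ->
  exists2 y, y \in centr g e1 e2 & y != 0 /\ admx z y = a *: y.
Proof.
move=> h1 h2 e12 g1 g2 z1 z2 Bg B0 zB.
pose E := (g :&: lker (linfun (admx z) - a *: \1%VF))%VS.
have memE A : (A \in E) = (A \in g) && (admx z A == a *: A).
  by rewrite memv_cap memv_ker !lfunE /= !lfunE /= !lfunE /= id_lfunE subr_eq0.
have E0 : (E != 0)%VS.
  by apply: contraNneq B0 => E0; rewrite -memv0 -E0 memE Bg zB eqxx.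
have stab e : z *m e = e *m z -> (forall A, A \in g -> admx e A \in g) ->
    (linfun (admx e) @: E <= E)%VS.
  move=> ze ge; apply/subvP=> A /memv_imgP[A']; rewrite memE => /andP[gA /eqP zA] ->.
  rewrite memE lfunE /= ge //= admxC // zA linearZ /=.
  by [].
have h2' : homog Y X 1 0 e2 by move=> s t /h2[].
have [m1 nil1] := admx_nilpotent h1; have [m2 nil2] := admx_nilpotent h2'.
have iterE e m A : iter m (linfun (admx e)) A = iter m (admx e) A.
  by elim: m => //= m ->; rewrite lfunE.
have [|y [Ey y0 y1 y2]] := nilpotent_ker2 E0 (stab _ z1 g1) (stab _ z2 g2) _
  (fun A => etrans (iterE _ m1 A) (nil1 A)) (fun A => etrans (iterE _ m2 A) (nil2 A)).
  by move=> A; rewrite !lfunE /= admxC.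
move: Ey; rewrite memE => /andP[gy /eqP zy]; exists y => //.
move: y1 y2; rewrite !lfunE /= => /eqP + /eqP; rewrite !admx_eq0 => /eqP y1 /eqP y2.
exact/centrP.
Qed.

End Centralizer.

Lemma coreC (K : fieldType) n (X Y : 'I_n -> rat) (e1 e2 : 'M[K]_n) Z :
  grid X Y e1 e2 -> core Y X e2 e1 Z = core X Y e1 e2 Z.
Proof.
move=> G; apply/vspaceP=> A; apply/coreP/coreP=> -[ZA bA]; split=> // R P /bA.
  by rewrite (belowC _ _ G).
by rewrite -(belowC _ _ G).
Qed.

Lemma failureC (K : fieldType) n (X Y : 'I_n -> rat) (e1 e2 : 'M[K]_n) Z
    x p q c i j P T M R : grid X Y e1 e2 ->
  failure X Y e1 e2 Z x p q c i j P T M R -> failure Y X e2 e1 Z x q p c j i P T M R.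
Proof.
move=> G [Zx ncx hx cc hc gP xTP PM xRM TR cPT].
split; rewrite ?(coreC _ G) ?(pleC _ _ _ _ G) 1?genC //.
- by move=> s t /hx[].
- by move=> s t /hc[].
by rewrite /coef (monoC _ _ G).
Qed.

(** * Relative positions of the paths in a failure of commutation *)

Section CrossingWindows.

Variables (K : fieldType) (n : nat) (X Y : 'I_n -> rat) (e1 e2 : 'M[K]_n).
Hypothesis G : grid X Y e1 e2.
Variable Z : {vspace 'M[K]_n}.
Hypothesis Zcomm : forall A, A \in Z -> A *m e1 = e1 *m A /\ A *m e2 = e2 *m A.
Variables (x c : 'M[K]_n) (p q : rat) (i j : nat) (P T M R : 'I_n).
Hypothesis F : failure X Y e1 e2 Z x p q c i j P T M R.

Local Notation ple := (ple e1 e2).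

(** Both paths are long enough to end with the same path of exponents [i], [j] into [Q]. Its
    starting point is unique, and its coefficient is that of [P1] and of [P2]. *)
Lemma coef_window a b a' b' P1 P2 Q : (i <= a)%N -> (j <= b)%N -> ple a b P1 Q ->
  (i <= a')%N -> (j <= b')%N -> ple a' b' P2 Q ->
  coef e1 e2 i j c P1 = coef e1 e2 i j c P2.
Proof.
move=> ia jb P1Q ia' jb' P2Q.
have [N P1N NQ] := ple_splitle G (leq_subr i a) (leq_subr j b) P1Q.
have [N' P2N' N'Q] := ple_splitle G (leq_subr i a') (leq_subr j b') P2Q.
rewrite !subKn // in NQ N'Q.
rewrite (core_coef_const G Zcomm (fail_c F) (fail_hc F) P1N NQ).
rewrite (core_coef_const G Zcomm (fail_c F) (fail_hc F) P2N' N'Q).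
by rewrite (ple_src G NQ N'Q).
Qed.

(** [x *m mono i j] has a nonzero entry from [P] to [R], and [mono k l] divides [mono i j]. *)
Lemma fail_mulx k l : (k <= i)%N -> (l <= j)%N -> mono e1 e2 k l *m x != 0.
Proof.
move=> ki lj; apply/eqP=> klx0.
have := congr1 (fun B : 'M_n => B R P) (Zmono Zcomm i j (fail_x F)) => /=.
rewrite (mulmx_coluniq _ _ (pinj_mono G _ _) (fail_PM F)).
rewrite -(subnK ki) -(subnK lj) (monoD G) -mulmxA klx0 mulmx0 [RHS]mxE.
by move/eqP; rewrite mulf_eq0 (negPf (fail_MR F)) -(monoD G) !subnK // (negPf (fail_PM F)).
Qed.

Variables (Ql Qk Pb : 'I_n) (a1 b1 a2 b2 a3 b3 : nat).
Hypothesis MQl : ple a1 b1 M Ql.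
Hypothesis RQk : ple a2 b2 R Qk.
Hypothesis PbT : ple a3 b3 Pb T.

Let PQl : ple (a1 + i) (b1 + j) P Ql.
Proof. exact: (ple_trans G (fail_PM F) MQl). Qed.

Let TQk : ple (a2 + i) (b2 + j) T Qk.
Proof. exact: (ple_trans G (fail_TR F) RQk). Qed.

Let PbQk : ple (a2 + i + a3) (b2 + j + b3) Pb Qk.
Proof. exact: (ple_trans G PbT TQk). Qed.

Lemma fail_coef_Pb : coef e1 e2 i j c P != coef e1 e2 i j c Pb.
Proof.
by rewrite (core_coef_const G Zcomm (fail_c F) (fail_hc F) PbT (fail_TR F)) (fail_coef F).
Qed.

(** A longer path from [P] to [Qk] would share its last window with the path from [Pb], and the two
    coefficients of [c] would agree. *)
Lemma fail_notwindow a b : ple a b P Qk -> (a < i)%N || (b < j)%N.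
Proof.
move=> PQk; rewrite !ltnNge -negb_and; apply: contra fail_coef_Pb => /andP[ia jb].
apply/eqP; apply: (coef_window _ _ PQk _ _ PbQk) => //; lia.
Qed.

Lemma fail_notwindow' a b : ple a b Pb Ql -> (a < i)%N || (b < j)%N.
Proof.
move=> PbQl; rewrite !ltnNge -negb_and; apply: contra fail_coef_Pb => /andP[ia jb].
apply/eqP; apply: (coef_window _ _ PQl _ _ PbQl) => //; lia.
Qed.

(** Comparing weights along the four paths: [a < i] makes [p] negative, puts [Pb] to the left of [P]
    and makes [a'] exceed [i]. The path from [Pb] to [Ql] can then only be too short in the second
    direction, so [Pb] lies above [P]. *)
Lemma crossing_left a b a' b' : ple a b P Qk -> ple a' b' Pb Ql -> (a < i)%N ->
  [/\ (b' < j)%N, p < 0, 0 < q, X Pb < X P & Y P < Y Pb].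
Proof.
move=> PQk PbQl ai; have := fail_notwindow' PbQl.
have [XT YT] := fail_hx F (fail_PT F).
have [X1 Y1] := ple_deg G PQk; have [X2 Y2] := ple_deg G PbQl.
have [X3 Y3] := ple_deg G PQl; have [X4 Y4] := ple_deg G TQk.
have [X5 Y5] := ple_deg G PbT.
have ai' : a%:R < i%:R :> rat by rewrite ltr_nat.
rewrite !natrD in X3 X4 Y3 Y4.
have p0 : p < 0 by have := ler0n rat a2; lra.
have PbP : X Pb < X P by have := ler0n rat a3; lra.
have ia' : (i < a')%N by rewrite -(ltr_nat rat); have := ler0n rat a1; lra.
rewrite ltnNge (ltnW ia') /= => b'j.
have b'j' : b'%:R < j%:R :> rat by rewrite ltr_nat.
have PPb : Y P < Y Pb by have := ler0n rat b1; lra.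
by split=> //; have := ler0n rat b3; lra.
Qed.

End CrossingWindows.

Section TypeA.

Variables (K : fieldType) (n : nat) (X Y : 'I_n -> rat) (e1 e2 : 'M[K]_n).
Hypothesis char0 : [pchar K] =i pred0.
Hypothesis G : grid X Y e1 e2.
Variable Z : {vspace 'M[K]_n}.
Hypothesis HZ : Z = centr fullv e1 e2.
Hypothesis Zdim : (\dim Z <= (\dim (core X Y e1 e2 Z)).+1)%N.

Let Zcomm A : A \in Z -> A *m e1 = e1 *m A /\ A *m e2 = e2 *m A.
Proof. by rewrite HZ; apply: centr_comm. Qed.

Let Zcomp p q A : A \in Z -> hcomp X Y p q A \in Z.
Proof.
by rewrite HZ; apply: centr_hcomp (grid_h1 G) (grid_h2 G) _ _ _ _ => *; apply: memvf.
Qed.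

Lemma diag_entry (D B : 'M[K]_n) s t : homog X Y 0 0 D ->
  D \in core X Y e1 e2 Z -> (D *m B) s t = D s s * B s t /\ (B *m D) s t = B s t * D t t.
Proof.
move=> hD cD; have dD u v : u != v -> D u v = 0.
  move=> uv; apply/eqP; apply: contraNT uv => /(core_ple G cD (i:=0) (j:=0) hD).
  by rewrite ple00 eq_sym.
rewrite !mxE (bigD1 s) //= big1 ?addr0 => [|u su]; last by rewrite dD ?mul0r // eq_sym.
rewrite (bigD1 t) //= big1 ?addr0 // => u su; by rewrite dD ?mulr0.
Qed.

(** If [ad D] has a nonzero eigenvalue [a] on [Z], the transposed elementary matrix has eigenvalue
    [- a], and [opposite_exists] finds this eigenvalue in [Z] too, against [core_opposite]. *)
Lemma diag_centralA D y : homog X Y 0 0 D -> D \in core X Y e1 e2 Z -> y \in Z ->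
  D *m y = y *m D.
Proof.
move=> hD cD Zy; apply/matrixP=> R P.
have [-> ->] := diag_entry y R P hD cD.
apply/eqP/negPn/negP; rewrite (mulrC (D R R)) -subr_eq0 -mulrBr mulf_eq0 negb_or.
case/andP=> yRP; set a := _ - _ => a0.
have /coreP[/Zcomm[D1 D2] _] := cD.
(* The diagonal entries of [D] give a second grading, for which [e1] and [e2] have degree zero. *)
pose W s := D s s.
have hW e : D *m e = e *m D -> homog W (fun=> 0 : K) 0 0 e.
  move=> De s t est; split; last by rewrite addr0.
  have := congr1 (fun B : 'M_n => B s t) De => /=; have [-> ->] := diag_entry e s t hD cD.
  by rewrite mulrC addr0 => /(mulfI est).
have admW b B : homog W (fun=> 0 : K) b 0 B -> admx D B = b *: B.
  move=> hB; apply/matrixP=> s t; rewrite admxE [RHS]mxE.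
  have [-> ->] := diag_entry B s t hD cD.
  have [->|/eqP/hB[Ws _]] := B s t =P 0; first by rewrite !mulr0 mul0r subrr.
  by rewrite -/(W s) -/(W t) Ws mulrDl (mulrC (W t)) addrAC subrr add0r.
have Zy1 : hcomp W (fun=> 0 : K) a 0 y \in Z.
  by move: Zy; rewrite HZ; apply: centr_hcomp (hW _ D1) (hW _ D2) _ _ _ _ => *; apply: memvf.
have y10 : hcomp W (fun=> 0 : K) a 0 y != 0.
  apply: contraNneq yRP => /matrixP/(_ R P); rewrite !mxE addr0 eqxx andbT.
  by rewrite /a addrC subrK eqxx => ->.
have [|||||||y' Zy' [y'0 ey']] := @opposite_exists K n fullv e1 e2 X Y D (- a) (delta_mx P R)
  (grid_h1 G) (grid_h2 G) (grid_comm G).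
- by move=> *; apply: memvf.
- by move=> *; apply: memvf.
- by [].
- by [].
- exact: memvf.
- apply/negP=> /eqP/matrixP/(_ P R)/eqP; by rewrite !mxE !eqxx oner_eq0.
- apply: admW => s t; rewrite mxE; case: andP => [[/eqP -> /eqP ->] _|]; last by rewrite eqxx.
  by rewrite addr0 /a opprB addrC subrK.
rewrite -HZ in Zy'.
exact: core_opposite char0 cD Zy1 Zy' a0 y10 y'0 (admW _ _ (@hcomp_homog _ _ _ _ _ _ _ _ _)) ey'.
Qed.

Hypothesis nab : exists A B, [/\ A \in Z, B \in Z & A *m B != B *m A].

(** The elementary matrix from [P] to [Q] lies in [Z]. A core element acts on it from either side
    through one diagonal entry, since [P] is a source and [Q] a sink; the two entries agree by
    [diag_centralA]. So the matrix is in the core, and its support is a path. *)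
Lemma typeA_all_le P Q : gen e1 e2 P -> sink e1 e2 Q -> exists i j, ple e1 e2 i j P Q.
Proof.
move=> gP sQ; apply/(belowP G).
have dZ : delta_mx Q P \in Z.
  rewrite HZ; apply/centrP; split; first exact: memvf.
    apply/matrixP=> s t; rewrite !mxE !big1 // => u _; rewrite mxE.
      have /andP[/eqP esQ _] := forallP sQ s.
      by case: (u =P Q) => [->|_]; rewrite ?esQ ?mul0r ?mulr0.
    have /andP[/eqP ePt _] := forallP gP t.
    by case: (u =P P) => [->|_]; rewrite ?ePt ?andbF ?mul0r ?mulr0.
  apply/matrixP=> s t; rewrite !mxE !big1 // => u _; rewrite mxE.
    have /andP[_ /eqP esQ] := forallP sQ s.
    by case: (u =P Q) => [->|_]; rewrite ?esQ ?mul0r ?mulr0.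
  have /andP[_ /eqP ePt] := forallP gP t.
  by case: (u =P P) => [->|_]; rewrite ?ePt ?andbF ?mul0r ?mulr0.
suff /coreP[_ /(_ Q P)] : delta_mx Q P \in core X Y e1 e2 Z.
  by rewrite mxE !eqxx oner_eq0 => ->.
apply: (core_of_central G Zcomm Zcomp Zdim nab) => // A cA.
have cD := core_hcomp Zcomp 0 0 cA; have hD := @hcomp_homog _ _ _ _ X Y 0 0 A.
have /coreP[_ bA] := cA.
have := congr1 (fun B : 'M_n => B Q P) (diag_centralA hD cD dZ) => /=.
have [-> ->] := diag_entry (delta_mx Q P) Q P hD cD.
rewrite !mxE !addr0 !eqxx mulr1 mul1r /= => AQP.
apply/matrixP=> s t; rewrite !mxE (bigD1 Q) //= big1 ?addr0 => [|u /negPf uQ]; last first.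
  by rewrite mxE uQ mulr0.
rewrite (bigD1 P) //= big1 ?addr0 => [|u /negPf uP]; last by rewrite mxE uP andbF mul0r.
rewrite !mxE !eqxx /= andbT.
have [->|/eqP tP] := t =P P; last first.
  rewrite mulr0; have [->|/eqP /bA/(belowP G)[i [j /(genP G gP)[_ _ tP']]]] := A P t =P 0.
    by rewrite mulr0.
  by rewrite tP' eqxx in tP.
have [->|/eqP sQ'] := s =P Q; first by rewrite mulr1 mul1r.
rewrite mul0r; have [->|/eqP /bA/(belowP G)[i [j /(sinkP G sQ)[_ _ sQ'']]]] := A s Q =P 0.
  by rewrite mul0r.
by rewrite sQ'' eqxx in sQ'.
Qed.

(** [e2 *m x] is nonzero because [j] is positive, and its degree differs from that of [x]; it would
    lie in the core with first degree [p < 0]. *)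
Lemma typeA_left x c p q i j P T M R j' : failure X Y e1 e2 Z x p q c i j P T M R ->
  (j' < j)%N -> p < 0 -> False.
Proof.
move=> F j'j p0.
have e2x : mono e1 e2 0 1 *m x != 0 by apply: (fail_mulx G Zcomm F) => //; lia.
rewrite mono01 in e2x.
have [Zx1 Zx2] := Zcomm (fail_x F).
have Ze2x : e2 *m x \in Z.
  rewrite HZ; apply/centrP; split; first exact: memvf.
    by rewrite -mulmxA Zx1 !mulmxA (grid_comm G).
  by rewrite -mulmxA Zx2 !mulmxA.
have he2x : homog X Y p (q + 1) (e2 *m x).
  by have := homogM (grid_h2 G) (fail_hx F); rewrite addr0.
have ce2x : e2 *m x \in core X Y e1 e2 Z.
  apply: (core_other Zcomp Zdim (fail_x F) (fail_nx F) (fail_hx F) Ze2x he2x).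
  by apply/eqP=> -[/eqP]; rewrite -subr_eq0 opprD addNKr oppr_eq0 oner_eq0.
have := core_nonneg G ce2x he2x e2x; lra.
Qed.

End TypeA.

Lemma typeA_abelian (K : fieldType) n (X Y : 'I_n -> rat) (e1 e2 : 'M[K]_n) Z :
  [pchar K] =i pred0 -> grid X Y e1 e2 -> Z = centr fullv e1 e2 ->
  (\dim Z <= (\dim (core X Y e1 e2 Z)).+1)%N ->
  {in Z &, forall A B, A *m B = B *m A}.
Proof.
move=> char0 G HZ Zdim A B ZA ZB; apply/eqP/negPn/negP=> nAB.
have nab : exists A B, [/\ A \in Z, B \in Z & A *m B != B *m A] by exists A, B.
have Zcomm C : C \in Z -> C *m e1 = e1 *m C /\ C *m e2 = e2 *m C.
  by rewrite HZ; apply: centr_comm.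
have Zcomp p q C : C \in Z -> hcomp X Y p q C \in Z.
  by rewrite HZ; apply: centr_hcomp (grid_h1 G) (grid_h2 G) _ _ _ _ => *; apply: memvf.
have [x [p [q [c [i [j [P [T [M [R F]]]]]]]]]] := nonabelian_failure G Zcomm Zcomp Zdim nab.
have [Ql [a1 [b1 [sQl MQl]]]] := sink_above G M.
have [Qk [a2 [b2 [sQk RQk]]]] := sink_above G R.
have [Pb [a3 [b3 [gPb PbT]]]] := gen_below G T.
have all_le := typeA_all_le char0 G HZ Zdim nab.
have [a [b PQk]] := all_le _ _ (fail_gen F) sQk.
have [a' [b' PbQl]] := all_le _ _ gPb sQl.
have /orP[ai|bj] := fail_notwindow G Zcomm F MQl RQk PbT PQk.
  have [b'j p0 _ _ _] := crossing_left G Zcomm F MQl RQk PbT PQk PbQl ai.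
  exact: (typeA_left G HZ Zdim F b'j p0).
have G' := gridC G; have F' := failureC G F.
have p' C D u v : ple e1 e2 u v C D -> ple e2 e1 v u C D by rewrite (pleC _ _ _ _ G).
have Zcomm' C : C \in Z -> C *m e2 = e2 *m C /\ C *m e1 = e1 *m C by case/Zcomm.
have [a'i q0 _ _ _] := crossing_left G' Zcomm' F' (p' _ _ _ _ MQl) (p' _ _ _ _ RQk) (p' _ _ _ _ PbT) (p' _ _ _ _ PQk) (p' _ _ _ _ PbQl) bj.
rewrite -(coreC _ G) in Zdim; rewrite centrC in HZ.
exact: (typeA_left G' HZ Zdim F' a'i q0).
Qed.

(** * Matrix algebras preserving a form *)

Section FormAlgebra.

Variables (K : fieldType) (n : nat) (J : 'M[K]_n) (eps : K).
Hypothesis eps2 : eps * eps = 1.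
Hypothesis JT : J^T = eps *: J.
Implicit Types (A B : 'M[K]_n) (a b s t : 'I_n).

Definition skewdef A := A^T *m J + J *m A.

Lemma skewdef_is_linear : linear skewdef.
Proof.
move=> c A B; rewrite /skewdef linearP /= mulmxDl mulmxDr -scalemxAl -scalemxAr.
by rewrite scalerDr addrACA.
Qed.

HB.instance Definition _ :=
  GRing.isLinear.Build K 'M[K]_n 'M[K]_n _ skewdef skewdef_is_linear.

Definition gform : {vspace 'M[K]_n} := lker (linfun skewdef).

Lemma gformP A : reflect (A^T *m J = - (J *m A)) (A \in gform).
Proof. by rewrite memv_ker lfunE /= addr_eq0; apply: eqP. Qed.

Lemma gform_admx A B : A \in gform -> B \in gform -> admx A B \in gform.
Proof.
move=> /gformP gA /gformP gB; apply/gformP.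
rewrite /admx linearB /= !trmx_mul mulmxBl mulmxBr -!mulmxA gA gB !mulmxN.
by rewrite !mulmxA gA gB !mulNmx !opprK opprB.
Qed.

(** The product of two basis vectors in the exterior square for [eps = 1], in the symmetric square
    for [eps = -1]. Multiplication by [J] identifies this square with the algebra, which acts on it
    by derivations ([bivJ_act]). *)
Definition biv a b : 'M[K]_n := delta_mx a b - eps *: delta_mx b a.

Definition bivJ a b := biv a b *m J.

Lemma bivJ_mul a b : bivJ a b = biv a b *m J. Proof. by []. Qed.

Lemma bivJ_alt a : eps = 1 -> bivJ a a = 0.
Proof. by move=> e; rewrite /bivJ /biv e scale1r subrr mul0mx. Qed.

Lemma trbiv a b : (biv a b)^T = - eps *: biv a b.
Proof.
rewrite /biv linearB /= linearZ /= !trmx_delta scalerBr scalerA mulNr eps2.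
by rewrite !scaleNr scale1r opprK addrC.
Qed.

Lemma bivC a b : bivJ b a = - eps *: bivJ a b.
Proof.
by rewrite /bivJ scalemxAl -trbiv /biv [in RHS]linearB /= [in RHS]linearZ /= !trmx_delta.
Qed.

Lemma bivJ_gform a b : bivJ a b \in gform.
Proof.
apply/gformP; rewrite /bivJ trmx_mul JT trbiv -!scalemxAl -scalemxAr -scalemxAl.
by rewrite scalerA mulrN eps2 scaleN1r mulmxA.
Qed.

Lemma bivJ_act A a b : A \in gform ->
  admx A (bivJ a b) = \sum_s (A s a *: bivJ s b + A s b *: bivJ a s).
Proof.
move=> /gformP gA; rewrite /admx /bivJ -(mulmxA (biv a b)).
have -> : J *m A = - (A^T *m J) by rewrite gA opprK.
rewrite mulmxN opprK !mulmxA -mulmxDl.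
under eq_bigr => s _ do rewrite !scalemxAl -mulmxDl.
rewrite -mulmx_suml; congr (_ *m J).
have Ad u v : A *m delta_mx u v = \sum_s A s u *: delta_mx s v.
  apply/matrixP=> r w; rewrite mxE summxE (bigD1 u) //= big1 ?addr0 => [|z /negPf zu].
    rewrite (bigD1 r) //= big1 ?addr0 => [|z /negPf zr]; rewrite !mxE ?eqxx //.
    by rewrite eq_sym zr mulr0.
  by rewrite mxE zu mulr0.
have dA u v : delta_mx u v *m A^T = \sum_s A s v *: delta_mx u s.
  by rewrite -[LHS]trmxK trmx_mul trmxK trmx_delta Ad linear_sum /=;
     apply: eq_bigr => s _; rewrite linearZ /= trmx_delta.
rewrite /biv mulmxBr mulmxBl -scalemxAl -scalemxAr !Ad !dA.
rewrite big_split /= !scaler_sumr.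
rewrite [X in _ = X + _](eq_bigr (fun s => A s a *: delta_mx s b - eps *: (A s a *: delta_mx b s))); last first.
  by move=> s _; rewrite scalerBr !scalerA (mulrC eps).
rewrite [X in _ = _ + X](eq_bigr (fun s => A s b *: delta_mx a s - eps *: (A s b *: delta_mx s a))); last first.
  by move=> s _; rewrite scalerBr !scalerA (mulrC eps).
rewrite !sumrB addrACA [RHS]addrACA; congr (_ + _).
by rewrite -!opprD (addrC (\sum_i eps *: (A i b *: _))).
Qed.

End FormAlgebra.

Section Duality.

Variables (K : fieldType) (n : nat) (J : 'M[K]_n) (eps : K).
Hypothesis heps : eps = 1 \/ eps = -1.
Hypothesis JT : J^T = eps *: J.
Hypothesis Ju : J \in unitmx.
Hypothesis Jp : pinj J.
Implicit Types (P Q R a b s t : 'I_n).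

Lemma eps_sqr : eps * eps = 1.
Proof. by case: heps => ->; rewrite ?mulrNN mulr1. Qed.

Lemma Jsym s t : J s t = eps * J t s.
Proof.
have := congr1 (fun B : 'M_n => B t s) JT; rewrite !mxE => ->; by [].
Qed.

(** The default value [s] never occurs for invertible [J], by [J_dual]. *)
Definition dual s := odflt s [pick t | J s t != 0].

Lemma unitmx_row (B : 'M[K]_n) s : B \in unitmx -> exists t, B s t != 0.
Proof.
move=> Bu; apply/existsP; rewrite -[[exists _, _]]negbK negb_exists.
apply/negP=> /forallP B0.
have := congr1 (fun C : 'M_n => C s s) (mulmxV Bu).
rewrite !mxE eqxx big1 => [/esym/eqP|t _]; first by rewrite oner_eq0.
by have := B0 t; rewrite negbK => /eqP ->; rewrite mul0r.
Qed.

Lemma J_dual s : J s (dual s) != 0.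
Proof.
rewrite /dual; case: pickP => //= J0.
by have [t] := unitmx_row s Ju; rewrite J0.
Qed.

Lemma J_dualE s t : J s t != 0 -> t = dual s.
Proof. by move=> /(Jp.2 _ _ _ (J_dual s)). Qed.

Lemma dualK : involutive dual.
Proof.
move=> s; apply/esym/J_dualE.
have := J_dual s; rewrite Jsym mulf_eq0 negb_or => /andP[_].
by [].
Qed.

Lemma dual_inj : injective dual. Proof. exact: inv_inj dualK. Qed.

Lemma mulJE (A : 'M[K]_n) s t : (A *m J) s t = A s (dual t) * J (dual t) t.
Proof.
by apply: mulmx_coluniq => //; rewrite -{2}[t]dualK J_dual.
Qed.

Lemma Jmul (A : 'M[K]_n) s t : (J *m A) s t = J s (dual s) * A (dual s) t.
Proof. by apply: mulmx_rowuniq => //; apply: J_dual. Qed.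

Lemma gform_entry A R P : A \in gform J ->
  A R P * J R (dual R) = - (J P (dual P) * A (dual P) (dual R)).
Proof.
move=> /gformP/(congr1 (fun B : 'M_n => B P (dual R))) /=.
rewrite [RHS]mxE Jmul => <-; rewrite mxE (bigD1 R) //= big1 ?addr0 => [|u uR].
  by rewrite mxE.
have [->|/eqP/J_dualE /dual_inj uR'] := J u (dual R) =P 0; first by rewrite mulr0.
by rewrite uR' eqxx in uR.
Qed.

Lemma gform_hcomp (U V : zmodType) (X : 'I_n -> U) (Y : 'I_n -> V) p q A :
  (forall s, X (dual s) = - X s) -> (forall s, Y (dual s) = - Y s) ->
  A \in gform J -> hcomp X Y p q A \in gform J.
Proof.
move=> dX dY gA; apply/gformP/matrixP=> P S; rewrite -[S]dualK; move: (dual S) => {}S.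
rewrite [RHS]mxE Jmul [LHS]mxE (bigD1 S) //= big1 ?addr0 => [|u uS]; last first.
  have [->|/eqP/J_dualE /dual_inj uS'] := J u (dual S) =P 0; first by rewrite mulr0.
  by rewrite uS' eqxx in uS.
rewrite !mxE !dX !dY.
have -> : (- X P == - X S + p) = (X S == X P + p).
  by rewrite -[LHS](inj_eq (addrI (X P + X S))) [X in X == _]addrAC subrr add0r addrA addrK.
have -> : (- Y P == - Y S + q) = (Y S == Y P + q).
  by rewrite -[LHS](inj_eq (addrI (Y P + Y S))) [X in X == _]addrAC subrr add0r addrA addrK.
case: ifP => _; first exact: gform_entry.
by rewrite mul0r mulr0 oppr0.
Qed.

Lemma bivE a b s t : biv eps a b s t = ((s == a) && (t == b))%:R - eps * ((s == b) && (t == a))%:R.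
Proof. by rewrite !mxE. Qed.

Lemma bivJE a b s t : bivJ J eps a b s t = biv eps a b s (dual t) * J (dual t) t.
Proof. exact: mulJE. Qed.

Lemma bivJ_homog (U V : zmodType) (X : 'I_n -> U) (Y : 'I_n -> V) a b :
  (forall s, X (dual s) = - X s) -> (forall s, Y (dual s) = - Y s) ->
  homog X Y (X a + X b) (Y a + Y b) (bivJ J eps a b).
Proof.
move=> dX dY s t; rewrite bivJE bivE mulf_eq0 negb_or => /andP[+ _].
have Xt : X t = - X (dual t) by rewrite dX opprK.
have Yt : Y t = - Y (dual t) by rewrite dY opprK.
have [/andP[/eqP-> /eqP tb] _|_] := boolP ((s == a) && (dual t == b)).
  by rewrite Xt Yt tb !(addrC (- _)) !addrK.
have [/andP[/eqP-> /eqP tb] _|_] := boolP ((s == b) && (dual t == a)).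
  by rewrite Xt Yt tb !(addrC (- _)) (addrC (X a)) (addrC (Y a)) !addrK.
by rewrite mulr0 subr0 eqxx.
Qed.

Lemma bivJ_entry a b : a != b -> bivJ J eps a b a (dual b) != 0.
Proof.
move=> ab; rewrite bivJE dualK bivE !eqxx (negPf ab) /= mulr0 subr0 mul1r.
exact: J_dual.
Qed.

Lemma bivJ_entry_diag a : [pchar K] =i pred0 -> eps = -1 ->
  bivJ J eps a a a (dual a) != 0.
Proof.
move=> char0 e1; rewrite bivJE dualK bivE !eqxx e1 mulr1 opprK mulf_neq0 ?J_dual //.
by rewrite -mulr2n ((pcharf0P K).1 char0).
Qed.

End Duality.

(* [fg_dim] and [fg_nab] are what the argument by contradiction assumes. *)
Record fgrid (K : fieldType) n (X Y : 'I_n -> rat) (e1 e2 J : 'M[K]_n) (eps : K)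
    (Z : {vspace 'M[K]_n}) : Prop := Fgrid {
  fg_grid : grid X Y e1 e2;
  fg_eps : eps = 1 \/ eps = -1;
  fg_JT : J^T = eps *: J;
  fg_Ju : J \in unitmx;
  fg_Jp : pinj J;
  fg_JX : forall s, X (dual J s) = - X s;
  fg_JY : forall s, Y (dual J s) = - Y s;
  fg_e1 : e1 \in gform J;
  fg_e2 : e2 \in gform J;
  fg_Z : Z = centr (gform J) e1 e2;
  fg_dim : (\dim Z <= (\dim (core X Y e1 e2 Z)).+1)%N;
  fg_nab : exists A B, [/\ A \in Z, B \in Z & A *m B != B *m A] }.

Lemma fgridC (K : fieldType) n (X Y : 'I_n -> rat) (e1 e2 J : 'M[K]_n) eps Z :
  fgrid X Y e1 e2 J eps Z -> fgrid Y X e2 e1 J eps Z.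
Proof.
case=> G ? ? ? ? ? ? ? ? HZ Zd [A [B [ZA ZB AB]]].
by split=> //; rewrite ?(coreC _ G) 1?centrC //; [exact: gridC|exists A, B].
Qed.

Record fbase (K : fieldType) n (X Y : 'I_n -> rat) (e1 e2 J : 'M[K]_n) (eps : K) : Prop :=
  Fbase {
  fb_grid : grid X Y e1 e2;
  fb_eps : eps = 1 \/ eps = -1;
  fb_JT : J^T = eps *: J;
  fb_Ju : J \in unitmx;
  fb_Jp : pinj J;
  fb_e1 : e1 \in gform J;
  fb_e2 : e2 \in gform J }.

Lemma fgrid_base (K : fieldType) n (X Y : 'I_n -> rat) (e1 e2 J : 'M[K]_n) eps Z :
  fgrid X Y e1 e2 J eps Z -> fbase X Y e1 e2 J eps.
Proof. by case. Qed.

Coercion fgrid_base : fgrid >-> fbase.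

Section FormBase.

Variables (K : fieldType) (n : nat) (X Y : 'I_n -> rat) (e1 e2 J : 'M[K]_n) (eps : K).
Hypothesis char0 : [pchar K] =i pred0.
Hypothesis F : fbase X Y e1 e2 J eps.
Implicit Types (P Q R s : 'I_n).

Let G := fb_grid F.
Let JT := fb_JT F.
Let Ju := fb_Ju F.
Let Jp := fb_Jp F.

Local Notation dual := (dual J).
Local Notation ple := (ple e1 e2).
Local Notation mono := (mono e1 e2).
Local Notation gen := (gen e1 e2).
Local Notation sink := (sink e1 e2).

(** Each factor is skew for the form, so a monomial is self-adjoint or skew according to the parity
    of its degree. Hence passing to dual basis vectors reverses the order. *)
Lemma trmono i j : (mono i j)^T *m J = (-1) ^+ (i + j) *: (J *m mono i j).
Proof.
have eT (e : 'M_n) m : e \in gform J -> (e ^+ m)^T *m J = (-1) ^+ m *: (J *m e ^+ m).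
  move=> /gformP ge; elim: m => [|m IH].
    by rewrite !expr0 -idmxE trmx1 mul1mx mulmx1 scale1r.
  rewrite exprSr -!mulmxE trmx_mul -mulmxA IH -scalemxAr mulmxA ge mulNmx.
  by rewrite scalerN -scaleNr exprS mulN1r -mulmxA mulmxE -exprS exprSr.
rewrite -[in LHS](monoC _ _ G) monoE trmx_mul -mulmxA (eT _ _ (fb_e2 F)) -scalemxAr.
rewrite [X in _ *: X]mulmxA.
rewrite (eT _ _ (fb_e1 F)) -scalemxAl scalerA -exprD addnC.
by rewrite -mulmxA.
Qed.

Lemma mono_entry i j R P :
  mono i j R P * J R (dual R) = (-1) ^+ (i + j) * (J P (dual P) * mono i j (dual P) (dual R)).
Proof.
have mT := trmono i j.
have := congr1 (fun B : 'M_n => B P (dual R)) mT => /=.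
rewrite [RHS]mxE (Jmul Ju Jp) => <-.
rewrite [RHS]mxE (bigD1 R) //= big1 ?addr0 => [|u uR]; first by rewrite [in RHS]mxE.
have [->|/eqP/(J_dualE Ju Jp)/(dual_inj JT Ju Jp) uR'] := J u (dual R) =P 0.
  by rewrite mulr0.
by rewrite uR' eqxx in uR.
Qed.

Lemma ple_dual i j P R : ple i j (dual R) (dual P) = ple i j P R.
Proof.
have := mono_entry i j R P; rewrite !pleE => E.
have J1 := J_dual Ju R; have J2 := J_dual Ju P.
apply/idP/idP => ne0.
  have : (-1) ^+ (i + j) * (J P (dual P) * mono i j (dual P) (dual R)) != 0.
    by rewrite !mulf_neq0 // signr_eq0.
  by rewrite -E mulf_eq0 negb_or => /andP[].
have : mono i j R P * J R (dual R) != 0 by rewrite mulf_neq0.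
by rewrite E !mulf_eq0 !negb_or => /and3P[].
Qed.

Lemma sink_dual P : sink (dual P) = gen P.
Proof.
have e1d s : (e1 (dual s) (dual P) == 0) = (e1 P s == 0).
  by apply: negb_inj; rewrite -(mono10 e1 e2) -pleE ple_dual.
have e2d s : (e2 (dual s) (dual P) == 0) = (e2 P s == 0).
  by apply: negb_inj; rewrite -(mono01 e1 e2) -pleE ple_dual.
apply/forallP/forallP=> H s; last by rewrite -[s](dualK JT Ju Jp) e1d e2d.
by rewrite -e1d -e2d.
Qed.

Lemma gen_dual P : gen (dual P) = sink P.
Proof. by rewrite -sink_dual (dualK JT Ju Jp). Qed.

Lemma gform_alt A R : eps = 1 -> A \in gform J -> A R (dual R) = 0.
Proof.
move=> e /(gform_entry JT Ju Jp R (dual R)); rewrite (dualK JT Ju Jp).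
rewrite (Jsym JT (dual R)) e mul1r (mulrC (J _ _)) => /eqP.
rewrite -addr_eq0 -mulr2n -mulr_natl !mulf_eq0 ((pcharf0P K).1 char0) /=.
by rewrite (negPf (J_dual Ju R)) orbF => /eqP.
Qed.

End FormBase.

Section FormGrid.

Variables (K : fieldType) (n : nat) (X Y : 'I_n -> rat) (e1 e2 J : 'M[K]_n) (eps : K).
Variable Z : {vspace 'M[K]_n}.
Hypothesis char0 : [pchar K] =i pred0.
Hypothesis F : fgrid X Y e1 e2 J eps Z.
Implicit Types (P Q R a b s t : 'I_n).

Let G := fg_grid F.
Let heps := fg_eps F.
Let eps2 := eps_sqr heps.
Let JT := fg_JT F.
Let Ju := fg_Ju F.
Let Jp := fg_Jp F.

Local Notation dual := (dual J).
Local Notation biv := (bivJ J eps).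
Local Notation ple := (ple e1 e2).
Local Notation mono := (mono e1 e2).
Local Notation gen := (gen e1 e2).
Local Notation sink := (sink e1 e2).
Local Notation core := (core X Y e1 e2 Z).

Lemma fg_comm A : A \in Z -> A *m e1 = e1 *m A /\ A *m e2 = e2 *m A.
Proof. by rewrite (fg_Z F); apply: centr_comm. Qed.

Lemma fg_comp p q A : A \in Z -> hcomp X Y p q A \in Z.
Proof.
rewrite (fg_Z F); apply: centr_hcomp (grid_h1 G) (grid_h2 G) _ _ _ _ => p' q' B.
exact: (gform_hcomp JT Ju Jp _ _ (fg_JX F) (fg_JY F)).
Qed.

Lemma fg_biv a b : biv a b \in gform J.
Proof. exact: bivJ_gform. Qed.

Lemma fg_bivZ A : A \in gform J -> admx e1 A = 0 -> admx e2 A = 0 -> A \in Z.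
Proof.
move=> gA /eqP A1 /eqP A2; rewrite (fg_Z F); apply/centrP; split=> //; apply/eqP.
  by rewrite eq_sym -admx_eq0.
by rewrite eq_sym -admx_eq0.
Qed.

Lemma Zgform A : A \in Z -> A \in gform J.
Proof. by rewrite (fg_Z F) => /centrP[]. Qed.

(** As for full matrices; the opposite eigenvalue is now carried by the bivector of [P] and
    [dual R]. *)
Lemma diag_centralJ D y : homog X Y 0 0 D -> D \in core -> y \in Z -> D *m y = y *m D.
Proof.
move=> hD cD Zy; apply/matrixP=> R P.
have [-> ->] := diag_entry G y R P hD cD.
apply/eqP/negPn/negP; rewrite (mulrC (D R R)) -subr_eq0 -mulrBr mulf_eq0 negb_or.
case/andP=> yRP; set a := _ - _ => a0.
have /coreP[ZD _] := cD; have [D1 D2] := fg_comm ZD.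
pose W s := D s s.
have dW s : W (dual s) = - W s.
  have := gform_entry JT Ju Jp s s (Zgform ZD); rewrite mulrC -mulrN.
  by move=> /(mulfI (J_dual Ju s)) Ws; rewrite /W Ws opprK.
have hW e : D *m e = e *m D -> homog W (fun=> 0 : K) 0 0 e.
  move=> De s t est; split; last by rewrite addr0.
  have := congr1 (fun B : 'M_n => B s t) De => /=; have [-> ->] := diag_entry G e s t hD cD.
  by rewrite mulrC addr0 => /(mulfI est).
have admW (k : K) B : homog W (fun=> 0 : K) k 0 B -> admx D B = k *: B.
  move=> hB; apply/matrixP=> s t; rewrite admxE [RHS]mxE.
  have [-> ->] := diag_entry G B s t hD cD.
  have [->|/eqP/hB[Ws _]] := B s t =P 0; first by rewrite !mulr0 mul0r subrr.
  by rewrite -/(W s) -/(W t) Ws mulrDl (mulrC (W t)) addrAC subrr add0r.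
have Zy1 : hcomp W (fun=> 0 : K) a 0 y \in Z.
  move: Zy; rewrite (fg_Z F); apply: centr_hcomp (hW _ D1) (hW _ D2) _ _ _ _ => p q B.
  exact: (gform_hcomp JT Ju Jp _ _ dW (fun s => esym (oppr0 K))).
have y10 : hcomp W (fun=> 0 : K) a 0 y != 0.
  apply: contraNneq yRP => /matrixP/(_ R P); rewrite !mxE addr0 eqxx andbT.
  by rewrite /a addrC subrK eqxx => ->.
(* The bivector vanishes only if [P = dual R] and [eps = 1], but then skewness makes the entry of
   [y] vanish as well. *)
have b0 : biv P (dual R) != 0.
  have [Pd|Pd] := eqVneq P (dual R); last first.
    apply/negP=> /eqP/matrixP/(_ P (dual (dual R))); rewrite [RHS]mxE => /eqP.
    by rewrite (negPf (bivJ_entry JT Ju Jp Pd)).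
  have em : eps = -1.
    case: heps => // e; case/eqP: yRP; rewrite Pd.
    by apply: (gform_alt char0 F) => //; apply: Zgform.
  apply/negP=> /eqP/matrixP/(_ P (dual P)); rewrite [RHS]mxE -{1}Pd => /eqP.
  by rewrite (negPf (bivJ_entry_diag JT Ju Jp P char0 em)).
have hb : homog W (fun=> 0 : K) (- a) 0 (biv P (dual R)).
  have := bivJ_homog JT Ju Jp (a := P) (b := dual R) dW (fun s => esym (oppr0 K)).
  by rewrite dW addr0 /a opprB.
have gad e : e \in gform J -> forall A, A \in gform J -> admx e A \in gform J.
  by move=> ge A gA; apply: gform_admx.
have [y' Zy' [y'0 ey']] := opposite_exists (grid_h1 G) (grid_h2 G) (grid_comm G)
  (gad _ (fg_e1 F)) (gad _ (fg_e2 F)) D1 D2 (fg_biv P (dual R)) b0 (admW _ _ hb).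
rewrite -(fg_Z F) in Zy'.
exact: (core_opposite G fg_comm fg_comp (fg_dim F) char0 cD Zy1 Zy' a0 y10 y'0
  (admW _ _ (@hcomp_homog _ _ _ _ _ _ _ _ _)) ey').
Qed.

End FormGrid.

(** * Bivectors in the centralizer *)

Section Bivectors.

Variables (K : fieldType) (n : nat) (X Y : 'I_n -> rat) (e1 e2 J : 'M[K]_n) (eps : K).
Variable Z : {vspace 'M[K]_n}.
Hypothesis char0 : [pchar K] =i pred0.
Hypothesis F : fgrid X Y e1 e2 J eps Z.
Implicit Types (P Q R N a b s t : 'I_n).

Let G := fg_grid F.
Let heps := fg_eps F.
Let eps2 := eps_sqr heps.
Let JT := fg_JT F.
Let Ju := fg_Ju F.
Let Jp := fg_Jp F.

Local Notation dual := (dual J).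
Local Notation biv := (bivJ J eps).
Local Notation ple := (ple e1 e2).
Local Notation mono := (mono e1 e2).
Local Notation gen := (gen e1 e2).
Local Notation sink := (sink e1 e2).
Local Notation core := (core X Y e1 e2 Z).

Lemma sum_single (A : 'M[K]_n) a a' (f : 'I_n -> 'M[K]_n) :
  (forall s, A s a != 0 -> s = a') -> \sum_s A s a *: f s = A a' a *: f a'.
Proof.
move=> ha; rewrite (bigD1 a') //= big1 ?addr0 // => s sa.
have [->|/eqP/ha sa'] := A s a =P 0; first by rewrite scale0r.
by rewrite sa' eqxx in sa.
Qed.

Lemma act_biv (A : 'M[K]_n) a b a' b' : A \in gform J ->
  (forall s, A s a != 0 -> s = a') -> (forall s, A s b != 0 -> s = b') ->
  admx A (biv a b) = A a' a *: biv a' b + A b' b *: biv a b'.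
Proof.
move=> gA ha hb; rewrite (bivJ_act _ _ _ gA) big_split /=.
by rewrite (sum_single (fun s => biv s b) ha) (sum_single (fun s => biv a s) hb).
Qed.

Lemma biv_neq0 a b : a != b \/ eps = -1 -> biv a b a (dual b) != 0.
Proof.
have [<-|ab] := eqVneq a b; last by move=> _; apply: (bivJ_entry JT Ju Jp).
by case=> // e; apply: (bivJ_entry_diag JT Ju Jp).
Qed.

Lemma biv_homog a b : homog X Y (X a + X b) (Y a + Y b) (biv a b).
Proof. exact: (bivJ_homog JT Ju Jp (fg_JX F) (fg_JY F)). Qed.

Lemma sink1 Q s : sink Q -> e1 s Q = 0.
Proof. by move=> /forallP/(_ s)/andP[/eqP]. Qed.

Lemma sink2 Q s : sink Q -> e2 s Q = 0.
Proof. by move=> /forallP/(_ s)/andP[_ /eqP]. Qed.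

Lemma act_e2 a b a' b' : ple 0 1 a a' -> ple 0 1 b b' ->
  admx e2 (biv a b) = e2 a' a *: biv a' b + e2 b' b *: biv a b'.
Proof.
rewrite !pleE !mono01 => ha hb; apply: act_biv (fg_e2 F) _ _.
  by move=> s /(grid_p2 G).1; apply.
by move=> s /(grid_p2 G).1; apply.
Qed.

Lemma act_e2r a b a' : ple 0 1 a a' -> sink b -> admx e2 (biv a b) = e2 a' a *: biv a' b.
Proof.
rewrite !pleE !mono01 => ha sb; rewrite (@act_biv _ _ _ a' b (fg_e2 F)).
- by rewrite (sink2 _ sb) scale0r addr0.
- by move=> s /(grid_p2 G).1; apply.
by move=> s; rewrite sink2 ?eqxx.
Qed.

Lemma act_e1_0 a b : (forall s, e1 s a = 0) -> (forall s, e1 s b = 0) ->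
  admx e1 (biv a b) = 0.
Proof.
move=> ha hb; rewrite (@act_biv _ _ _ a b (fg_e1 F)) ?ha ?hb ?scale0r ?addr0 //.
  by move=> s; rewrite ha eqxx.
by move=> s; rewrite hb eqxx.
Qed.

Lemma sink_biv Q Q' : sink Q -> sink Q' -> biv Q Q' \in Z.
Proof.
move=> sQ sQ'; apply: (fg_bivZ F); first exact: bivJ_gform.
  by apply: act_e1_0 => s; apply: sink1.
rewrite (@act_biv _ _ _ Q Q' (fg_e2 F)) ?sink2 ?scale0r ?addr0 //.
  by move=> s; rewrite sink2 ?eqxx.
by move=> s; rewrite sink2 ?eqxx.
Qed.

Lemma sink_core A s Q : A \in core -> sink Q -> A s Q != 0 -> s = Q.
Proof.
move=> /coreP[_ bA] sQ /bA/(belowP G)[i [j /(sinkP G sQ)[_ _ //]]].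
Qed.

(** The degree-zero component of [A] is diagonal and commutes with [Z]; it multiplies the bivector
    by the sum of its two entries. *)
Lemma diag_sum A a b : A \in core -> biv a b \in Z -> biv a b != 0 ->
  A a a + A b b = 0.
Proof.
move=> cA Zb b0; have cD := core_hcomp (fg_comp F) 0 0 cA.
have hD := @hcomp_homog _ _ _ _ X Y 0 0 A.
have dD s t : hcomp X Y 0 0 A s t != 0 -> s = t.
  by move=> /(core_ple G cD (i:=0) (j:=0) hD); rewrite ple00 => /eqP.
have /coreP[ZD _] := cD.
have := diag_centralJ char0 F hD cD Zb => /eqP.
rewrite -admx_eq0 (@act_biv _ a b a b (Zgform F ZD)) //.
- by rewrite -scalerDl scaler_eq0 (negPf b0) orbF !mxE !addr0 !eqxx /= => /eqP.
- by move=> s /dD.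
by move=> s /dD.
Qed.

(** A core element sends a sink to a multiple of itself, so it multiplies the bivector by a sum of
    diagonal entries, which is zero by [diag_sum]. *)
Lemma sink_biv_core Q Q' : sink Q -> sink Q' -> Q != Q' \/ eps = -1 -> biv Q Q' \in core.
Proof.
move=> sQ sQ' QQ'; have Zb := sink_biv sQ sQ'.
have b0 : biv Q Q' != 0.
  by apply: contraNneq (biv_neq0 QQ') => ->; rewrite mxE.
apply: (core_of_central G (fg_comm F) (fg_comp F) (fg_dim F) (fg_nab F)) => // A cA.
have /coreP[ZA _] := cA; apply/eqP; rewrite -admx_eq0.
rewrite (@act_biv _ Q Q' Q Q' (Zgform F ZA)).
- by rewrite -scalerDl (diag_sum cA Zb b0) scale0r.
- by move=> s; apply: sink_core.
by move=> s; apply: sink_core.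
Qed.

(** [dual P] is a sink, and the core bivector of [Q] and [dual P] has a nonzero entry from [P] to
    [Q]. For [Q = dual P] and [eps = 1] this bivector is zero, which is the origin of the
    exceptional case. *)
Lemma gen_ple_sink P Q : gen P -> sink Q -> Q != dual P \/ eps = -1 ->
  exists i j, ple i j P Q.
Proof.
rewrite -(sink_dual F) => sP sQ PQ; apply/(belowP G).
have /coreP[_ /(_ Q P)] := sink_biv_core sQ sP PQ; apply.
by have := biv_neq0 PQ; rewrite (dualK JT Ju Jp).
Qed.

Lemma pred_core N A s Q : A \in core -> sink Q -> ple 0 1 N Q ->
  (forall s, e1 s N = 0) -> A s N != 0 -> (s == N) || (s == Q).
Proof.
move=> /coreP[_ bA] sQ NQ e1N /bA/(belowP G)[i [j Ns]].
case: i Ns => [|i] Ns; last first.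
  have [||M + _] := ple_splitle G (k := 1) (l := 0) _ _ Ns => //.
  by rewrite pleE mono10 e1N eqxx.
case: j Ns => [|j] Ns; first by move: Ns; rewrite ple00 eq_sym => ->.
have := ple_from G (leqnn 0) (ltn0Sn j) NQ Ns.
by case/(sinkP G sQ)=> _ _ ->; rewrite eqxx orbT.
Qed.

Lemma pred_neq N Q : ple 0 1 N Q -> N != Q.
Proof.
move=> /(ple_deg G)[_ YQ]; apply/eqP=> NQ; move: YQ; rewrite NQ.
by move/eqP; rewrite addrC -subr_eq subrr eq_sym oner_eq0.
Qed.

Lemma pred_biv N Q : eps = 1 -> sink Q -> ple 0 1 N Q -> (forall s, e1 s N = 0) ->
  biv N Q \in Z.
Proof.
move=> e sQ NQ e1N; apply: (fg_bivZ F); first exact: bivJ_gform.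
  by apply: act_e1_0 => // s; apply: sink1.
by rewrite (act_e2r NQ sQ) bivJ_alt // scaler0.
Qed.

(** For [eps = 1] the bivector of [N] and [Q] is killed by [e2], since the bivector of [Q] with
    itself vanishes. A core element moves [N] only to [N] and [Q], so it acts on this bivector by a
    vanishing sum of diagonal entries. *)
Lemma pred_biv_below N Q : eps = 1 -> sink Q -> ple 0 1 N Q -> (forall s, e1 s N = 0) ->
  exists i j, ple i j (dual Q) N.
Proof.
move=> e sQ NQ e1N; apply/(belowP G).
have nNQ := pred_neq NQ; have entry := biv_neq0 (or_introl nNQ : _ \/ eps = -1).
suff /coreP[_] : biv N Q \in core by apply.
have Zb := pred_biv e sQ NQ e1N.
have b0 : biv N Q != 0 by apply: contraNneq entry => ->; rewrite mxE.
apply: (core_of_central G (fg_comm F) (fg_comp F) (fg_dim F) (fg_nab F)) => // A cA.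
have /coreP[ZA _] := cA; apply/eqP; rewrite -admx_eq0 (bivJ_act _ _ _ (Zgform F ZA)).
rewrite big_split /= (@sum_single A Q Q); last by move=> s; apply: sink_core.
rewrite (bigD1 N) //= (bigD1 Q) /= 1?eq_sym // big1 => [|s /andP[sN sQ']]; last first.
  have [->|/eqP/(pred_core cA sQ NQ e1N)] := A s N =P 0; first by rewrite scale0r.
  by rewrite (negPf sN) (negPf sQ').
by rewrite bivJ_alt // scaler0 !addr0 -scalerDl (diag_sum cA Zb b0) scale0r.
Qed.

Lemma homogD p q (A B : 'M[K]_n) :
  homog X Y p q A -> homog X Y p q B -> homog X Y p q (A + B).
Proof.
move=> hA hB s t; rewrite mxE; have [->|/eqP/hA //] := A s t =P 0.
by rewrite add0r; apply: hB.
Qed.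

Lemma homogZ p q k (A : 'M[K]_n) : homog X Y p q A -> homog X Y p q (k *: A).
Proof. by move=> hA s t; rewrite mxE mulf_eq0 negb_or => /andP[_ /hA]. Qed.

Lemma lin2E (u v : K) (A B : 'M[K]_n) s t :
  (u *: A + v *: B) s t = u * A s t + v * B s t.
Proof. by rewrite [LHS]mxE [X in X + _]mxE [X in _ + X]mxE. Qed.

Lemma pred2_biv N N' Q Q' : sink Q -> sink Q' -> Q != Q' ->
  ple 0 1 N Q -> ple 0 1 N' Q' -> (forall s, e1 s N = 0) -> (forall s, e1 s N' = 0) ->
  exists y, [/\ y \in Z, y != 0 & homog X Y (X N + X Q') (Y N + Y Q') y].
Proof.
move=> sQ sQ' QQ' NQ NQ' e1N e1N'.
(* [e2] sends both terms to multiples of the bivector of [Q] and [Q']; exchanging its factors costs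
   [- eps], and [eps * eps = 1] cancels the sum. *)
exists (e2 Q' N' *: biv N Q' + (eps * e2 Q N) *: biv N' Q); split.
- apply: (fg_bivZ F); first by rewrite memvD // memvZ // bivJ_gform.
    rewrite linearD 2!linearZ /= !act_e1_0 ?scaler0 ?addr0 // => s; exact: sink1.
  rewrite linearD 2!linearZ /= (act_e2r NQ sQ') (act_e2r NQ' sQ).
  rewrite (bivC J eps2 Q) !scalerA -scalerDl.
  set u := (X in X *: _); have -> : u = e2 Q' N' * e2 Q N * (1 - eps * eps) by rewrite /u; ring.
  by rewrite eps2 subrr mulr0 scale0r.
- have NQ'0 : N != Q'.
    by apply: contraTneq NQ => ->; rewrite pleE mono01 sink2 ?eqxx.
  apply/negP=> /eqP/matrixP/(_ N (dual Q')).
  rewrite lin2E [RHS]mxE (bivJE JT Ju Jp N' Q) bivE (dualK JT Ju Jp) !(eq_sym Q').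
  rewrite (negPf QQ') (negPf (pred_neq NQ)) andbF /= mulr0 subrr mul0r mulr0 addr0.
  move/eqP; rewrite mulf_eq0 (negPf (biv_neq0 (or_introl NQ'0))) orbF.
  by move: NQ'; rewrite pleE mono01 => /negPf ->.
have [XN YN] := ple_deg G NQ; have [XN' YN'] := ple_deg G NQ'.
apply: homogD; apply: homogZ; first exact: biv_homog.
have -> : X N + X Q' = X N' + X Q by lra.
have -> : Y N + Y Q' = Y N' + Y Q by lra.
exact: biv_homog.
Qed.

Lemma pred3_biv N N' Q : eps = -1 -> sink Q -> ple 0 1 N' N -> ple 0 1 N Q ->
  (forall s, e1 s N = 0) -> (forall s, e1 s N' = 0) ->
  exists y, [/\ y \in Z, y != 0 & homog X Y (X N' + X Q) (Y N' + Y Q) y].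
Proof.
move=> e sQ NN NQ e1N e1N'.
have [XN YN] := ple_deg G NQ; have [XN' YN'] := ple_deg G NN.
(* In the symmetric square the product of [N] with itself has two equal contributions under [e2],
   whence the factor two on the other term. *)
exists ((2%:R * e2 Q N) *: biv N' Q + (- e2 N N') *: biv N N); split.
- apply: (fg_bivZ F).
  + by rewrite rpredD // memvZ // bivJ_gform.
  + rewrite linearD 2!linearZ /= !act_e1_0 ?scaler0 ?addr0 // => s; exact: sink1.
  rewrite linearD 2!linearZ /= (act_e2r NN sQ) (act_e2 NQ NQ).
  rewrite (bivC J eps2 N Q) e opprK scale1r -scalerDl !scalerA -scalerDl.
  set u := (X in X *: _); have -> : u = 0 by rewrite /u; ring.
  by rewrite scale0r.
- have NQ0 : N' != Q.
    by apply/eqP=> NQ0; move: YN'; rewrite NQ0 YN; lra.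
  apply/negP=> /eqP/matrixP/(_ N' (dual Q)).
  rewrite lin2E [RHS]mxE (bivJE JT Ju Jp N N) bivE (dualK JT Ju Jp).
  rewrite (eq_sym Q) (negPf (pred_neq NQ)) !andbF /= mulr0 subrr mul0r mulr0 addr0.
  move/eqP; rewrite mulf_eq0 (negPf (biv_neq0 (or_introl NQ0))) orbF mulf_eq0.
  rewrite ((pcharf0P K).1 char0) /=.
  by move: NQ; rewrite pleE mono01 => /negPf ->.
apply: homogD; first by apply: homogZ; apply: biv_homog.
apply: homogZ.
have -> : X N' + X Q = X N + X N by lra.
have -> : Y N' + Y Q = Y N + Y N by lra.
exact: biv_homog.
Qed.

(** An even monomial is self-adjoint and commutes with [A], so its product with the skew [A] is
    skew. This replaces the element [e2 *m x] of the full matrix argument. *)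
Lemma mono_even_Z A i j : A \in Z -> ~~ odd (i + j) -> mono i j *m A \in Z.
Proof.
move=> ZA ev; have [A1 A2] := fg_comm F ZA.
rewrite (fg_Z F); apply/centrP; split.
- have /gformP gA := Zgform F ZA; apply/gformP.
  have := trmono F i j; rewrite -signr_odd (negPf ev) expr0 scale1r.
  have := Zmono (fg_comm F) i j ZA; move: (mono i j) => m mA mT.
  by rewrite trmx_mul -mulmxA mT mulmxA gA mulNmx -mulmxA mA.
- have := monoD G 1 0 i j; rewrite addnC (addnC 0) (monoD G) mono10.
  by move: (mono i j) => m me; rewrite -mulmxA A1 !mulmxA me.
have := monoD G 0 1 i j; rewrite addnC (addnC 1) (monoD G) mono01.
by move: (mono i j) => m me; rewrite -mulmxA A2 !mulmxA me.
Qed.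

End Bivectors.

(** * Crossing windows for form algebras *)

Section CrossingForm.

Variables (K : fieldType) (n : nat) (X Y : 'I_n -> rat) (e1 e2 J : 'M[K]_n) (eps : K).
Variable Z : {vspace 'M[K]_n}.
Hypothesis char0 : [pchar K] =i pred0.
Hypothesis F : fgrid X Y e1 e2 J eps Z.

Let G := fg_grid F.
Let Zcomm := fg_comm F.
Let Zcomp := fg_comp F.
Let JT := fg_JT F.
Let Ju := fg_Ju F.
Let Jp := fg_Jp F.

Local Notation dual := (dual J).
Local Notation ple := (ple e1 e2).
Local Notation mono := (mono e1 e2).
Local Notation gen := (gen e1 e2).
Local Notation sink := (sink e1 e2).
Local Notation core := (core X Y e1 e2 Z).

Variables (x c : 'M[K]_n) (p q : rat) (i j : nat) (P T M R : 'I_n).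
Hypothesis Fl : failure X Y e1 e2 Z x p q c i j P T M R.

(** The product has a degree different from that of [x], so it lies in the core, and it is nonzero
    by [fail_mulx]. *)
Lemma mono_x_core k l : (k <= i)%N -> (l <= j)%N -> ~~ odd (k + l) -> (0 < k + l)%N ->
  exists a b : nat, p + k%:R = a%:R /\ q + l%:R = b%:R.
Proof.
move=> ki lj ev kl0; have mx0 := fail_mulx G Zcomm Fl ki lj.
have Zmx := mono_even_Z F (fail_x Fl) ev.
have hmx := homogM (homog_mono G (i := k) (j := l)) (fail_hx Fl).
have [|mx0'|[a [b [pa qb]]]] // := homog_core_nat (e1 := e1) (e2 := e2) (Z := Z) G _ hmx.
- apply: (core_other Zcomp (fg_dim F) (fail_x Fl) (fail_nx Fl) (fail_hx Fl) Zmx hmx).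
  apply/eqP=> -[pk ql]; move: kl0; rewrite addn_gt0 => /orP[].
    by rewrite -(ltr_nat rat) => k0; lra.
  by rewrite -(ltr_nat rat) => k0; lra.
- by rewrite mx0' eqxx in mx0.
by exists a, b.
Qed.

Variables (Ql Qk Pb : 'I_n) (a1 b1 a2 b2 a3 b3 a b a' b' : nat).
Hypothesis sQl : sink Ql.
Hypothesis gPb : gen Pb.
Hypothesis MQl : ple a1 b1 M Ql.
Hypothesis RQk : ple a2 b2 R Qk.
Hypothesis PbT : ple a3 b3 Pb T.
Hypothesis PQk : ple a b P Qk.
Hypothesis PbQl : ple a' b' Pb Ql.

Hypothesis ai : (a < i)%N.

(** As [q] is positive, an element of [Z] of negative second degree would lie in the core, so it is
    zero. Bivectors near the sinks [Ql] and [dual Pb] provide nonzero ones in all positions but one,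
    where a path would run past a sink. *)
Lemma crossing_form_left : False.
Proof.
have [b'j p0 q0 XPb YPb] := crossing_left G Zcomm Fl MQl RQk PbT PQk PbQl ai.
have Zneg y p' q' : y \in Z -> homog X Y p' q' y -> q' < 0 -> y = 0.
  move=> Zy hy q'0; apply/eqP/negPn/negP=> y0.
  have cy : y \in core.
    apply: (core_other Zcomp (fg_dim F) (fail_x Fl) (fail_nx Fl) (fail_hx Fl) Zy hy).
    by apply/eqP=> -[_ qq]; lra.
  by have := core_nonneg G cy hy y0; lra.
(* For [2 <= j], the even monomial [e2^2] would bring [x] into the core with first degree [p < 0].
   Afterwards [e1 e2] forces [p = -1]. *)
have j1 : j = 1%N.
  apply/eqP; rewrite eqn_leq; apply/andP; split; last by clear -b'j; lia.
  rewrite leqNgt; apply/negP=> j2.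
  have [//|//|//|//|u [v [pu _]]] := @mono_x_core 0 2.
  by have := ler0n rat u; lra.
have i1 : (0 < i)%N by clear -ai; lia.
have [//||//|//|u [v [pu _]]] := @mono_x_core 1 1; first by rewrite j1.
have pm1 : p = -1.
  have u0 : (u < 1)%N by rewrite -(ltr_nat rat); lra.
  by move: pu; case: (u) u0 => // _; lra.
have b'0 : b' = 0%N by clear -b'j j1; lia.
have PQl := ple_trans G (fail_PM Fl) MQl; have TQk := ple_trans G (fail_TR Fl) RQk.
have PbQk := ple_trans G PbT TQk.
have [XT YT] := fail_hx Fl (fail_PT Fl).
have [X1 Y1] := ple_deg G PQk; have [X2 Y2] := ple_deg G PbQl.
have [X3 Y3] := ple_deg G PQl; have [X4 Y4] := ple_deg G TQk.
have [X5 Y5] := ple_deg G PbT.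
rewrite b'0 addr0 in Y2; rewrite {}j1 in PQl TQk PbQk Y3 Y4.
have [N PbN _] : exists2 N, ple 0 1 Pb N & ple (a2 + i + a3) (b2 + 1 + b3 - 1) N Qk.
  by rewrite -[X in ple X (_ - _)]subn0; apply: (ple_splitle G _ _ PbQk) => //; clear -i1; lia.
have [XN YN] := ple_deg G PbN; rewrite addr0 in XN.
have [Nl _ NlQl] : exists2 Nl, ple (a1 + i) b1 P Nl & ple 0 1 Nl Ql.
  have : ple (0 + (a1 + i)) (1 + b1) P Ql by rewrite add0n (addnC 1%N).
  by case/(ple_split G) => Nl PNl NlQl; exists Nl.
have [XNl YNl] := ple_deg G NlQl; rewrite addr0 in XNl.
have NPb : ple 0 1 (dual N) (dual Pb) by rewrite (ple_dual F).
have sPb : sink (dual Pb) by rewrite (sink_dual F).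
have dX := fg_JX F; have dY := fg_JY F.
have neg1 : Y Nl + Y Ql < 0 -> eps = 1 -> (forall s, e1 s Nl = 0) -> False.
  move=> Yneg e e1Nl; have Zb := pred_biv F e sQl NlQl e1Nl.
  have := Zneg _ _ _ Zb (biv_homog F (a := Nl) (b := Ql)) Yneg.
  move/matrixP/(_ Nl (dual Ql)); rewrite [RHS]mxE => /eqP.
  by apply/negP; apply: (biv_neq0 char0 F); left; apply: (pred_neq F).
have neg2 : Y N + Y Pb > 0 -> eps = 1 -> (forall s, e1 s (dual N) = 0) -> False.
  move=> Yneg e e1N; have Zb := pred_biv F e sPb NPb e1N.
  have := Zneg _ _ _ Zb (biv_homog F (a := dual N) (b := dual Pb)); rewrite !dY => /(_ _)/matrixP.
  move=> H; have /H/(_ (dual N) (dual (dual Pb))) : - Y N + - Y Pb < 0 by lra.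
  rewrite [RHS]mxE => /eqP.
  by apply/negP; apply: (biv_neq0 char0 F); left; apply: (pred_neq F).
have all_le := gen_ple_sink char0 F.
(* If [e1] does not kill [Nl], some sink lies at the height of [Nl], one step below [Pb], so it is
   not above [Pb]; only the exceptional pair of a source and its dual sink remains. [A2] is the dual
   statement. *)
have A1 : (forall s, e1 s Nl = 0) \/ eps = 1 /\ Y Pb = 1 / 2%:R.
  have [/forallP e1Nl|] := boolP [forall s, e1 s Nl == 0].
    by left=> s; apply/eqP.
  rewrite negb_forall => /existsP[s]; rewrite -(mono10 e1 e2) => Nls; right.
  have [Q'' [u' [v' [sQ'' sQ]]]] := sink_above G s.
  have NlQ'' := ple_trans G Nls sQ.
  have v'0 : v' = 0%N.
    case: (v') NlQ'' => // w NlQ''.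
    have := ple_from G (leq0n _) _ NlQl NlQ''; rewrite addn0 => /(_ isT).
    by case/(sinkP G sQl) => /eqP; rewrite subn0 addn1.
  have [XQ YQ] := ple_deg G NlQ''; rewrite v'0 addr0 in YQ.
  have [Qd|Qnd] := eqVneq Q'' (dual Pb).
    have Ypb : Y Pb = 1 / 2%:R by have := dY Pb; rewrite -Qd; lra.
    split=> //; case: (fg_eps F) => // e; exfalso.
    have [u2 [v2 PbQ]] := all_le _ _ gPb sQ'' (or_intror e); clear e.
    by have [_ YY] := ple_deg G PbQ; have := ler0n rat v2; lra.
  have [u2 [v2 PbQ]] := all_le _ _ gPb sQ'' (or_introl Qnd); clear Qnd.
  by have [_ YY] := ple_deg G PbQ; have := ler0n rat v2; lra.
have A2 : (forall s, e1 s (dual N) = 0) \/ eps = 1 /\ Y Pb = - (1 / 2%:R).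
  have [/forallP e1N|] := boolP [forall s, e1 s (dual N) == 0].
    by left=> s; apply/eqP.
  rewrite negb_forall => /existsP[s]; rewrite -(mono10 e1 e2) => Ns; right.
  have sN : ple 1 0 (dual s) N.
    by rewrite -(ple_dual F) (dualK JT Ju Jp).
  have [G' [u' [v' [gG' G's]]]] := gen_below G (dual s).
  have G'N := ple_trans G G's sN.
  have v'0 : v' = 0%N.
    case: (v') G'N => // w G'N.
    have := ple_to G (leq0n _) _ PbN G'N; rewrite add0n => /(_ isT).
    by case/(genP G gPb) => /eqP; rewrite subn0 add1n.
  have [XG YG] := ple_deg G G'N; rewrite v'0 addr0 in YG.
  have [Qd|Qnd] := eqVneq Ql (dual G').
    have Ypb : Y Pb = - (1 / 2%:R) by have := dY G'; rewrite -Qd; lra.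
    split=> //; case: (fg_eps F) => // e; exfalso.
    have [u2 [v2 GQ]] := all_le _ _ gG' sQl (or_intror e); clear e.
    by have [_ YY] := ple_deg G GQ; have := ler0n rat v2; lra.
  have [u2 [v2 GQ]] := all_le _ _ gG' sQl (or_introl Qnd); clear Qnd.
  by have [_ YY] := ple_deg G GQ; have := ler0n rat v2; lra.
case: A1 => [e1Nl|[e Ypb]]; last first.
  case: A2 => [e1N|[_ Ypb']]; last lra.
  by apply: neg2 => //; lra.
case: A2 => [e1N|[e Ypb]]; last by apply: neg1 => //; lra.
(* For different sinks the element of [pred2_biv] has second degree [-1]. *)
have [Qd|Qnd] := eqVneq Ql (dual Pb); last first.
  have [y [Zy y0 hy]] := pred2_biv char0 F sQl sPb Qnd NlQl NPb e1Nl e1N.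
  have : y = 0 by apply: Zneg Zy hy _; rewrite dY; lra.
  by move/eqP; rewrite (negPf y0).
have YPb0 : Y Pb = 0 by have := dY Pb; rewrite -Qd; lra.
case: (fg_eps F) => [e|e]; first by apply: neg1 => //; clear e; lra.
have {}all_le G' Q' : gen G' -> sink Q' -> exists u v, ple u v G' Q'.
  by move=> gG' sQ'; apply: all_le => //; right.
have {}e : eps = -1 /\ True by [].
(* If [T] lies in the row of [Pb], moving the entry of [x] along this row produces a sink strictly
   to the right of [Ql], and the path from [Pb] to it would pass through the sink [Ql]. Otherwise
   [e2] applies twice to [Pb], and [pred3_biv] gives second degree [-2]. *)
move: b3 (PbT) PbQk Y5 => [|b3'] PbT0 PbQk Y5.
  rewrite addr0 in Y5.
  have a3a' : (a3 <= a')%N.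
    by rewrite -(ler_nat rat); have := ler0n rat (a1 + i); rewrite X3 in X2; lra.
  have TQl : ple (a' - a3) 0 T Ql.
    by have := PbQl; rewrite b'0; apply: (ple_from G a3a' (leqnn 0) PbT0).
  have xmT : (x *m mono (a' - a3) 0) Ql P != 0.
    rewrite (Zmono Zcomm _ _ (fail_x Fl)) (mulmx_rowuniq _ _ (pinj_mono G _ _) TQl).
    by rewrite mulf_neq0 // (fail_PT Fl).
  have [W _ PW] := mulmx_neq0 xmT.
  have [XW YW] := ple_deg G PW; have [XTQ _] := ple_deg G TQl.
  have [Q' [u' [v' [sQ' WQ']]]] := sink_above G W.
  have [XWQ YWQ] := ple_deg G WQ'.
  have [u2 [v2 PbQ']] := all_le _ _ gPb sQ'.
  have [XPQ YPQ] := ple_deg G PbQ'.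
  have a'u2 : (a' < u2)%N by rewrite -(ltr_nat rat); have := ler0n rat u'; lra.
  have PbQl0 : ple a' 0 Pb Ql by rewrite -b'0.
  have := ple_from G (ltnW a'u2) (leq0n v2) PbQl0 PbQ'.
  by case/(sinkP G sQl) => /eqP; rewrite subn_eq0 leqNgt a'u2.
have [N2 PbN2 _] : exists2 N2, ple 0 2 Pb N2 & ple (a2 + i + a3 - 0) (b2 + 1 + b3'.+1 - 2) N2 Qk.
  by apply: (ple_splitle G _ _ PbQk) => //; clear -i1; lia.
have NN2 : ple 0 1 N N2 by exact: (ple_from G (leqnn 0) (leqnSn 1) PbN PbN2).
have NN2d : ple 0 1 (dual N2) (dual N) by rewrite (ple_dual F).
have e1N2 s : e1 s (dual N2) = 0.
  apply/eqP/negPn/negP; rewrite -(mono10 e1 e2) => Ns.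
  have sN : ple 1 0 (dual s) N2.
    by rewrite -(ple_dual F) (dualK JT Ju Jp).
  have [G' [u' [v' [gG' G's]]]] := gen_below G (dual s).
  have G'N := ple_trans G G's sN.
  have [XG YG] := ple_deg G G'N; have [_ YN2] := ple_deg G PbN2.
  have [u2 [v2 GQ]] := all_le _ _ gG' sQl.
  have [_ YGQ] := ple_deg G GQ.
  have v'2 : (2 <= v')%N by rewrite -(ler_nat rat); have := ler0n rat v2; rewrite add0n in YG; lra.
  have := ple_to G (leq0n _) _ PbN2 G'N; rewrite add0n => /(_ v'2).
  by case/(genP G gPb) => /eqP; rewrite subn0 add1n.
have sPb' : sink (dual Pb) by rewrite -Qd.
have [y [Zy y0 hy]] := pred3_biv char0 F (proj1 e) sPb' NN2d NPb e1N e1N2.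
have : y = 0.
  by apply: Zneg Zy hy _; have [_ YN2] := ple_deg G PbN2; rewrite !dY; lra.
by move/eqP; rewrite (negPf y0).
Qed.

End CrossingForm.

(** * A source not below its dual sink *)

Section Exceptional.

Variables (K : fieldType) (n : nat) (X Y : 'I_n -> rat) (e1 e2 J : 'M[K]_n).
Variable Z : {vspace 'M[K]_n}.
Hypothesis char0 : [pchar K] =i pred0.
Hypothesis F : fgrid X Y e1 e2 J 1 Z.

Let G := fg_grid F.
Let JT := fg_JT F.
Let Ju := fg_Ju F.
Let Jp := fg_Jp F.

Local Notation dual := (dual J).
Local Notation ple := (ple e1 e2).
Local Notation gen := (gen e1 e2).
Local Notation sink := (sink e1 e2).

Variables (G0 : 'I_n).
Hypothesis gG0 : gen G0.
Hypothesis nG0 : forall i j, ~~ ple i j G0 (dual G0).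

Local Notation Q := (dual G0).

Let sQ : sink Q. Proof. by rewrite (sink_dual F). Qed.

(** If [e1] killed [N], [pred_biv_below] would join [G0] to [N], hence to [Q]. So the row of [N]
    reaches another sink [Q'], which is above [G0]. The path from [G0] cannot pass through [N], so
    [Q] lies to the left of [G0] and higher. *)
Lemma exceptional_pred2 N : ple 0 1 N Q ->
  exists Q' u a b, [/\ sink Q', ple u.+1 0 N Q', ple a b G0 Q', (a < u.+1)%N
    & X Q < X G0 /\ Y G0 < Y Q].
Proof.
move=> NQ; have [XQ YQ] := ple_deg G NQ; rewrite addr0 in XQ.
have [/forallP e1N|] := boolP [forall s, e1 s N == 0].
  have [i [j]] := pred_biv_below char0 F (erefl 1) sQ NQ (fun s => eqP (e1N s)).
  rewrite (dualK JT Ju Jp) => GN.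
  by have := ple_trans G GN NQ; rewrite (negPf (nG0 _ _)).
rewrite negb_forall => /existsP[s Ns0].
have Ns : ple 1 0 N s by rewrite pleE mono10.
have [Q' [u [v [sQ' sQ'']]]] := sink_above G s.
have NQ' := ple_trans G Ns sQ''.
have v0 : v = 0%N.
  case: (v) NQ' => // w NQ'.
  have := ple_from G (leq0n _) _ NQ NQ'; rewrite addn0 => /(_ isT).
  by case/(sinkP G sQ) => /eqP; rewrite subn0 addn1.
rewrite v0 addn1 addn0 in NQ'.
have [XQ' YQ'] := ple_deg G NQ'; rewrite addr0 in YQ'.
have QQ' : Q' != Q.
  by apply/eqP=> QQ'; rewrite QQ' in XQ'; have := ltr0Sn rat u; lra.
have [a [b GQ']] := gen_ple_sink char0 F gG0 sQ' (or_introl QQ').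
have [XG YG] := ple_deg G GQ'.
have au : (a < u.+1)%N.
  rewrite ltnNge; apply/negP=> ua.
  have GN := ple_to G ua (leq0n b) NQ' GQ'.
  by have := ple_trans G GN NQ; rewrite (negPf (nG0 _ _)).
have b0 := ler0n rat b; have au' : a%:R < u.+1%:R :> rat by rewrite ltr_nat.
by exists Q', u, a, b; split=> //; split; lra.
Qed.

End Exceptional.

Section ExceptionalRow.

Variables (K : fieldType) (n : nat) (X Y : 'I_n -> rat) (e1 e2 J : 'M[K]_n).
Variable Z : {vspace 'M[K]_n}.
Hypothesis char0 : [pchar K] =i pred0.
Hypothesis F : fgrid X Y e1 e2 J 1 Z.

Let G := fg_grid F.
Let JT := fg_JT F.
Let Ju := fg_Ju F.
Let Jp := fg_Jp F.

Local Notation dual := (dual J).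
Local Notation rple := (ple e2 e1).
Local Notation ple := (ple e1 e2).
Local Notation rgen := (gen e2 e1).
Local Notation gen := (gen e1 e2).
Local Notation sink := (sink e1 e2).

Variables (G0 : 'I_n).
Hypothesis gG0 : gen G0.
Hypothesis nG0 : forall i j, ~~ ple i j G0 (dual G0).

Local Notation Q := (dual G0).

Let sQ : sink Q. Proof. by rewrite (sink_dual F). Qed.

(** The inequalities of [exceptional_pred2] and those obtained by exchanging coordinates exclude
    each other, so [Q] has no predecessor under [e2]. Everything below [Q] is then one [e1]-row with
    a single source [A], and duality gives the row from [G0] to [dual A]. *)
Lemma exceptional_row N' : ple 1 0 N' Q ->
  exists A m v, [/\ gen A, ple m.+1 0 A Q, ple m v A (dual A),
    forall P i j, gen P -> ple i j P Q -> [/\ P = A, i = m.+1 & j = 0%N]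
    & forall S i j, sink S -> ple i j G0 S -> [/\ S = dual A, i = m.+1 & j = 0%N]].
Proof.
move=> NQ.
have nG0' i j : ~~ rple i j G0 Q by rewrite (pleC _ _ _ _ G).
have NQ' : rple 0 1 N' Q by rewrite (pleC _ _ _ _ G).
have gG0' : rgen G0 by rewrite genC.
have [B [v [b [a [sB NB GB _ [YGQ XGQ]]]]]] := exceptional_pred2 char0 (fgridC F) gG0' nG0' NQ'.
rewrite sinkC in sB; rewrite !(pleC _ _ _ _ G) in NB GB.
have nopred2 N : ~~ ple 0 1 N Q.
  by apply/negP=> /(exceptional_pred2 char0 F gG0 nG0)[? [? [? [? [_ _ _ _ [? ?]]]]]]; lra.
have row W i j : ple i j W Q -> j = 0%N.
  case: j => // j WQ.
  have [M _] := ple_splitle G (leqnn i) (leqnSn j) WQ.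
  by rewrite subnn subSnn (negPf (nopred2 _)).
have row' W i j : ple i j G0 W -> j = 0%N.
  by rewrite -(ple_dual F) => /row.
have b0 := row' _ _ _ GB; rewrite {}b0 in GB.
have sA : gen (dual B) by rewrite (gen_dual F).
have AQ : ple a 0 (dual B) Q by rewrite (ple_dual F).
have [XN YN] := ple_deg G NQ; have [XB YB] := ple_deg G NB.
have a0 : (0 < a)%N.
  rewrite lt0n; apply/eqP=> a0; move: GB; rewrite a0 ple00 => /eqP GB.
  by have := NB; rewrite -GB => /(genP G gG0)[].
case: a a0 => // m _ in GB AQ.
exists (dual B), m, v.+1; rewrite (dualK JT Ju Jp); split=> //.
- have AN := ple_to G (ltn0Sn m) (leqnn 0) NQ AQ.
  by have := ple_trans G AN NB; rewrite subn1 add0n addn0.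
- move=> P i j gP PQ; have j0 := row _ _ _ PQ; rewrite {}j0 in PQ *.
  have [im|mi] := leqP i m.+1.
    have /(genP G gP)[/eqP + _ AP] := ple_to G im (leqnn 0) PQ AQ.
    by rewrite subn_eq0 AP => mi; split=> //; apply/eqP; rewrite eqn_leq im.
  have /(genP G sA)[/eqP] := ple_to G (ltnW mi) (leqnn 0) AQ PQ.
  by rewrite subn_eq0 leqNgt mi.
move=> S i j sS GS; have j0 := row' _ _ _ GS; rewrite {}j0 in GS *.
have [im|mi] := leqP i m.+1.
  have /(sinkP G sS)[/eqP + _ BS] := ple_from G im (leqnn 0) GS GB.
  by rewrite subn_eq0 BS => mi; split=> //; apply/eqP; rewrite eqn_leq im.
have /(sinkP G sB)[/eqP] := ple_from G (ltnW mi) (leqnn 0) GB GS.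
by rewrite subn_eq0 leqNgt mi.
Qed.

(** [Q] is then both source and sink. Any source other than [G0] lies below [Q], hence equals it,
    and nothing else is left; this happens in size two, which is excluded later. *)
Lemma exceptional_nopred : (forall N, ~~ ple 1 0 N Q) -> (forall N, ~~ ple 0 1 N Q) ->
  (n <= 2)%N.
Proof.
move=> np1 np2.
have leQ W i j : ple i j W Q -> W = Q.
  case: i => [|i] WQ; last first.
    have [M _] := ple_splitle G (leqnSn i) (leqnn j) WQ.
    by rewrite subnn subSnn (negPf (np1 _)).
  case: j WQ => [|j] WQ; first by move: WQ; rewrite ple00 => /eqP.
  have [M _] := ple_splitle G (leqnn 0) (leqnSn j) WQ.
  by rewrite subnn subSnn (negPf (np2 _)).
have gens P : gen P -> P = G0 \/ P = Q.
  move=> gP; have [->|PG0] := eqVneq P G0; first by left.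
  have [|i [j /leQ]] := gen_ple_sink char0 F gP sQ; last by right.
  by left; apply: contraNneq PG0 => /(dual_inj JT Ju Jp) ->.
have all2 s : s \in [set G0; Q].
  rewrite !inE; have [P [i [j [gP Ps]]]] := gen_below G s.
  have [S [k [l [sS sS']]]] := sink_above G s.
  have gS : gen (dual S) by rewrite (gen_dual F).
  case: (gens _ gP) => eP; rewrite {}eP in gP Ps.
    case: (gens _ gS) => eS.
      have SQ : S = Q by rewrite -eS (dualK JT Ju Jp).
      by rewrite SQ in sS'; rewrite (leQ _ _ _ sS') eqxx orbT.
    have SG : S = G0 by apply: (dual_inj JT Ju Jp).
    by rewrite SG in sS'; have [_ _ ->] := genP G gG0 sS'; rewrite eqxx.
  by have [_ _ ->] := sinkP G sQ Ps; rewrite eqxx orbT.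
rewrite -[n]card_ord (leq_trans (subset_leq_card (introT subsetP (fun s _ => all2 s)))) //.
by rewrite cards2; case: (_ != _).
Qed.

Variables (x c : 'M[K]_n) (i : nat) (A : 'I_n).
Hypothesis Zx : x \in Z.
Hypothesis cc : c \in core X Y e1 e2 Z.
Hypothesis hc : homog X Y i%:R 0 c.
Hypothesis AQ : ple i 0 A Q.

(** Skewness of [c] on the two dual rows gives equal coefficients for odd [i], so [i] is even and
    [e1^i] is self-adjoint. An entry of the skew [x] joining the rows and commuting with [e1^i]
    gives the same relation with the opposite sign. *)
Lemma exceptional_sign : coef e1 e2 i 0 c A != coef e1 e2 i 0 c G0 ->
  x G0 A != 0 \/ x A G0 != 0 -> False.
Proof.
move=> neq_c x0.
have dJ := dualK JT Ju Jp.
pose B := dual A; have GB : ple i 0 G0 B by rewrite -(ple_dual F) dJ.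
have hm := mono_entry F i 0 Q A; rewrite dJ -/B addn0 in hm.
have Zc : c \in Z by case/coreP: cc.
have hcc := gform_entry JT Ju Jp Q A (Zgform F Zc); rewrite dJ -/B in hcc.
have hc0 : homog X Y i%:R 0%:R c := hc.
have cE := core_coef G cc hc0; rewrite !cE in hcc.
have JAB : J A B != 0 by exact: J_dual.
have JQG : J Q G0 != 0 by have := J_dual Ju Q; rewrite dJ.
set m1 := mono e1 e2 i 0 Q A in hm hcc *; set m2 := mono e1 e2 i 0 B G0 in hm hcc *.
have m1n0 : m1 != 0 by []. have m2n0 : m2 != 0 by [].
have ev : (-1) ^+ i = 1 :> K.
  have := hm; rewrite -signr_odd; case: (odd i) => //= hm'; rewrite expr1 in hm'.
  case/eqP: neq_c; apply: (mulfI (mulf_neq0 m1n0 JQG)).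
  rewrite mulrAC hcc hm'; ring.
rewrite ev mul1r in hm.
have key : J Q G0 * m1 = - (J A B * m2).
  have comm := Zmono (fg_comm F) i 0 Zx.
  case: x0 => x0; apply: (mulfI x0).
    have gx := gform_entry JT Ju Jp G0 A (Zgform F Zx); rewrite -/B in gx.
    have := congr1 (fun C : 'M_n => C B A) comm => /=.
    rewrite (mulmx_coluniq _ _ (pinj_mono G _ _) AQ).
    rewrite (mulmx_rowuniq _ _ (pinj_mono G _ _) GB) -/m1 -/m2 => xm.
    rewrite mulrA (Jsym JT Q) mul1r gx mulNr -mulrA xm; ring.
  have gx := gform_entry JT Ju Jp A G0 (Zgform F Zx); rewrite -/B in gx.
  have := congr1 (fun C : 'M_n => C Q G0) comm => /=.
  rewrite (mulmx_coluniq _ _ (pinj_mono G _ _) GB).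
  rewrite (mulmx_rowuniq _ _ (pinj_mono G _ _) AQ) -/m1 -/m2 => xm.
  rewrite mulrN (mulrA _ (J A B)) gx mulNr opprK -mulrA xm (Jsym JT Q) mul1r; ring.
move: key; rewrite -hm (mulrC m1) => /eqP; rewrite -addr_eq0 -mulr2n -mulr_natl.
by rewrite !mulf_eq0 ((pcharf0P K).1 char0) (negPf JQG) (negPf m1n0).
Qed.

End ExceptionalRow.

Section ExceptionalFailure.

Variables (K : fieldType) (n : nat) (X Y : 'I_n -> rat) (e1 e2 J : 'M[K]_n).
Variable Z : {vspace 'M[K]_n}.
Hypothesis char0 : [pchar K] =i pred0.
Hypothesis F : fgrid X Y e1 e2 J 1 Z.

Local Notation dual := (dual J).
Local Notation ple := (ple e1 e2).
Local Notation gen := (gen e1 e2).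
Local Notation sink := (sink e1 e2).

Variables (x c : 'M[K]_n) (p q : rat) (i j : nat) (P T M R : 'I_n).
Hypothesis Fl : failure X Y e1 e2 Z x p q c i j P T M R.

Variables (Ql Qk Pb : 'I_n) (a1 b1 a2 b2 a3 b3 : nat).
Hypothesis sQl : sink Ql.
Hypothesis sQk : sink Qk.
Hypothesis gPb : gen Pb.
Hypothesis MQl : ple a1 b1 M Ql.
Hypothesis RQk : ple a2 b2 R Qk.
Hypothesis PbT : ple a3 b3 Pb T.

Let G := fg_grid F.

Let PQl : ple (a1 + i) (b1 + j) P Ql.
Proof. exact: (ple_trans G (fail_PM Fl) MQl). Qed.

Let TQk : ple (a2 + i) (b2 + j) T Qk.
Proof. exact: (ple_trans G (fail_TR Fl) RQk). Qed.

Let PbQk : ple (a2 + i + a3) (b2 + j + b3) Pb Qk.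
Proof. exact: (ple_trans G PbT TQk). Qed.

(** [exceptional_row] leaves no freedom: the window is the whole row, [P] is its source and
    [T = Pb], so [x] joins the two rows as [exceptional_sign] forbids. *)
Lemma exceptional_fail_gen N : Ql = dual Pb -> (forall a b, ~~ ple a b Pb Ql) ->
  ple 1 0 N Ql -> False.
Proof.
move=> QlE; rewrite QlE => nPb NQ.
have [A [m [v [gA AQ AB gens sinks]]]] := exceptional_row char0 F gPb nPb NQ.
have := PQl; rewrite QlE => /(gens _ _ _ (fail_gen Fl))[PA im /eqP].
rewrite addn_eq0 => /andP[/eqP b10 /eqP j0].
have [QkB im' _] := sinks _ _ _ sQk PbQk.
have := fail_notwindow G (fg_comm F) Fl MQl RQk PbT (a := m) (b := v).
rewrite PA QkB j0 ltn0 orbF => /(_ AB) mi.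
have iE : i = m.+1 by apply/eqP; rewrite eqn_leq mi -im leq_addl.
have a30 : a3 = 0%N by clear -im' iE; lia.
have TPb : T = Pb.
  have [XT YT] := ple_deg G (fail_TR Fl).
  case: (sinks _ _ _ sQk PbQk) => _ _ /eqP; rewrite addn_eq0 => /andP[_ /eqP b30].
  by move: PbT; rewrite a30 b30 ple00 => /eqP.
rewrite -iE in AQ; have hc : homog X Y i%:R 0 c by have := fail_hc Fl; rewrite j0.
apply: (exceptional_sign char0 F (fail_x Fl) (fail_c Fl) hc AQ).
  by rewrite -PA -TPb; have := fail_coef Fl; rewrite j0.
by left; rewrite -PA -TPb (fail_PT Fl).
Qed.

Lemma exceptional_fail_sink N : Qk = dual P -> (forall a b, ~~ ple a b P Qk) ->
  ple 1 0 N Qk -> False.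
Proof.
move=> QkE; rewrite QkE => nP NQ.
have [A [m [v [gA AQ AB gens sinks]]]] := exceptional_row char0 F (fail_gen Fl) nP NQ.
have := PbQk; rewrite QkE => /(gens _ _ _ gPb)[PbA im /eqP].
rewrite !addn_eq0 => /andP[/andP[/eqP b20 /eqP j0] /eqP b30].
have [QlB im' _] := sinks _ _ _ sQl PQl.
have := fail_notwindow' G (fg_comm F) Fl MQl RQk PbT (a := m) (b := v).
rewrite PbA QlB j0 ltn0 orbF => /(_ AB) mi.
have iE : i = m.+1 by apply/eqP; rewrite eqn_leq mi -im' leq_addl.
have a30 : a3 = 0%N by clear -im iE; lia.
have TA : T = A by move: PbT; rewrite PbA a30 b30 ple00 => /eqP.
rewrite -iE in AQ; have hc : homog X Y i%:R 0 c by have := fail_hc Fl; rewrite j0.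
apply: (exceptional_sign char0 F (fail_x Fl) (fail_c Fl) hc AQ).
  by rewrite -TA eq_sym; have := fail_coef Fl; rewrite j0.
by right; rewrite -TA (fail_PT Fl).
Qed.

End ExceptionalFailure.

(** * Contradiction for partial permutation matrices preserving a form *)

Section FormAbelian.

Variables (K : fieldType) (n : nat) (X Y : 'I_n -> rat) (e1 e2 J : 'M[K]_n) (eps : K).
Variable Z : {vspace 'M[K]_n}.
Hypothesis char0 : [pchar K] =i pred0.
Hypothesis F : fgrid X Y e1 e2 J eps Z.
Hypothesis n2 : eps = 1 -> (2 < n)%N.

Local Notation dual := (dual J).
Local Notation rple := (ple e2 e1).
Local Notation ple := (ple e1 e2).
Local Notation rgen := (gen e2 e1).
Local Notation gen := (gen e1 e2).
Local Notation rsink := (sink e2 e1).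
Local Notation sink := (sink e1 e2).

Let G := fg_grid F.

Lemma gen_sink_cases P Q : gen P -> sink Q -> (exists a b, ple a b P Q) \/
  [/\ eps = 1, Q = dual P, forall a b, ~~ ple a b P Q
    & exists N, ple 1 0 N Q \/ ple 0 1 N Q].
Proof.
move=> gP sQ.
have [PQ|] := boolP (below X Y e1 e2 P Q); first by left; apply/(belowP G).
move=> nPQ.
have nple a b : ~~ ple a b P Q.
  by apply: contra nPQ => PQ; apply/(belowP G); exists a, b.
have le := gen_ple_sink char0 F gP sQ.
have e : eps = 1.
  case: (fg_eps F) => // e; case: (le (or_intror e)) => a [b].
  by rewrite (negPf (nple _ _)).
have QP : Q = dual P.
  apply/eqP/negPn/negP=> QP; case: (le (or_introl QP)) => a [b].
  by rewrite (negPf (nple _ _)).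
right; split=> //.
have [/existsP[N /orP NQ]|] := boolP [exists N, ple 1 0 N Q || ple 0 1 N Q].
  by exists N.
rewrite negb_exists => /forallP np; exfalso.
move: F; rewrite e => F1; have := n2 e; rewrite ltnNge => /negP; apply.
by apply: (exceptional_nopred char0 F1 gP); rewrite -QP //= => N;
   have := np N; rewrite negb_or => /andP[].
Qed.

Lemma form_abelian_absurd : False.
Proof.
have [x [p [q [c [i [j [P [T [M [R Fl]]]]]]]]]] :=
  nonabelian_failure G (fg_comm F) (fg_comp F) (fg_dim F) (fg_nab F).
have [Ql [a1 [b1 [sQl MQl]]]] := sink_above G M.
have [Qk [a2 [b2 [sQk RQk]]]] := sink_above G R.
have [Pb [a3 [b3 [gPb PbT]]]] := gen_below G T.
have p' C D u v : ple u v C D -> rple v u C D by rewrite (pleC _ _ _ _ G).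
have Fl' := failureC G Fl; have F' := fgridC F.
have sC Q : rsink Q = sink Q := sinkC _ _ _.
have gC Q : rgen Q = gen Q := genC _ _ _.
case: (gen_sink_cases (fail_gen Fl) sQk) => [[a [b PQk]]|[e QkE nle [N NQ]]]; last first.
  move: F F'; rewrite e => F1 F1'; case: NQ => NQ.
    exact: (exceptional_fail_sink char0 F1 Fl sQl gPb MQl RQk PbT QkE nle NQ).
  apply: (exceptional_fail_sink char0 F1' Fl' _ _ (p' _ _ _ _ MQl)
    (p' _ _ _ _ RQk) (p' _ _ _ _ PbT) QkE _ (p' _ _ _ _ NQ)); rewrite ?sC ?gC //.
  by move=> u v; rewrite (pleC _ _ _ _ G).
case: (gen_sink_cases gPb sQl) => [[a' [b' PbQl]]|[e QlE nle [N NQ]]]; last first.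
  move: F F'; rewrite e => F1 F1'; case: NQ => NQ.
    exact: (exceptional_fail_gen char0 F1 Fl sQk gPb MQl RQk PbT QlE nle NQ).
  apply: (exceptional_fail_gen char0 F1' Fl' _ _ (p' _ _ _ _ MQl)
    (p' _ _ _ _ RQk) (p' _ _ _ _ PbT) QlE _ (p' _ _ _ _ NQ)); rewrite ?sC ?gC //.
  by move=> u v; rewrite (pleC _ _ _ _ G).
have /orP[ai|bj] := fail_notwindow G (fg_comm F) Fl MQl RQk PbT PQk.
  exact: (crossing_form_left char0 F Fl sQl gPb MQl RQk PbT PQk PbQl ai).
apply: (crossing_form_left char0 F' Fl' _ _ (p' _ _ _ _ MQl) (p' _ _ _ _ RQk)
  (p' _ _ _ _ PbT) (p' _ _ _ _ PQk) (p' _ _ _ _ PbQl) bj); by rewrite ?sC ?gC.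
Qed.

End FormAbelian.

(** * Counting weights *)

Section SymbolMatrix.

Variables (K : fieldType) (n : nat).

(* Stands for the action of a grading element on a type where the differences of
   weights need not be integers: only their variation by [k] under [e] matters. *)
Definition scale_deg (W : 'I_n -> rat) (A : 'M[K]_n) : 'M[K]_n :=
  \matrix_(s, t) ((Num.floor (W s - W t))%:~R * A s t).

Lemma scale_deg_is_linear W : linear (scale_deg W).
Proof. by move=> a A B; apply/matrixP=> s t; rewrite !mxE mulrDr mulrCA. Qed.

HB.instance Definition _ W :=
  GRing.isLinear.Build K 'M[K]_n 'M[K]_n _ (scale_deg W) (scale_deg_is_linear W).

Lemma scale_deg_admx (k : int) W (e A : 'M[K]_n) : (forall s t, e s t != 0 -> W s = W t + k%:~R) ->
  scale_deg W (admx e A) = admx e (scale_deg W A) + k%:~R *: admx e A.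
Proof.
have floorD (q : rat) : (Num.floor (q + k%:~R))%:~R = (Num.floor q)%:~R + k%:~R :> K.
  by rewrite Num.Theory.floorDrz ?rpred_int // Num.Theory.intrKfloor rmorphD.
move=> he; apply/matrixP=> s t; rewrite [LHS]mxE [RHS]mxE [X in _ = _ + X]mxE !admxE.
rewrite mulrBr mulrBr addrACA -opprD; congr (_ - _).
  rewrite ![in LHS]mxE ![in RHS]mxE !mulr_sumr -big_split; apply: eq_bigr => u _ /=.
  rewrite !mxE; have [->|/eqP/he E] := e s u =P 0; first by rewrite !mul0r !mulr0 addr0.
  have -> : W s - W t = W u - W t + k%:~R by rewrite E addrAC.
  by rewrite floorD; ring.
rewrite ![in LHS]mxE ![in RHS]mxE !mulr_sumr -big_split; apply: eq_bigr => u _ /=.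
rewrite !mxE; have [->|/eqP/he E] := e u t =P 0; first by rewrite !mulr0 addr0.
have -> : W s - W t = W s - W u + k%:~R by rewrite E opprD addrA addrNK.
by rewrite floorD; ring.
Qed.

Lemma symbol_mx (X Y : 'I_n -> rat) e1 e2 (T A : {vspace 'M[K]_n}) :
  [pchar K] =i pred0 -> homog X Y 1 0 e1 -> homog X Y 0 1 e2 -> e1 *m e2 = e2 *m e1 ->
  (forall B, B \in T -> homog X Y 0 0 B) -> (T <= A)%VS ->
  (forall B, B \in A -> admx e1 B \in A) -> (forall B, B \in A -> admx e2 B \in A) ->
  (\dim T <= \dim (A :&: (lker (linfun (admx e1)) :&: lker (linfun (admx e2)))))%N.
Proof.
move=> char0 h1 h2 e12 hT TA A1 A2.
have [m1 N1] := admx_nilpotent h1.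
have h2' : homog Y X 1 0 e2 by move=> s t /h2[].
have [m2 N2] := admx_nilpotent h2'.
have iterE (e : 'M[K]_n) m B : iter m (linfun (admx e)) B = iter m (admx e) B.
  by elim: m => //= m ->; rewrite lfunE.
have zero W (B : 'M[K]_n) : (forall s t, B s t != 0 -> W s = W t) -> scale_deg W B = 0.
  move=> h; apply/matrixP=> s t; rewrite !mxE.
  have [->|/eqP/h->] := B s t =P 0; first by rewrite mulr0.
  by rewrite subrr floor0 mul0r.
have iter0 m (e B : 'M[K]_n) k : iter m (admx e) B = 0 -> (m <= k)%N -> iter k (admx e) B = 0.
  move=> h mk; rewrite -(subnK mk) iterD h; elim: (k - m)%N => //= l ->; exact: linear0.
apply: (@symbol_ker _ _ char0 _ _ (linfun (scale_deg X)) (linfun (scale_deg Y)) _ _ (m1 + m2)).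
- by move=> B; rewrite !lfunE /= (@scale_deg_admx 1) ?scale1r // => s t /h1[].
- by move=> B; rewrite !lfunE /= (@scale_deg_admx 1) ?scale1r // => s t /h2[].
- move=> B; rewrite !lfunE /= (@scale_deg_admx 0) ?scale0r ?addr0 // => s t /h1[_ ->].
  by rewrite addr0.
- by move=> B; rewrite !lfunE /= admxC.
- by move=> B; rewrite iterE (iter0 m1) ?leq_addr.
- by move=> B; rewrite iterE (iter0 m2) ?leq_addl.
- apply/subvP=> B /hT hB; rewrite memv_ker lfunE /= zero // => s t /hB[-> _].
  by rewrite addr0.
- apply/subvP=> B /hT hB; rewrite memv_ker lfunE /= zero // => s t /hB[_ ->].
  by rewrite addr0.
- by [].
- by apply/subvP=> C /memv_imgP[B BA ->]; rewrite lfunE /= A1.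
- by apply/subvP=> C /memv_imgP[B BA ->]; rewrite lfunE /= A2.
Qed.

End SymbolMatrix.

(** The map [g] serves to cancel the factor [J] of bivectors before their entries are read. *)
Lemma card_le_dim (K : fieldType) n (g : {linear 'M[K]_n -> 'M[K]_n}) (U : {vspace 'M[K]_n})
    (S : {set 'I_n * 'I_n}) (f : 'I_n * 'I_n -> 'M[K]_n) :
  (forall u, u \in S -> f u \in U) ->
  (forall u v, u \in S -> v \in S -> (g (f u) v.1 v.2 != 0) = (u == v)) ->
  (#|S| <= \dim U)%N.
Proof.
move=> fU gf; pose X := [tuple f (enum_val i) | i < #|S|].
have freeX : free X.
  have Xi (j : 'I_#|S|) : X`_j = f (enum_val j) by rewrite -tnth_nth tnth_mktuple.
  apply/freeP=> k; under eq_bigr do rewrite Xi; move=> kX i; pose v := enum_val i.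
  have := congr1 (fun B => g B v.1 v.2) kX; rewrite linear_sum linear0 /= summxE [RHS]mxE.
  rewrite (bigD1 i) //= big1 ?addr0 => [|j ji].
    rewrite linearZ /= mxE => /eqP; rewrite mulf_eq0.
    have := gf _ _ (enum_valP i) (enum_valP i); rewrite eqxx => /negPf.
    by rewrite -/v => ->; rewrite orbF => /eqP.
  rewrite linearZ /= mxE.
  have := gf _ _ (enum_valP j) (enum_valP i); rewrite (inj_eq enum_val_inj) (negPf ji).
  by move=> /negbFE/eqP ->; rewrite mulr0.
move: freeX; rewrite /free size_tuple => /eqP <-.
by rewrite dimvS //; apply/span_subvP=> B /mapP[i _ ->]; apply: fU; apply: enum_valP.
Qed.

(** Some term of the Leibniz formula is nonzero. This matches opposite weights bijectively before
    [J] is known to be a partial permutation matrix. *)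
Lemma unitmx_transversal (K : fieldType) n (J : 'M[K]_n) : J \in unitmx ->
  exists p : 'S_n, forall s, J s (p s) != 0.
Proof.
move=> Ju; case: (pickP [pred p : 'S_n | [forall s, J s (p s) != 0]]) => [p /forallP|no].
  by exists p.
move: Ju; rewrite unitmxE unitfE /determinant big1 ?eqxx // => p _.
have := no p => /= /negbT; rewrite negb_forall => /existsP[s]; rewrite negbK => /eqP Js.
by rewrite (bigD1 s) //= Js mul0r mulr0.
Qed.

Lemma card_pairs n (P : rel 'I_n) :
  #|[set u : 'I_n * 'I_n | P u.1 u.2]| = (\sum_s \sum_t P s t)%N.
Proof.
rewrite pair_bigA /= -sum1dep_card big_mkcond; apply: eq_bigr => u _ /=.
by case: (P _ _).
Qed.

(* Weights opposite to that of [s]: those which the form may pair with it. *)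
Definition wopp n (X Y : 'I_n -> rat) s := [set t | (X s + X t == 0) && (Y s + Y t == 0)].

Definition deg0 (K : fieldType) n (X Y : 'I_n -> rat) : {vspace 'M[K]_n} :=
  lker (linfun (@offpart K n (fun t s => (X s == X t) && (Y s == Y t)))).

Lemma deg0P (K : fieldType) n (X Y : 'I_n -> rat) (A : 'M[K]_n) :
  reflect (homog X Y 0 0 A) (A \in deg0 K X Y).
Proof.
rewrite memv_ker lfunE /=; apply: (iffP (offpart_eq0 _ _)) => h s t /h.
  by rewrite !addr0 => /andP[/eqP -> /eqP ->].
by rewrite !addr0 => -[-> ->]; rewrite !eqxx.
Qed.

(** What the grading provides before anything is known about multiplicities. In [fd_dim], [n./2]
    stands for the rank, which [toral_form_bound] bounds by it. *)
Record fdata (K : fieldType) n (X Y : 'I_n -> rat) (e1 e2 J : 'M[K]_n) (eps : K) : Prop :=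
  Fdata {
  fd_h1 : homog X Y 1 0 e1;
  fd_h2 : homog X Y 0 1 e2;
  fd_comm : e1 *m e2 = e2 *m e1;
  fd_eps : eps = 1 \/ eps = -1;
  fd_JT : J^T = eps *: J;
  fd_Ju : J \in unitmx;
  fd_J : forall s t, J s t != 0 -> X s + X t = 0 /\ Y s + Y t = 0;
  fd_e1 : e1 \in gform J;
  fd_e2 : e2 \in gform J;
  fd_dim : (\dim (centr (gform J) e1 e2) <= (n./2).+1)%N }.

Lemma fdataC (K : fieldType) n (X Y : 'I_n -> rat) (e1 e2 J : 'M[K]_n) eps :
  fdata X Y e1 e2 J eps -> fdata Y X e2 e1 J eps.
Proof.
case=> h1 h2 c he JT Ju dJ g1 g2 dZ; split=> //.
- by move=> s t /h2[].
- by move=> s t /h1[].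
- by move=> s t /dJ[].
- by rewrite centrC.
Qed.

Section Counting.

Variables (n : nat) (X Y : 'I_n -> rat).
Local Notation wopp := (wopp X Y).
Local Notation S0 := [set s | s \in wopp s].
Local Notation Slt := [set u : 'I_n * 'I_n | (u.1 < u.2)%N && (u.2 \in wopp u.1)].

Lemma wopp_sym s t : (t \in wopp s) = (s \in wopp t).
Proof. by rewrite !inE addrC [Y s + _]addrC. Qed.

Lemma wopp_S0 s : s \in S0 -> wopp s = S0.
Proof.
rewrite !inE => /andP[/eqP Xs /eqP Ys]; apply/setP=> t; rewrite !inE.
have -> : X s = 0 by lra.
have -> : Y s = 0 by lra.
by rewrite !add0r -!mulr2n !mulrn_eq0.
Qed.

Lemma sum_wopp : (\sum_s #|wopp s| = 2 * #|Slt| + #|S0|)%N.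
Proof.
have -> : #|S0| = (\sum_s \sum_t ((s == t) && (t \in wopp s)))%N.
  rewrite -sum1dep_card big_mkcond; apply: eq_bigr => s _ /=.
  rewrite (bigD1 s) //= eqxx /= big1 ?addn0 => [|t ts]; first by case: (_ \in _).
  by rewrite eq_sym (negPf ts).
rewrite mul2n -addnn (@card_pairs n (fun s t => (s < t)%N && (t \in wopp s))).
rewrite {2}exchange_big /= -!big_split; apply: eq_bigr => s _ /=.
rewrite -!big_split -sum1_card big_mkcond; apply: eq_bigr => t _ /=.
rewrite -(wopp_sym t s) (wopp_sym t s); case: (t \in wopp s); rewrite ?andbF // !andbT.
by rewrite -val_eqE /=; case: ltngtP.
Qed.

Variable p : 'S_n.
Hypothesis wopp_p : forall s, p s \in wopp s.

Lemma wopp_gt0 s : (0 < #|wopp s|)%N.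
Proof. by apply/card_gt0P; exists (p s). Qed.

Lemma sum_wopp_split : (\sum_s #|wopp s| = \sum_(s | s \notin S0) #|wopp s| + #|S0| * #|S0|)%N.
Proof.
rewrite (bigID (mem S0)) /= addnC; congr addn.
by rewrite (eq_bigr (fun=> #|S0|)) ?sum_nat_const // => s /wopp_S0 ->.
Qed.

Lemma sum_wopp_ge : (n - #|S0| + #|S0| * #|S0| <= \sum_s #|wopp s|)%N.
Proof.
rewrite sum_wopp_split leq_add2r -{1}[n]card_ord -(cardsC S0) addKn -sum1_card.
rewrite (eq_bigl (fun s => s \notin S0)); last by move=> s; rewrite !inE.
by apply: leq_sum => s _; apply: wopp_gt0.
Qed.

(** If [s0] and [t0] share a nonzero weight, each of [s0], [t0] and their two partners has at least
    two vectors of opposite weight: four more pairs. *)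
Lemma sum_wopp_ge4 s0 t0 : X s0 = X t0 -> Y s0 = Y t0 -> s0 != t0 -> s0 \notin S0 ->
  (n - #|S0| + 4 + #|S0| * #|S0| <= \sum_s #|wopp s|)%N.
Proof.
move=> Xst Yst st s0S.
pose F := [set s0; t0; p s0; p t0].
have wp s : X (p s) = - X s /\ Y (p s) = - Y s.
  by have := wopp_p s; rewrite inE => /andP[/eqP ? /eqP ?]; split; lra.
have [[Xs Ys] [Xt Yt]] := (wp s0, wp t0).
have nz : X s0 != 0 \/ Y s0 != 0.
  move: s0S; rewrite !inE -!mulr2n !mulrn_eq0 /= negb_and => /orP[]; [by left|by right].
have np s t : X s = X s0 -> Y s = Y s0 -> X t = - X s0 -> Y t = - Y s0 -> s != t.
  move=> Es Es' Et Et'; apply/eqP=> e; rewrite -e Es Es' in Et Et'.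
  by case: nz => /eqP; lra.
have F4 : #|F| = 4%N.
  rewrite /F -!setUA !cardsU1 cards1 !inE !negb_or.
  have pst : p s0 != p t0 by rewrite (inj_eq perm_inj).
  by rewrite st pst !np // ?Xt ?Yt ?Xst ?Yst.
have Fnot s : s \in F -> s \notin S0.
  rewrite !inE -!mulr2n !mulrn_eq0 /= negb_and => sF; apply/orP.
  move: sF; rewrite -!orbA => /or4P[]/eqP ->;
    rewrite ?Xs ?Ys ?Xt ?Yt -?Xst -?Yst ?oppr_eq0 //; exact: nz.
have F2 s : s \in F -> (1 < #|wopp s|)%N.
  have two s1 t1 t2 : t1 != t2 -> t1 \in wopp s1 -> t2 \in wopp s1 -> (1 < #|wopp s1|)%N.
    move=> t12 o1 o2; apply: (@leq_trans #|[set t1; t2]|); first by rewrite cards2 t12.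
    apply: subset_leq_card.
    by apply/subsetP=> u; rewrite in_set2 => /orP[]/eqP->.
  have pst : p s0 != p t0 by rewrite (inj_eq perm_inj).
  rewrite !inE -!orbA => /or4P[]/eqP ->;
    [apply: (two _ _ _ pst)|apply: (two _ _ _ pst)|apply: (two _ _ _ st)|apply: (two _ _ _ st)];
    rewrite inE ?Xs ?Ys ?Xt ?Yt ?Xst ?Yst; apply/andP; split; apply/eqP; lra.
rewrite sum_wopp_split leq_add2r -{1}[n]card_ord -(cardsC S0) addKn -F4 -!sum1_card.
rewrite (eq_bigl (fun s => s \notin S0)); last by move=> s; rewrite !inE.
rewrite [X in (_ + X)%N](_ : _ = \sum_(s | s \notin S0) (s \in F))%N; last first.
  rewrite [RHS]big_mkcond [LHS]big_mkcond; apply: eq_bigr => s _.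
  by case: (boolP (s \in F)) => [/Fnot ->|_] //; case: ifP.
rewrite -big_split; apply: leq_sum => s _ /=.
by case: (boolP (s \in F)) => [/F2|_] //=; rewrite addn0 wopp_gt0.
Qed.

End Counting.

Section StableBelow.

Variables (K : fieldType) (n : nat) (X Y : 'I_n -> rat) (e1 e2 : 'M[K]_n).
Hypothesis G : grid X Y e1 e2.

Definition below_space : {vspace 'M[K]_n} := lker (linfun (@offpart K n (below X Y e1 e2))).

Lemma below_spaceP (A : 'M[K]_n) :
  reflect (forall R P, A R P != 0 -> below X Y e1 e2 P R) (A \in below_space).
Proof. by rewrite memv_ker lfunE /=; apply: offpart_eq0. Qed.

Lemma below_trans P Q R : below X Y e1 e2 P Q -> below X Y e1 e2 Q R -> below X Y e1 e2 P R.
Proof.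
move=> /(belowP G)[i [j PQ]] /(belowP G)[k [l QR]]; apply/(belowP G).
by exists (k + i)%N, (l + j)%N; apply: (ple_trans G PQ).
Qed.

Lemma below_refl P : below X Y e1 e2 P P.
Proof. by apply/(belowP G); exists 0%N, 0%N; rewrite ple00. Qed.

Lemma below_space_admx (e A : 'M[K]_n) : (forall s t, e s t != 0 -> below X Y e1 e2 t s) ->
  A \in below_space -> admx e A \in below_space.
Proof.
move=> he /below_spaceP hA; apply/below_spaceP=> R P; rewrite admxE => nz.
have : ((e *m A) R P != 0) || ((A *m e) R P != 0).
  by apply: contraNT nz; rewrite negb_or !negbK => /andP[/eqP -> /eqP ->]; rewrite subr0.
case/orP=> /mulmx_neq0[Q nz1 nz2].
  exact: below_trans (hA _ _ nz2) (he _ _ nz1).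
exact: below_trans (he _ _ nz2) (hA _ _ nz1).
Qed.

Lemma below1 s t : e1 s t != 0 -> below X Y e1 e2 t s.
Proof. by move=> st; apply/(belowP G); exists 1%N, 0%N; rewrite /ple mono10. Qed.

Lemma below2 s t : e2 s t != 0 -> below X Y e1 e2 t s.
Proof. by move=> st; apply/(belowP G); exists 0%N, 1%N; rewrite /ple mono01. Qed.

End StableBelow.

Lemma homog_pinj (K : fieldType) n (X Y : 'I_n -> rat) p q (A : 'M[K]_n) :
  (forall s t, X s = X t -> Y s = Y t -> s = t) -> homog X Y p q A -> pinj A.
Proof.
move=> inj hA; split=> [R R' P /hA[x1 y1] /hA[x2 y2]|R P P' /hA[x1 y1] /hA[x2 y2]].
  by apply: inj; rewrite ?x1 ?y1.
by apply: inj; [apply: (addIr p); rewrite -x1|apply: (addIr q); rewrite -y1].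
Qed.

(** * Multiplicities of the weights *)

Section FData.

Variables (K : fieldType) (n : nat) (X Y : 'I_n -> rat) (e1 e2 J : 'M[K]_n) (eps : K).
Hypothesis char0 : [pchar K] =i pred0.
Hypothesis F : fdata X Y e1 e2 J eps.
Local Notation Z := (centr (gform J) e1 e2).
Local Notation wopp := (wopp X Y).
Local Notation S0 := [set s | s \in wopp s].
Local Notation Slt := [set u : 'I_n * 'I_n | (u.1 < u.2)%N && (u.2 \in wopp u.1)].
Local Notation bivJ := (bivJ J eps).

(** Indexes independent degree-zero elements of the algebra. Equal indices count only for
    [eps = -1], since [bivJ a a] vanishes for [eps = 1]. *)
Definition half_pairs := [set u : 'I_n * 'I_n |
  (u.2 \in wopp u.1) && ((u.1 < u.2)%N || (u.1 == u.2) && (eps == -1))].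

Lemma woppP s t : reflect (X s + X t = 0 /\ Y s + Y t = 0) (t \in wopp s).
Proof. by rewrite inE; apply: (iffP andP) => -[/eqP ? /eqP ?]. Qed.

Lemma wopp_perm : exists p : 'S_n, forall s, p s \in wopp s.
Proof.
have [p Jp] := unitmx_transversal (fd_Ju F); exists p => s.
by apply/woppP/(fd_J F).
Qed.

Lemma card_half_pairs : #|half_pairs| = (#|Slt| + (eps == -1)%R * #|S0|)%N.
Proof.
rewrite -(cardsID Slt half_pairs); congr addn.
  apply: eq_card => u; rewrite !inE.
  by case: (u.1 < u.2)%N => /=; rewrite ?andbF ?andbT ?andbb.
have [e|e] := eqVneq eps (-1); last first.
  rewrite mul0n; apply: eq_card0 => u; rewrite !inE (negPf e) andbF orbF.
  by case: (u.1 < u.2)%N => /=; rewrite ?andbF ?andbT ?andNb.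
have dinj : injective (fun s : 'I_n => (s, s)) by move=> s t [].
rewrite mul1n -[RHS](card_imset _ dinj).
apply: eq_card => -[s t]; rewrite !inE e eqxx andbT /=; apply/idP/imsetP=> /=.
  move=> /andP[nlt /andP[o lt_or]]; move: nlt lt_or o.
  move=> + + o; rewrite o andbT => /negPf -> /= /eqP st; move: o; rewrite -st => o.
  by exists s; rewrite // !inE o.
by move=> [u + [-> ->]]; rewrite !inE ltnn eqxx => ->.
Qed.

Lemma bivJ_homog_gr a b : homog X Y (X a + X b) (Y a + Y b) (bivJ a b).
Proof.
move=> s t /mulmx_neq0[u]; rewrite !mxE => nz /(fd_J F)[Xt Yt].
have : (s == a) && (u == b) || (s == b) && (u == a).
  by apply: contraNT nz; rewrite negb_or => /andP[/negPf-> /negPf->]; rewrite mulr0 subr0.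
by case/orP=> /andP[/eqP-> /eqP ub]; rewrite ub in Xt Yt; split; lra.
Qed.

Lemma half_pairs_dim (S : {set 'I_n * 'I_n}) (U : {vspace 'M[K]_n}) : S \subset half_pairs ->
  (forall u, u \in S -> bivJ u.1 u.2 \in U) -> (#|S| <= \dim U)%N.
Proof.
move=> /subsetP Sh hU; apply: (card_le_dim (g := mulmxr (invmx J))) hU _ => u v /Sh + /Sh.
rewrite !inE /= => /andP[_ su] /andP[_ sv]; rewrite bivJ_mul mulmxK ?(fd_Ju F) //.
rewrite bivE [v.1 == u.1]eq_sym [v.2 == u.2]eq_sym -xpair_eqE -!surjective_pairing.
have [<-|uv] := eqVneq u v.
  have [e12|_] := boolP ((u.1 == u.2) && (u.2 == u.1)); last by rewrite mulr0 subr0 oner_eq0.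
  move: su; case/andP: e12 => /eqP -> _; rewrite ltnn eqxx => /eqP ->.
  by rewrite mulr1 opprK -mulr2n ((pcharf0P K).1 char0).
have [/andP[/eqP E1 /eqP E2]|_] := boolP ((v.1 == u.2) && (v.2 == u.1)); last first.
  by rewrite mulr0 subr0 eqxx.
move: su sv uv; rewrite E1 E2 => su sv uv.
have e12 : u.1 = u.2.
  case/orP: su sv => [lt|/andP[/eqP //]] /orP[|/andP[/eqP //]].
  by move=> /(ltn_trans lt); rewrite ltnn.
by case/eqP: uv; rewrite [u]surjective_pairing [v]surjective_pairing E1 E2 e12.
Qed.

(** The leading terms of these bivectors stay in the stable space [A] and centralize [e1] and [e2],
    with no loss of dimension. *)
Lemma fd_symbol (S : {set 'I_n * 'I_n}) (A : {vspace 'M[K]_n}) : S \subset half_pairs ->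
  (A <= gform J)%VS -> (forall u, u \in S -> bivJ u.1 u.2 \in A) ->
  (forall B, B \in A -> admx e1 B \in A) -> (forall B, B \in A -> admx e2 B \in A) ->
  (#|S| <= \dim (A :&: Z))%N.
Proof.
move=> Sh Ag hA A1 A2.
have -> : (A :&: Z = A :&: (lker (linfun (admx e1)) :&: lker (linfun (admx e2))))%VS.
  by rewrite /centr capvA (capv_idPl Ag).
apply: leq_trans (symbol_mx (T := A :&: deg0 K X Y) char0 (fd_h1 F) (fd_h2 F) (fd_comm F) _ _ A1 A2).
- apply: (half_pairs_dim Sh) => u hu; rewrite memv_cap hA //; apply/deg0P.
  have := bivJ_homog_gr (a := u.1) (b := u.2).
  by move: (subsetP Sh _ hu); rewrite inE => /andP[/woppP[-> ->]].
- by move=> B; rewrite memv_cap => /andP[_ /deg0P].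
- exact: capvSl.
Qed.

Lemma bivJ_in_gform a b : bivJ a b \in gform J.
Proof. by apply: bivJ_gform; [apply: eps_sqr; apply: fd_eps F|apply: fd_JT F]. Qed.

Lemma half_pairs_bound : (#|half_pairs| <= (n./2).+1)%N.
Proof.
apply: leq_trans (fd_dim F); apply: leq_trans (fd_symbol (A := gform J) (subxx _) _ _ _ _) _ => //.
- by move=> u _; apply: bivJ_in_gform.
- by move=> B; apply: gform_admx; apply: fd_e1 F.
- by move=> B; apply: gform_admx; apply: fd_e2 F.
- by apply: dimvS; apply: capvSr.
Qed.

Lemma fd_half_pairs_ge : (n./2 <= #|half_pairs|)%N.
Proof.
have [p wopp_p] := wopp_perm; rewrite card_half_pairs.
have := sum_wopp_ge wopp_p; rewrite sum_wopp; have : (#|S0| <= n)%N.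
  by rewrite -[leqRHS]card_ord max_card.
move: #|_| #|_| => a b bn h.
(* [h] bounds [n] by [2 * a + (2 * b - b * b)], and the bracket is at most one. *)
have : (n <= 2 * a + 1)%N by nia.
by lia.
Qed.

(** Let [b] be the multiplicity of the zero weight. Twice the number of strict pairs is at least
    [n + b * (b - 2)], plus four if a nonzero weight repeats, while [half_pairs] has at most
    [(n./2).+1] elements. This leaves [b <= 1], or [b = 2] with [eps = 1]. *)
Lemma weights_cases : (forall s t, X s = X t -> Y s = Y t -> s = t) \/
  [/\ eps = 1, #|S0| = 2%N & forall s t, X s = X t -> Y s = Y t -> s \notin S0 -> s = t].
Proof.
have [p wopp_p] := wopp_perm.
have := half_pairs_bound; rewrite card_half_pairs.
have := sum_wopp_ge wopp_p; rewrite sum_wopp; have mn : (#|S0| <= n)%N.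
  by rewrite -[leqRHS]card_ord max_card.
move=> ge bound.
have nz s t : X s = X t -> Y s = Y t -> s \notin S0 -> s = t.
  move=> Xst Yst sS; apply/eqP/negPn/negP=> st.
  have := sum_wopp_ge4 wopp_p Xst Yst st sS; rewrite sum_wopp.
  move: bound mn; move: #|_| #|_| (eps == -1) => a b c; clear; nia.
have [S01|S02] := leqP #|S0| 1.
  left=> s t Xst Yst; have [sS|/nz] := boolP (s \in S0); last by apply.
  have tS : t \in S0 by move: sS; rewrite !inE Xst Yst.
  by move/card_le1_eqP: S01; apply.
right; have e : eps = 1.
  case: (fd_eps F) => // e; exfalso; move: bound ge mn S02; rewrite e eqxx mul1n.
  by move: #|_| #|_| => a b; clear; nia.
have n11 : (1 == -1 :> K) = false.
  by rewrite -subr_eq0 opprK -mulr2n ((pcharf0P K).1 char0).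
split=> //; move: bound ge mn S02; rewrite e n11; move: #|_| #|_| => a b; clear; nia.
Qed.

End FData.

Section PinjData.

Variables (K : fieldType) (n : nat) (X Y : 'I_n -> rat) (e1 e2 J : 'M[K]_n) (eps : K).
Hypothesis char0 : [pchar K] =i pred0.
Hypothesis F : fdata X Y e1 e2 J eps.
Hypothesis p1 : pinj e1.
Hypothesis p2 : pinj e2.
Hypothesis Jp : pinj J.
Local Notation Z := (centr (gform J) e1 e2).

Lemma fd_grid : grid X Y e1 e2.
Proof. by split=> //; [apply: fd_h1 F|apply: fd_h2 F|apply: fd_comm F]. Qed.

Lemma fd_dualX s : X (dual J s) = - X s.
Proof. by have [h _] := fd_J F (J_dual (fd_Ju F) s); lra. Qed.

Lemma fd_dualY s : Y (dual J s) = - Y s.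
Proof. by have [_ h] := fd_J F (J_dual (fd_Ju F) s); lra. Qed.

Lemma bivJ_diag s : bivJ J eps s (dual J s) \in below_space X Y e1 e2.
Proof.
have dK := dualK (fd_JT F) (fd_Ju F) Jp.
apply/below_spaceP=> R P; rewrite (bivJE (fd_JT F) (fd_Ju F) Jp) bivE.
rewrite mulf_eq0 negb_or => /andP[+ _]; have [/andP[/eqP-> /eqP dP]|_] := boolP (_ && _).
  by rewrite (dual_inj (fd_JT F) (fd_Ju F) Jp dP) => _; exact (below_refl fd_grid s).
have [/andP[/eqP-> /eqP dP]|_] := boolP (_ && _); last by rewrite mulr0 subr0 eqxx.
by move=> _; rewrite -dP dK; exact (below_refl fd_grid _).
Qed.

(** Every half pair consists of dual indices, so its bivector is diagonal and lies in [below_space],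
    which is stable under [ad e1] and [ad e2]. Its leading terms therefore fill at least [n./2]
    dimensions of the core. *)
Lemma fgrid_of_pinj : (forall s t, t \in wopp X Y s -> s != t \/ eps = -1 -> t = dual J s) ->
  (exists A B, [/\ A \in Z, B \in Z & A *m B != B *m A]) ->
  fgrid X Y e1 e2 J eps Z.
Proof.
move=> hd nab; have [h1 h2 c12 he JT Ju _ g1 g2 dZ] := F.
split=> //; [exact: fd_dualX|exact: fd_dualY|].
apply: leq_trans dZ _; rewrite ltnS; apply: leq_trans (fd_half_pairs_ge F) _.
pose A := (gform J :&: below_space X Y e1 e2)%VS.
apply: (@leq_trans (\dim (A :&: Z))); last first.
  apply: dimvS; apply/subvP=> B; rewrite !memv_cap => /andP[/andP[_ hb] hZ].
  by rewrite hb andbT.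
apply: (fd_symbol char0 F (subxx _)); first exact: capvSl.
- move=> u; rewrite inE => /andP[o su]; rewrite memv_cap (bivJ_in_gform F) /=.
  rewrite (hd _ _ o) ?bivJ_diag //.
  case/orP: su => [lt|/andP[_ /eqP]]; last by right.
  by left; apply: contraTneq lt => ->; rewrite ltnn.
- move=> B; rewrite !memv_cap => /andP[gB bB]; rewrite gform_admx //=.
  by apply: (below_space_admx fd_grid) bB; apply: below1 fd_grid.
- move=> B; rewrite !memv_cap => /andP[gB bB]; rewrite gform_admx //=.
  by apply: (below_space_admx fd_grid) bB; apply: below2 fd_grid.
Qed.

End PinjData.

(** * Commutativity of the centralizer for simple weights *)

Section Injective.

Variables (K : fieldType) (n : nat) (X Y : 'I_n -> rat) (e1 e2 : 'M[K]_n).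
Hypothesis char0 : [pchar K] =i pred0.

Lemma commute_dec (Z : {vspace 'M[K]_n}) :
  ~ (exists A B, [/\ A \in Z, B \in Z & A *m B != B *m A]) ->
  {in Z &, forall A B, A *m B = B *m A}.
Proof.
move=> nab A B ZA ZB; apply/eqP/negPn/negP=> AB.
by apply: nab; exists A, B.
Qed.

Lemma form_injective_abelian J eps : fdata X Y e1 e2 J eps -> (eps = 1 -> (2 < n)%N) ->
  (forall s t, X s = X t -> Y s = Y t -> s = t) ->
  {in centr (gform J) e1 e2 &, forall A B, A *m B = B *m A}.
Proof.
move=> F n2 inj; apply: commute_dec => nab.
have p1 := homog_pinj inj (fd_h1 F); have p2 := homog_pinj inj (fd_h2 F).
have Jp : pinj J.
  split=> [R R' P /(fd_J F)[x1 y1] /(fd_J F)[x2 y2]|R P P' /(fd_J F)[x1 y1] /(fd_J F)[x2 y2]].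
    by apply: inj; lra.
  by apply: inj; lra.
apply: (form_abelian_absurd char0 (fgrid_of_pinj char0 F p1 p2 Jp _ nab) n2).
move=> s t /woppP[x y] _; apply: inj; first by rewrite (fd_dualX F); lra.
by rewrite (fd_dualY F); lra.
Qed.

Lemma typeA_graded_abelian : homog X Y 1 0 e1 -> homog X Y 0 1 e2 -> e1 *m e2 = e2 *m e1 ->
  (\dim (centr fullv e1 e2) <= n.+1)%N ->
  {in centr fullv e1 e2 &, forall A B, A *m B = B *m A}.
Proof.
move=> h1 h2 c12 dZ.
have symb (S : {set 'I_n * 'I_n}) (A : {vspace 'M[K]_n}) :
    (forall u, u \in S -> X u.1 = X u.2 /\ Y u.1 = Y u.2) ->
    (forall u, u \in S -> delta_mx u.1 u.2 \in A) ->
    (forall B, B \in A -> admx e1 B \in A) -> (forall B, B \in A -> admx e2 B \in A) ->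
    (#|S| <= \dim (A :&: centr fullv e1 e2))%N.
  move=> dS SA A1 A2; rewrite /centr capfv.
  apply: leq_trans (symbol_mx (T := A :&: deg0 K X Y) char0 h1 h2 c12 _ _ A1 A2).
  - apply: (card_le_dim (g := idfun) (f := fun u => delta_mx u.1 u.2)) => [u uS|u v _ _].
      rewrite memv_cap SA //; apply/deg0P=> s t; rewrite !mxE.
      have [/andP[/eqP-> /eqP->] _|] := boolP (_ && _); last by rewrite eqxx.
      by rewrite !addr0; apply: dS.
    rewrite /= mxE -xpair_eqE -!surjective_pairing.
    by rewrite [v == u]eq_sym; case: (u == v); rewrite ?oner_eq0 ?eqxx.
  - by move=> B; rewrite memv_cap => /andP[_ /deg0P].
  - exact: capvSl.
have diag n0 : #|[set u : 'I_n0 * 'I_n0 | u.1 == u.2]| = n0.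
  have dinj : injective (fun s : 'I_n0 => (s, s)) by move=> s t [].
  rewrite -[RHS]card_ord -[RHS](card_imset _ dinj).
  apply: eq_card => -[s t]; rewrite !inE /=; apply/eqP/imsetP=> [->|[u _ [-> ->]]] //.
  by exists t.
have inj s t : X s = X t -> Y s = Y t -> s = t.
  move=> Xst Yst; apply/eqP/negPn/negP=> st.
  (* Diagonal units and two off-diagonal ones make [n.+2] elements of degree zero, one too many for
     the centralizer. *)
  pose S := (s, t) |: ((t, s) |: [set u | u.1 == u.2]).
  have cS : #|S| = n.+2.
    rewrite !cardsU1 diag !inE /= xpair_eqE negb_or negb_and st [t == s]eq_sym st.
    by [].
  suff : (#|S| <= n.+1)%N by rewrite cS ltnn.
  apply: leq_trans dZ; rewrite -[centr _ _ _]capfv; apply: symb => [u||B _|B _]; rewrite ?memvf //.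
    by rewrite !inE => /or3P[/eqP->|/eqP->|/eqP->].
  by move=> u _; rewrite memvf.
have G : grid X Y e1 e2 by split=> //; apply: homog_pinj inj _; eassumption.
apply: (typeA_abelian char0 G (erefl _)).
apply: leq_trans dZ _; rewrite ltnS -[leqLHS]diag.
apply: (@leq_trans (\dim (below_space X Y e1 e2 :&: centr fullv e1 e2))); last first.
  by apply: dimvS; rewrite capvC.
apply: symb => [u|u|B|B].
- by rewrite inE => /eqP ->.
- rewrite inE => /eqP ->; apply/below_spaceP=> R P; rewrite !mxE.
  have [/andP[/eqP-> /eqP->] _|] := boolP (_ && _); last by rewrite eqxx.
  exact (below_refl G _).
- by apply: (below_space_admx G); apply: below1 G.
- by apply: (below_space_admx G); apply: below2 G.
Qed.

End Injective.

(** * Wedges of vectors and conjugation *)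

Section Wedge.

Variables (K : fieldType) (n : nat) (J : 'M[K]_n).
Hypothesis JT : J^T = J.
Implicit Types (u v w : 'cV[K]_n) (A e f : 'M[K]_n).

(** [bivJ] for [eps = 1] and arbitrary vectors: images such as [e ^+ s *m w] need not be basis
    vectors. *)
Definition wedge u v : 'M[K]_n := (u *m v^T - v *m u^T) *m J.

Lemma wedge_gform u v : wedge u v \in gform J.
Proof.
apply/gformP; rewrite /wedge trmx_mul JT linearB /= !trmx_mul !trmxK.
by rewrite -(opprB (u *m v^T)) mulmxN mulNmx mulmxA.
Qed.

Lemma wedge0l v : wedge 0 v = 0.
Proof. by rewrite /wedge trmx0 mul0mx mulmx0 subrr mul0mx. Qed.

Lemma wedge0r u : wedge u 0 = 0.
Proof. by rewrite /wedge trmx0 mul0mx mulmx0 subrr mul0mx. Qed.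

Lemma wedge_scale c u : wedge u (c *: u) = 0.
Proof. by rewrite /wedge linearZ /= -scalemxAl -scalemxAr subrr mul0mx. Qed.

Lemma wedge_act A u v : A \in gform J ->
  admx A (wedge u v) = wedge (A *m u) v + wedge u (A *m v).
Proof.
move=> /gformP gA; rewrite /admx /wedge -(mulmxA _ J A).
have -> : J *m A = - (A^T *m J) by rewrite gA opprK.
rewrite mulmxN opprK !mulmxA -mulmxDl -mulmxDl; congr (_ *m J).
rewrite !trmx_mul mulmxBr mulmxBl !mulmxA.
by rewrite addrACA -opprD [X in _ - X]addrC opprD addrACA.
Qed.

(** An invariant of [e] when [e ^+ t.+1] kills [w] and [w']. For [w = w'] the terms [s] and [t - s]
    add up if [t] is odd and cancel if [t] is even. *)
Definition alt_wedge e t w w' :=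
  \sum_(s < t.+1) (-1) ^+ s *: wedge (e ^+ s *m w) (e ^+ (t - s) *m w').

Lemma alt_wedge_gform e t w w' : alt_wedge e t w w' \in gform J.
Proof. by apply: memv_suml => s _; apply: memvZ; apply: wedge_gform. Qed.

(* The action of [e] on the alternating sum telescopes. *)
Lemma alt_wedge_act0 e f t w w' : e \in gform J -> f \in gform J -> e *m f = f *m e ->
  f *m w = 0 -> f *m w' = 0 -> e ^+ t.+1 *m w = 0 -> e ^+ t.+1 *m w' = 0 ->
  admx e (alt_wedge e t w w') = 0 /\ admx f (alt_wedge e t w w') = 0.
Proof.
move=> ge gf ef fw fw' ew ew'.
have fX s (v : 'cV[K]_n) : f *m v = 0 -> f *m (e ^+ s *m v) = 0.
  move=> fv; have fe : f *m e ^+ s = e ^+ s *m f by apply: (@commrX _ f e s); apply/esym.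
  by rewrite mulmxA fe -mulmxA fv mulmx0.
split; rewrite linear_sum /=; last first.
  by apply: big1 => s _; rewrite linearZ /= wedge_act // !fX // wedge0l wedge0r addr0 scaler0.
pose T s := wedge (e ^+ s *m w) (e ^+ (t.+1 - s) *m w').
rewrite (eq_bigr (fun s : 'I_t.+1 => - ((-1) ^+ s.+1 *: T s.+1 - (-1) ^+ s *: T s))); last first.
  move=> s _; rewrite linearZ /= wedge_act // !mulmxA.
  have -> : e *m e ^+ s = e ^+ s.+1 by rewrite exprS.
  have st : (s <= t)%N by rewrite -ltnS.
  have -> : e *m e ^+ (t - s) = e ^+ (t.+1 - s) by rewrite (subSn st) exprS.
  by rewrite [(-1) ^+ s.+1]exprS mulN1r scaleNr -opprD opprK scalerDr /T subSS.
rewrite sumrN -(big_mkord xpredT (fun s => (-1) ^+ s.+1 *: T s.+1 - (-1) ^+ s *: T s)).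
rewrite telescope_sumr // /T ew subn0 ew' wedge0l wedge0r !scaler0 subrr oppr0.
by [].
Qed.

Lemma wedge_entry u v s t : wedge u v s t = \sum_k (u s 0 * v k 0 - v s 0 * u k 0) * J k t.
Proof.
rewrite [LHS]mxE; apply: eq_bigr => k _; congr (_ * _).
by rewrite [LHS]mxE [X in X + _]mxE [X in _ + X]mxE [X in - X]mxE !big_ord1 !mxE.
Qed.

End Wedge.

Definition hvec (K : fieldType) n (X Y : 'I_n -> rat) x y (u : 'cV[K]_n) :=
  forall s, u s 0 != 0 -> X s = x /\ Y s = y.

Lemma hvec_delta (K : fieldType) n (X Y : 'I_n -> rat) s :
  hvec X Y (X s) (Y s) (delta_mx s 0 : 'cV[K]_n).
Proof. by move=> t; rewrite mxE eqxx andbT; have [->|_] := eqVneq t s; rewrite ?eqxx. Qed.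

Lemma hvec_mul (K : fieldType) n (X Y : 'I_n -> rat) x y p q (A : 'M[K]_n) u :
  homog X Y p q A -> hvec X Y x y u -> hvec X Y (x + p) (y + q) (A *m u).
Proof.
move=> hA hu s; rewrite mxE => nz.
have [t] : exists t, A s t * u t 0 != 0.
  apply/existsP; apply: contraNT nz; rewrite negb_exists => /forallP h.
  by rewrite big1 // => t _; apply/eqP; have := h t; rewrite negbK.
by rewrite mulf_eq0 negb_or => /andP[/hA[-> ->] /hu[-> ->]].
Qed.

Lemma wedge_homog (K : fieldType) n (X Y : 'I_n -> rat) (J : 'M[K]_n) x y x' y' u v :
  (forall s t, J s t != 0 -> X s + X t = 0 /\ Y s + Y t = 0) ->
  hvec X Y x y u -> hvec X Y x' y' v -> homog X Y (x + x') (y + y') (wedge J u v).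
Proof.
move=> dJ hu hv s t; rewrite wedge_entry => nz.
have [k] : exists k, (u s 0 * v k 0 - v s 0 * u k 0) * J k t != 0.
  apply/existsP; apply: contraNT nz; rewrite negb_exists => /forallP h.
  by rewrite big1 // => k _; apply/eqP; have := h k; rewrite negbK.
rewrite mulf_eq0 negb_or => /andP[nz1 /dJ[Xk Yk]].
have : (u s 0 != 0) && (v k 0 != 0) || (v s 0 != 0) && (u k 0 != 0).
  apply: contraNT nz1; rewrite negb_or !negb_and !negbK => /andP[h1 h2].
  have -> : u s 0 * v k 0 = 0 by case/orP: h1 => /eqP ->; rewrite ?mul0r ?mulr0.
  by have -> : v s 0 * u k 0 = 0; [case/orP: h2 => /eqP ->; rewrite ?mul0r ?mulr0|rewrite subrr].
by case/orP=> /andP[]; [move=> /hu[? ?] /hv[? ?]|move=> /hv[? ?] /hu[? ?]]; split; lra.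
Qed.

Lemma dim_add_line (K : fieldType) n (U : {vspace 'M[K]_n}) (B : 'M[K]_n) s t :
  (forall A, A \in U -> A s t = 0) -> B s t != 0 -> \dim (U + <[B]>) = (\dim U).+1.
Proof.
move=> U0 Bst; rewrite dimv_disjoint_sum.
  by rewrite dim_vline (contraNneq _ Bst) ?addn1 // => ->; rewrite mxE.
apply/eqP; rewrite -subv0; apply/subvP=> A; rewrite memv_cap memv0 => /andP[/U0 A0 /vlineP[k Ak]].
move: A0; rewrite Ak mxE => /eqP; rewrite mulf_eq0 (negPf Bst) orbF => /eqP ->.
by rewrite scale0r.
Qed.

Lemma entry_add_line (K : fieldType) n (U : {vspace 'M[K]_n}) (B : 'M[K]_n) s t :
  (forall A, A \in U -> A s t = 0) -> B s t = 0 -> forall A, A \in (U + <[B]>)%VS -> A s t = 0.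
Proof.
move=> U0 Bst A /memv_addP[C CU [D /vlineP[k ->] ->]].
by rewrite [LHS]mxE (U0 _ CU) mxE Bst mulr0 addr0.
Qed.

Section Conjugation.

Variables (K : fieldType) (n : nat).
Implicit Types (A B P J : 'M[K]_n).

Definition conj_mx P A := invmx P *m A *m P.

Lemma conj_mxM P A B : P \in unitmx -> conj_mx P (A *m B) = conj_mx P A *m conj_mx P B.
Proof. by move=> Pu; rewrite /conj_mx !mulmxA mulmxK. Qed.

Lemma conj_mxVK P C : P \in unitmx -> P *m conj_mx P C *m invmx P = C.
Proof. by move=> Pu; rewrite /conj_mx !mulmxA mulmxK // mulmxV // mul1mx. Qed.

Lemma conj_mx_inj P : P \in unitmx -> injective (conj_mx P).
Proof.
by move=> Pu A B AB; rewrite -[A](conj_mxVK _ Pu) AB conj_mxVK.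
Qed.

Lemma conj_mxK P A : P \in unitmx -> conj_mx (invmx P) (conj_mx P A) = A.
Proof. by move=> Pu; rewrite {1}/conj_mx invmxK conj_mxVK. Qed.

Lemma conj_gform P J A : P \in unitmx -> A \in gform J -> conj_mx P A \in gform (P^T *m J *m P).
Proof.
move=> Pu /gformP gA; apply/gformP; rewrite /conj_mx !trmx_mul !mulmxA.
rewrite -(mulmxA (P^T *m A^T)) -[(invmx P)^T *m P^T]trmx_mul mulmxV // trmx1 mulmx1.
rewrite -(mulmxA P^T A^T J) gA mulmxN mulNmx; congr (- _).
by rewrite -!mulmxA (mulmxA P (invmx P)) mulmxV // mul1mx.
Qed.

Lemma conj_centr P J e1 e2 A : P \in unitmx -> A \in centr (gform J) e1 e2 ->
  conj_mx P A \in centr (gform (P^T *m J *m P)) (conj_mx P e1) (conj_mx P e2).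
Proof.
move=> Pu /centrP[gA c1 c2]; apply/centrP; split; first exact: conj_gform.
  by rewrite -!conj_mxM // c1.
by rewrite -!conj_mxM // c2.
Qed.

Lemma conj_mx_is_linear P : linear (conj_mx P).
Proof. by move=> a A B; rewrite /conj_mx linearP mulmxDl -scalemxAl. Qed.

HB.instance Definition _ P :=
  GRing.isLinear.Build K 'M[K]_n 'M[K]_n _ (conj_mx P) (conj_mx_is_linear P).

Lemma dim_conj_centr P J e1 e2 : P \in unitmx ->
  (\dim (centr (gform (P^T *m J *m P)) (conj_mx P e1) (conj_mx P e2))
    <= \dim (centr (gform J) e1 e2))%N.
Proof.
move=> Pu; have Pu' : invmx P \in unitmx by rewrite unitmx_inv.
pose f := linfun (conj_mx (invmx P)).
have fker : (lker f == 0)%VS.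
  by apply/lker0P=> A B; rewrite !lfunE /=; apply: conj_mx_inj.
rewrite -(limg_dim_eq (f := f)); last by move/eqP: fker => ->; rewrite capv0.
apply: dimvS; apply/subvP=> B /memv_imgP[A + ->]; rewrite lfunE /=.
move/(conj_centr Pu'); rewrite !conj_mxK // trmx_inv -!mulmxA mulmxV // mulmx1.
by rewrite mulmxA -trmx_inv -trmx_mul mulmxV // trmx1 mul1mx.
Qed.

End Conjugation.

(** * A split double zero weight *)

Lemma offpart_mull (K : fieldType) n (S : rel 'I_n) (c : pred 'I_n) (e A : 'M[K]_n) :
  S =2 (fun s t => c s == c t) -> (forall s t, e s t != 0 -> c s = c t) ->
  offpart S (e *m A) = e *m offpart S A.
Proof.
move=> SE ec; apply/matrixP=> s t; rewrite !mxE SE.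
under [RHS]eq_bigr => u _ do rewrite mxE SE.
case: ifP => [cst|cst]; last first.
  apply: eq_bigr => u _; have [->|/eqP/ec csu] := e s u =P 0; first by rewrite !mul0r.
  by rewrite -csu cst.
rewrite big1 // => u _; have [->|/eqP/ec csu] := e s u =P 0; first by rewrite mul0r.
by rewrite -csu cst mulr0.
Qed.

Lemma offpart_tr (K : fieldType) n (S : rel 'I_n) (A : 'M[K]_n) :
  symmetric S -> offpart S A^T = (offpart S A)^T.
Proof. by move=> Ss; apply/matrixP=> s t; rewrite !mxE Ss. Qed.

Lemma wedge_delta (K : fieldType) n (J : 'M[K]_n) a b :
  wedge J (delta_mx a 0) (delta_mx b 0) = bivJ J 1 a b.
Proof. by rewrite /wedge /bivJ /biv !trmx_delta !mul_delta_mx scale1r. Qed.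

Section Split.

Variables (K : fieldType) (n : nat) (X Y : 'I_n -> rat) (e1 e2 J : 'M[K]_n).
Hypothesis char0 : [pchar K] =i pred0.
Hypothesis F : fdata X Y e1 e2 J 1.
Hypothesis p1 : pinj e1.
Hypothesis p2 : pinj e2.
Hypothesis Jp : pinj J.

Let Ju := fd_Ju F.
Let JT := fd_JT F.
Let G : grid X Y e1 e2 := fd_grid F p1 p2.
Let B : fbase X Y e1 e2 J 1.
Proof.
exact (Fbase G (fd_eps F) JT Ju Jp (fd_e1 F) (fd_e2 F)).
Qed.

Local Notation dual := (dual J).
Local Notation ple := (ple e1 e2).
Local Notation mono := (mono e1 e2).
Local Notation gen := (gen e1 e2).
Local Notation sink := (sink e1 e2).
Local Notation below := (below X Y e1 e2).
Local Notation Z := (centr (gform J) e1 e2).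
Local Notation core := (core X Y e1 e2 Z).

Variables (al be r : 'I_n) (k : nat).
Hypothesis al_be : al != be.
Hypothesis dal : dual al = al.
Hypothesis dbe : dual be = be.
Hypothesis Xal : X al = 0.
Hypothesis Yal : Y al = 0.
Hypothesis Xbe : X be = 0.
Hypothesis Ybe : Y be = 0.
Hypothesis hd : forall s t, t \in wopp X Y s -> s != t ->
  [\/ t = dual s, s = al /\ t = be | s = be /\ t = al].
Hypothesis gr : gen r.
Hypothesis r_al : ple k 0 r al.
Hypothesis e2r : forall s, e2 s r = 0.

Let dK : involutive dual := dualK JT Ju Jp.
Let dX s : X (dual s) = - X s := fd_dualX F s.
Let dY s : Y (dual s) = - Y s := fd_dualY F s.
Let Zcomm A : A \in Z -> A *m e1 = e1 *m A /\ A *m e2 = e2 *m A.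
Proof. exact: centr_comm. Qed.
Let Zcomp p q A : A \in Z -> hcomp X Y p q A \in Z.
Proof.
apply: centr_hcomp (grid_h1 G) (grid_h2 G) _ _ _ _ => p' q' C.
exact: (gform_hcomp JT Ju Jp _ _ dX dY).
Qed.
Let JT1 : J^T = J. Proof. by rewrite JT scale1r. Qed.

Local Notation R s := (below r s).
Local Notation r' := (dual r).

Let r_r' : ple (k + k) 0 r r'.
Proof.
have al_r' : ple k 0 al r' by rewrite -dal (ple_dual B).
by have := ple_trans G r_al al_r'; rewrite addn0.
Qed.

Let sr' : sink r'. Proof. by rewrite (sink_dual B). Qed.

Lemma chain_row i j s : ple i j r s -> j = 0%N.
Proof.
case: j => // j rs; have [M rM _] := ple_splitle G (leq0n i) (ltn0Sn j) rs.
by move: rM; rewrite pleE mono01 e2r eqxx.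
Qed.

Lemma chain_sub s : R s -> R (dual s).
Proof.
move=> /(belowP G)[c [j rs]]; have j0 := chain_row rs; rewrite {}j0 in rs.
have [ck|kc] := leqP c (k + k).
  have := ple_from G ck (leqnn 0) rs r_r'; rewrite -(ple_dual B) dK => h.
  by apply/(belowP G); do 2!eexists; exact: h.
have := ple_from G (ltnW kc) (leqnn 0) r_r' rs.
by case/(sinkP G sr') => /eqP; rewrite subn_eq0 leqNgt kc.
Qed.

Lemma chain_dual s : R (dual s) = R s.
Proof. by apply/idP/idP=> /chain_sub //; rewrite dK. Qed.

Lemma chain_ple i j s t : ple i j s t -> R s = R t.
Proof.
move=> st; apply/idP/idP => [Rs|].
  by apply: (below_trans G Rs); apply/(belowP G); exists i, j.
rewrite -chain_dual -(chain_dual s) => Rt.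
apply: (below_trans G Rt); apply/(belowP G); exists i, j.
by rewrite (ple_dual B).
Qed.

Lemma chain1 s t : e1 s t != 0 -> R s = R t.
Proof.
move=> st; have /chain_ple -> // : ple 1 0 t s by rewrite pleE mono10.
Qed.

Lemma chain2 s t : e2 s t != 0 -> R s = R t.
Proof.
move=> st; have /chain_ple -> // : ple 0 1 t s by rewrite pleE mono01.
Qed.

Lemma chainJ s t : J s t != 0 -> R s = R t.
Proof. by move=> /(J_dualE Ju Jp) ->; rewrite chain_dual. Qed.

Lemma chain_r : R r. Proof. exact (below_refl G _). Qed.
Lemma chain_r' : R r'. Proof. by rewrite chain_dual chain_r. Qed.

Lemma chain_be : R be = false.
Proof.
apply/negbTE/negP=> /(belowP G)[c [j rb]]; have j0 := chain_row rb; rewrite {}j0 in rb.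
have [X1 _] := ple_deg G rb; have [X2 _] := ple_deg G r_al.
have ck : c = k by apply/eqP; rewrite -(eqr_nat rat); apply/eqP/(addrI (X r)); rewrite -X1 -X2 Xal Xbe.
by move: al_be; rewrite (ple_tgt G r_al (R' := be)) ?eqxx // -ck.
Qed.

Lemma chain_e2 s t : e2 s t != 0 -> R s = false.
Proof.
move=> st; apply/negbTE/negP => Rs; have Rt : R t by rewrite -(chain2 st).
have [c [j rt]] := elimT (belowP G _ _) Rt; have ts : ple 0 1 t s by rewrite pleE mono01.
by have := chain_row (ple_trans G rt ts).
Qed.

(** [offpart] deletes the entries within the chain and within its complement, so the part exchanging
    the two remains. *)
Definition odd_part : 'M[K]_n -> 'M[K]_n := offpart (fun s t => R s == R t).

Lemma odd_part_Z A : A \in Z -> odd_part A \in Z.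
Proof.
have symR : symmetric (fun s t => R s == R t) by move=> s t; apply: eq_sym.
have mull (e C : 'M[K]_n) : (forall s t, e s t != 0 -> R s = R t) ->
    odd_part (e *m C) = e *m odd_part C.
  by move=> he; apply: (@offpart_mull _ _ _ (fun s => R s)).
have mulr (e C : 'M[K]_n) : (forall s t, e s t != 0 -> R s = R t) ->
    odd_part (C *m e) = odd_part C *m e.
  move=> he; apply: trmx_inj; rewrite trmx_mul -!(offpart_tr _ symR) trmx_mul.
  apply: (@offpart_mull _ _ _ (fun s => R s)) => //.
  by move=> s t; rewrite mxE => /he ->.
move=> /centrP[/gformP gA c1 c2]; apply/centrP; split.
- apply/gformP; rewrite -(offpart_tr _ symR) -/(odd_part _) -(mulr _ _ chainJ) gA.
  by rewrite /odd_part linearN /= -/(odd_part _) (mull _ _ chainJ).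
- by rewrite -(mulr _ _ chain1) c1 (mull _ _ chain1).
- by rewrite -(mulr _ _ chain2) c2 (mull _ _ chain2).
Qed.

Definition even_mx (A : 'M[K]_n) := forall s t, A s t != 0 -> R s = R t.
Definition odd_mx (A : 'M[K]_n) := forall s t, A s t != 0 -> R s <> R t.

Lemma even_odd A : even_mx (A - odd_part A) /\ odd_mx (odd_part A).
Proof.
split=> s t; rewrite !mxE; last by case: ifP => [|/eqP]; rewrite ?eqxx // => h _ /esym.
by have [->|_] := eqVneq (R t) (R s); rewrite ?subrr ?eqxx.
Qed.

Lemma core_even A : A \in core -> even_mx A.
Proof. by move=> /coreP[_ h] s t /h/(belowP G)[i [j /chain_ple]]. Qed.

(** Only the half pair made of [al] and [be] is lost, as its bivector is not supported on the order.
    The core thus has codimension at most two in [Z]. *)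
Lemma dim_core_ge : (n./2 <= (\dim core).+1)%N.
Proof.
pose S := half_pairs X Y (1 : K) :\: [set (al, be); (be, al)].
apply: (@leq_trans #|S|.+1).
  apply: leq_trans (fd_half_pairs_ge F) _; rewrite -(cardsID [set (al, be); (be, al)]).
  rewrite -addn1 addnC leq_add2l.
  have /subset_leq_card : half_pairs X Y (1 : K) :&: [set (al, be); (be, al)] \subset
      [set if (al < be)%N then (al, be) else (be, al)].
    apply/subsetP=> u; rewrite !inE => /andP[/andP[_ lt] /orP[]/eqP uE];
      move: lt; rewrite uE /= ?[be == al]eq_sym (negPf al_be) /= orbF => lt.
      by rewrite lt.
    by rewrite ltnNge (ltnW lt).
  by rewrite cards1.
rewrite ltnS; pose A := (gform J :&: below_space X Y e1 e2)%VS.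
apply: (@leq_trans (\dim (A :&: Z))); last first.
  apply: dimvS; apply/subvP=> C; rewrite !memv_cap => /andP[/andP[_ hb] hZ].
  by rewrite hb andbT.
apply: (fd_symbol char0 F (subsetDl _ _)); first exact: capvSl.
- move=> u; rewrite !inE negb_or -andbA => /and3P[n1 n2 /andP[o lt]].
  rewrite memv_cap (bivJ_in_gform F) /=.
  have lt' : u.1 != u.2.
    case/orP: lt => [lt|/andP[_ /eqP e]]; first by apply: contraTneq lt => ->; rewrite ltnn.
    have : 2%:R == 0 :> K by rewrite mulr2n {1}e addNr.
    by rewrite ((pcharf0P K).1 char0).
  have o' : u.2 \in wopp X Y u.1 by rewrite inE.
  case: (hd o' lt') => [->|[E1 E2]|[E1 E2]]; first exact: (bivJ_diag F p1 p2 Jp).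
    by case/eqP: n1; rewrite [u]surjective_pairing E1 E2.
  by case/eqP: n2; rewrite [u]surjective_pairing E1 E2.
- move=> C; rewrite !memv_cap => /andP[gB bB]; rewrite gform_admx ?(fd_e1 F) //=.
  by apply: (below_space_admx G) bB; apply: below1 G.
- move=> C; rewrite !memv_cap => /andP[gB bB]; rewrite gform_admx ?(fd_e2 F) //=.
  by apply: (below_space_admx G) bB; apply: below2 G.
Qed.

(** Entries in triangular position and outside the support of the core certify three elements
    independent modulo the core, one more than [dim_core_ge] allows. *)
Lemma three_absurd (B1 B2 B3 : 'M[K]_n) s1 t1 s2 t2 s3 t3 :
  B1 \in Z -> B2 \in Z -> B3 \in Z ->
  (forall A, A \in core -> A s1 t1 = 0) -> (forall A, A \in core -> A s2 t2 = 0) ->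
  (forall A, A \in core -> A s3 t3 = 0) -> B1 s1 t1 != 0 -> B2 s2 t2 != 0 -> B3 s3 t3 != 0 ->
  B1 s2 t2 = 0 -> B1 s3 t3 = 0 -> B2 s3 t3 = 0 -> False.
Proof.
move=> Z1 Z2 Z3 c1 c2 c3 n1 n2 n3 B12 B13 B23.
have v2 := entry_add_line c2 B12.
have v3 := entry_add_line (entry_add_line c3 B13) B23.
have sub : (core + <[B1]> + <[B2]> + <[B3]> <= Z)%VS.
  by rewrite !subv_add -!memvE Z1 Z2 Z3 !andbT; apply: capvSl.
have := leq_trans (dimvS sub) (fd_dim F).
rewrite (dim_add_line v3 n3) (dim_add_line v2 n2) (dim_add_line c1 n1) ltnS.
by move/leq_trans/(_ dim_core_ge); rewrite ltnn.
Qed.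

Lemma Z_of_act A : A \in gform J -> admx e1 A = 0 -> admx e2 A = 0 -> A \in Z.
Proof.
by move=> gA /eqP A1 /eqP A2; apply/centrP; split=> //; apply/eqP; rewrite eq_sym -admx_eq0.
Qed.

Lemma admx_Z A C : A \in Z -> C \in Z -> admx A C \in Z.
Proof.
move=> /centrP[gA A1 A2] /centrP[gC C1 C2]; apply/centrP; split; first exact: gform_admx.
  by rewrite /admx mulmxBl mulmxBr -!mulmxA C1 A1 !mulmxA A1 C1.
by rewrite /admx mulmxBl mulmxBr -!mulmxA C2 A2 !mulmxA A2 C2.
Qed.

Lemma delta_entry (A : 'M[K]_n) a s : (A *m delta_mx a 0 : 'cV_n) s 0 = A s a.
Proof. by rewrite -colE mxE. Qed.

Lemma delta_eq0 (A : 'M[K]_n) a : (forall s, A s a = 0) -> A *m delta_mx a 0 = 0 :> 'cV_n.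
Proof. by move=> h; apply/matrixP=> s j; rewrite ord1 delta_entry h mxE. Qed.

Lemma sink_col Q s : sink Q -> e1 s Q = 0 /\ e2 s Q = 0.
Proof. by move=> /forallP/(_ s)/andP[/eqP -> /eqP ->]. Qed.

Lemma mono_e1 t : mono t 0 = e1 ^+ t.
Proof. by rewrite monoE expr0 mulmx1. Qed.

Lemma mono_e2 t : mono 0 t = e2 ^+ t.
Proof. by rewrite monoE expr0 mul1mx. Qed.

Lemma alt1_Z t w w' : e2 *m w = 0 -> e2 *m w' = 0 -> e1 ^+ t.+1 *m w = 0 ->
  e1 ^+ t.+1 *m w' = 0 -> alt_wedge J e1 t w w' \in Z.
Proof.
move=> h1 h2 h3 h4; have [] := alt_wedge_act0 (fd_e1 F) (fd_e2 F) (fd_comm F) h1 h2 h3 h4.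
exact: Z_of_act (alt_wedge_gform JT1 _ _ _ _).
Qed.

Lemma alt2_Z t w w' : e1 *m w = 0 -> e1 *m w' = 0 -> e2 ^+ t.+1 *m w = 0 ->
  e2 ^+ t.+1 *m w' = 0 -> alt_wedge J e2 t w w' \in Z.
Proof.
move=> h1 h2 h3 h4.
have [] := alt_wedge_act0 (fd_e2 F) (fd_e1 F) (esym (fd_comm F)) h1 h2 h3 h4.
by move=> a2 a1; apply: Z_of_act (alt_wedge_gform JT1 _ _ _ _) a1 a2.
Qed.

Lemma pow_sink1 t s Q : sink Q -> ple t 0 s Q -> e1 ^+ t.+1 *m delta_mx s 0 = 0 :> 'cV_n.
Proof.
move=> sQ sQ'; apply: delta_eq0 => u; rewrite -mono_e1; apply/eqP/negPn/negP=> su.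
have := ple_from G (leqnSn t) (leqnn 0) sQ' su.
by case/(sinkP G sQ) => /eqP; rewrite subSnn.
Qed.

Lemma pow_sink2 t s Q : sink Q -> ple 0 t s Q -> e2 ^+ t.+1 *m delta_mx s 0 = 0 :> 'cV_n.
Proof.
move=> sQ sQ'; apply: delta_eq0 => u; rewrite -mono_e2; apply/eqP/negPn/negP=> su.
have := ple_from G (leqnn 0) (leqnSn t) sQ' su.
by case/(sinkP G sQ) => _ /eqP; rewrite subSnn.
Qed.

Lemma sink_wedge_Z Q Q' : sink Q -> sink Q' -> bivJ J 1 Q Q' \in Z.
Proof.
move=> sQ sQ'; rewrite -wedge_delta; apply: Z_of_act; first exact: wedge_gform.
  by rewrite wedge_act ?(fd_e1 F) // !delta_eq0 ?wedge0l ?wedge0r ?addr0 // => s;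
     case: (sink_col s sQ); case: (sink_col s sQ').
by rewrite wedge_act ?(fd_e2 F) // !delta_eq0 ?wedge0l ?wedge0r ?addr0 // => s;
   case: (sink_col s sQ); case: (sink_col s sQ').
Qed.

Lemma wedgeE (u v : 'cV[K]_n) s t :
  wedge J u v s t = (u s 0 * v (dual t) 0 - v s 0 * u (dual t) 0) * J (dual t) t.
Proof.
rewrite wedge_entry (bigD1 (dual t)) //= big1 ?addr0 // => l lt.
have [->|/eqP/(J_dualE Ju Jp) tl] := J l t =P 0; first by rewrite mulr0.
by rewrite tl dK eqxx in lt.
Qed.

Lemma wedge_even (u v : 'cV[K]_n) : (forall a, u a 0 != 0 -> R a = false) ->
  (forall a, v a 0 != 0 -> R a = false) -> even_mx (wedge J u v).
Proof.
move=> hu hv s t; rewrite wedgeE mulf_eq0 negb_or => /andP[nz _].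
have : (u s 0 != 0) && (v (dual t) 0 != 0) || (v s 0 != 0) && (u (dual t) 0 != 0).
  apply: contraNT nz; rewrite negb_or !negb_and !negbK => /andP[h1 h2].
  have -> : u s 0 * v (dual t) 0 = 0 by case/orP: h1 => /eqP ->; rewrite ?mul0r ?mulr0.
  by have -> : v s 0 * u (dual t) 0 = 0;
    [case/orP: h2 => /eqP ->; rewrite ?mul0r ?mulr0|rewrite subrr].
by case/orP=> /andP[]; [move=> /hu -> /hv|move=> /hv -> /hu]; rewrite chain_dual.
Qed.

Lemma alt_even (e : 'M[K]_n) t s : (forall u v, e u v != 0 -> R u = R v) -> R s = false ->
  even_mx (alt_wedge J e t (delta_mx s 0) (delta_mx s 0)).
Proof.
move=> he Rs.
have eX a u : ((e ^+ a) *m delta_mx s 0 : 'cV_n) u 0 != 0 -> R u = false.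
  rewrite delta_entry; elim: a u => [|a IH] u.
    rewrite expr0 -idmxE mxE; have [->//|_] := eqVneq u s; by rewrite eqxx.
  by rewrite exprS -mulmxE => /mulmx_neq0[v /he -> /IH].
move=> u v; rewrite summxE => nz.
have [a] : exists a : 'I_t.+1, ((-1) ^+ a *: wedge J (e ^+ a *m delta_mx s 0)
    (e ^+ (t - a) *m delta_mx s 0)) u v != 0.
  apply/existsP; apply: contraNT nz; rewrite negb_exists => /forallP h.
  by rewrite big1 // => a _; apply/eqP; have := h a; rewrite negbK.
rewrite mxE mulf_eq0 negb_or => /andP[_].
exact: (wedge_even (eX a) (eX (t - a)%N)).
Qed.

(** Only the first and the last term reach this entry; for odd [t] their signs agree, whence the
    factor two. *)
Lemma alt_entry (D : 'I_n -> rat) (e : 'M[K]_n) t s Q :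
  (forall a u, (e ^+ a) u s != 0 -> D u = D s + a%:R) -> D Q = D s + t%:R -> odd t ->
  alt_wedge J e t (delta_mx s 0) (delta_mx s 0) s (dual Q) =
    2%:R * ((e ^+ t) Q s * J Q (dual Q)).
Proof.
move=> hD DQ ot.
have e0 a : (0 < a)%N -> (e ^+ a) s s = 0.
  move=> a0; apply/eqP/negPn/negP=> /hD/eqP; rewrite -subr_eq0 opprD addrA subrr sub0r.
  by rewrite oppr_eq0 pnatr_eq0 eqn0Ngt a0.
have eQ a : a <> t -> (e ^+ a) Q s = 0.
  move=> at_; apply/eqP/negPn/negP=> /hD; rewrite DQ => /addrI/eqP.
  by rewrite eqr_nat eq_sym => /eqP.
case: t ot DQ eQ => // t ot DQ eQ.
rewrite summxE big_ord_recl big_ord_recr /= big1 ?add0r => [|a _]; last first.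
  rewrite mxE wedgeE dK !delta_entry (e0 (bump 0 a)) // (eQ (bump 0 a)) ?mulr0 ?mul0r ?subrr ?mul0r ?mulr0 //.
  by rewrite /bump leq0n add1n => -[E]; have := ltn_ord a; rewrite E ltnn.
rewrite [X in X + _]mxE [X in _ + X]mxE !wedgeE dK !delta_entry /bump leq0n add1n subnn subn0.
have -> : (-1) ^+ t.+1 = -1 :> K by rewrite -signr_odd ot expr1.
rewrite (e0 t.+1) // (eQ 0%N) // !expr0 -idmxE mxE eqxx mulr1n; ring.
Qed.

Lemma biv_odd Q u v : R u = R v -> R Q = false -> bivJ J 1 r' Q u v = 0.
Proof.
move=> uv RQ; rewrite (bivJE JT Ju Jp) bivE.
have n1 : (u == r') && (dual v == Q) = false.
  apply/negP=> /andP[/eqP E1 /eqP E2]; move: uv.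
  by rewrite E1 chain_r' -(chain_dual v) E2 RQ.
have n2 : (u == Q) && (dual v == r') = false.
  apply/negP=> /andP[/eqP E1 /eqP E2]; move: uv.
  by rewrite E1 RQ -(chain_dual v) E2 chain_r'.
by rewrite n1 n2 /= mulr0 subrr mul0r.
Qed.

Section TwoSinks.

Variables (Q1 Q2 : 'I_n) (i j : nat).
Hypothesis sQ1 : sink Q1.
Hypothesis sQ2 : sink Q2.
Hypothesis RQ1 : R Q1 = false.
Hypothesis RQ2 : R Q2 = false.
Hypothesis Q12 : Q2 != Q1.
Hypothesis beQ1 : ple i j be Q1.

Let biv_pos Q : R Q = false -> bivJ J 1 r' Q r' (dual Q) != 0.
Proof.
move=> RQ; apply: (bivJ_entry JT Ju Jp).
by apply/eqP=> E; rewrite -E chain_r' in RQ.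
Qed.

Let biv_pos0 Q Q' : R Q = false -> R Q' = false -> Q != Q' -> bivJ J 1 r' Q r' (dual Q') = 0.
Proof.
move=> RQ RQ' QQ'; rewrite (bivJE JT Ju Jp) dK bivE eqxx /= [Q' == Q]eq_sym (negPf QQ').
have [E|_] := eqVneq r' Q; first by rewrite -E chain_r' in RQ.
by rewrite /= mulr0 subrr mul0r.
Qed.

Let core_pos Q A : R Q = false -> A \in core -> A r' (dual Q) = 0.
Proof.
move=> RQ cA; apply/eqP/negPn/negP=> /(core_even cA).
by rewrite chain_r' chain_dual RQ.
Qed.

(** The wedges of [r'] with the two sinks are odd and independent modulo the core; an even element
    outside the core would be a third one. *)
Lemma even_core A : A \in Z -> even_mx A -> A \in core.
Proof.
move=> ZA evA; apply/coreP; split=> // s t Ast.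
apply: contraT => nts; exfalso; have Rst := evA _ _ Ast.
apply: (three_absurd (sink_wedge_Z sr' sQ1) (sink_wedge_Z sr' sQ2) ZA
  (fun C => @core_pos Q1 C RQ1) (fun C => @core_pos Q2 C RQ2) _
  (biv_pos RQ1) (biv_pos RQ2) Ast) => [C|||].
- by move=> /coreP[_ h]; apply: contraNeq nts => /h.
- by apply: biv_pos0; rewrite // eq_sym.
- exact: biv_odd.
- exact: biv_odd.
Qed.

Lemma two_sinks_only Q : sink Q -> R Q = false -> Q = Q1 \/ Q = Q2.
Proof.
move=> sQ RQ; have [->|n1] := eqVneq Q Q1; first by left.
have [->|n2] := eqVneq Q Q2; first by right.
exfalso; apply: (three_absurd (sink_wedge_Z sr' sQ1) (sink_wedge_Z sr' sQ2)
  (sink_wedge_Z sr' sQ) (fun C => @core_pos Q1 C RQ1) (fun C => @core_pos Q2 C RQ2)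
  (fun C => @core_pos Q C RQ) (biv_pos RQ1) (biv_pos RQ2) (biv_pos RQ));
  by apply: biv_pos0; rewrite // eq_sym.
Qed.

(** The wedge of the two sinks is in the core, so [dual Q1] reaches [Q2], with exponents [a], [b]
    incomparable to those of its path to [Q1] through [be]. By duality a path with exponents [a],
    [b] ends at [Q1]. If [i + i < a], it contains a row of odd length [(i + i).+1] ending at [Q1];
    the alternating wedge of this row with itself lies in the core, yet has an entry from [dual Q1]
    to a vector on its left. The other case is symmetric. *)
Lemma two_sinks_absurd : False.
Proof.
have [Xi Yj] := ple_deg G beQ1; rewrite Xbe Ybe !add0r in Xi Yj.
have Q1be : ple i j (dual Q1) be by rewrite -dbe (ple_dual B).
have Q11 := ple_trans G Q1be beQ1.
have [a [b Q12']] : exists a b, ple a b (dual Q1) Q2.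
  apply/(belowP G); have c12 : bivJ J 1 Q2 Q1 \in core.
    apply: even_core; first exact: sink_wedge_Z.
    rewrite -wedge_delta; apply: wedge_even => u; rewrite mxE eqxx andbT.
      by have [->|_] := eqVneq u Q2; rewrite ?eqxx.
    by have [->|_] := eqVneq u Q1; rewrite ?eqxx.
  have /coreP[_] := c12; apply; exact: (bivJ_entry JT Ju Jp).
have Q21 : ple a b (dual Q2) Q1 by rewrite -(ple_dual B) dK.
have [X2 Y2] := ple_deg G Q12'; rewrite dX dY in X2 Y2.
have [X3 Y3] := ple_deg G Q21; rewrite dX dY in X3 Y3.
have above s : R s = false -> exists c d, ple c d s Q1 \/ ple c d s Q2.
  move=> Rs; have [Q [c [d [sQ sQ']]]] := sink_above G s.
  have RQ : R Q = false by rewrite -(chain_ple sQ').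
  by case: (two_sinks_only sQ RQ) => <-; exists c, d; [left|right].
have nle1 : ~~ ((a <= i + i)%N && (b <= j + j)%N).
  apply/negP=> /andP[ai bj]; have := ple_from G ai bj Q12' Q11.
  by case/(sinkP G sQ2) => _ _ E; move: Q12; rewrite E eqxx.
have nle2 : ~~ ((i + i <= a)%N && (j + j <= b)%N).
  apply/negP=> /andP[ai bj]; have := ple_from G ai bj Q11 Q12'.
  by case/(sinkP G sQ1) => _ _ E; move: Q12; rewrite E eqxx.
have [/andP[ai bj]|/andP[ai bj]] :
  ((i + i < a) && (b < j + j))%N \/ ((a < i + i) && (j + j < b))%N.
- move: nle1 nle2; clear; lia.
- have [M _ MQ1] := ple_splitle G (leq0n a) (leqnn b) Q21; rewrite subn0 subnn in MQ1.
  have [s _ sQ1'] := ple_splitle G (leq_subr (i + i).+1 a) (leqnn 0) MQ1.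
  rewrite subKn // subnn in sQ1'.
  have Rs : R s = false by rewrite (chain_ple sQ1').
  have [Xs Ys] := ple_deg G sQ1'; rewrite addr0 in Ys.
  have e2s u : e2 u s = 0.
    apply/eqP/negPn/negP=> us; have su : ple 0 1 s u by rewrite pleE mono01.
    have Ru : R u = false by rewrite (chain2 us).
    have [_ Yu] := ple_deg G su; have [c [d [uQ|uQ]]] := above _ Ru.
      by have [_ YY] := ple_deg G uQ; have := ler0n rat d; lra.
    have bj' : b%:R < (j + j)%:R :> rat by rewrite ltr_nat.
    by have [_ YY] := ple_deg G uQ; have := ler0n rat d; rewrite natrD in bj'; lra.
  have ZA := @alt1_Z (i + i).+1 _ _ (delta_eq0 e2s) (delta_eq0 e2s)
    (pow_sink1 sQ1 sQ1') (pow_sink1 sQ1 sQ1').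
  have cA := even_core ZA (alt_even chain1 Rs).
  have hD c u : (e1 ^+ c) u s != 0 -> X u = X s + c%:R.
    by rewrite -mono_e1 => su; have [] := ple_deg G (su : ple c 0 s u).
  have := alt_entry hD Xs; rewrite /= addnn odd_double => /(_ isT) AE.
  have /coreP[_ /(_ s (dual Q1))] := cA; rewrite -addnn in AE.
  rewrite AE !mulf_eq0 ((pcharf0P K).1 char0) /= (negPf (J_dual Ju Q1)) orbF -mono_e1.
  move=> /(_ sQ1')/(belowP G)[c [d cd]]; have [XX _] := ple_deg G cd.
  by rewrite dX in XX; have := ler0n rat c; rewrite -natr1 natrD in Xs; lra.
have [M _ MQ1] := ple_splitle G (leqnn a) (leq0n b) Q21; rewrite subn0 subnn in MQ1.
have [s _ sQ1'] := ple_splitle G (leqnn 0) (leq_subr (j + j).+1 b) MQ1.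
rewrite subKn // subnn in sQ1'.
have Rs : R s = false by rewrite (chain_ple sQ1').
have [Xs Ys] := ple_deg G sQ1'; rewrite addr0 in Xs.
have e1s u : e1 u s = 0.
  apply/eqP/negPn/negP=> us; have su : ple 1 0 s u by rewrite pleE mono10.
  have Ru : R u = false by rewrite (chain1 us).
  have [Xu _] := ple_deg G su; have [c [d [uQ|uQ]]] := above _ Ru.
    by have [XX _] := ple_deg G uQ; have := ler0n rat c; lra.
  have ai' : a%:R < (i + i)%:R :> rat by rewrite ltr_nat.
  by have [XX _] := ple_deg G uQ; have := ler0n rat c; rewrite natrD in ai'; lra.
have ZA := @alt2_Z (j + j).+1 _ _ (delta_eq0 e1s) (delta_eq0 e1s)
  (pow_sink2 sQ1 sQ1') (pow_sink2 sQ1 sQ1').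
have cA := even_core ZA (alt_even chain2 Rs).
have hD c u : (e2 ^+ c) u s != 0 -> Y u = Y s + c%:R.
  by rewrite -mono_e2 => su; have [] := ple_deg G (su : ple 0 c s u).
have := alt_entry hD Ys; rewrite /= addnn odd_double => /(_ isT) AE.
have /coreP[_ /(_ s (dual Q1))] := cA; rewrite -addnn in AE.
rewrite AE !mulf_eq0 ((pcharf0P K).1 char0) /= (negPf (J_dual Ju Q1)) orbF -mono_e2.
move=> /(_ sQ1')/(belowP G)[c [d cd]]; have [_ YY] := ple_deg G cd.
by rewrite dY in YY; have := ler0n rat d; rewrite -natr1 natrD in Ys; lra.
Qed.

End TwoSinks.

Section OneSink.

Variables (Q : 'I_n) (i j : nat).
Hypothesis sQ : sink Q.
Hypothesis RQ : R Q = false.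
Hypothesis beQ : ple i j be Q.
Hypothesis only : forall Q', sink Q' -> R Q' = false -> Q' = Q.

Let gen_out P : gen P -> R P = false -> P = dual Q.
Proof. by rewrite -(sink_dual B) -(chain_dual P) => sP /(only sP) <-; rewrite dK. Qed.

Let gen_in P : gen P -> R P -> P = r.
Proof. by move=> gP /(belowP G)[c [d /(genP G gP)[_ _ ->]]]. Qed.

Let out_below s : R s = false -> exists a b, ple a b (dual Q) s.
Proof.
move=> Rs; have [P [a [b [gP Ps]]]] := gen_below G s.
by rewrite -(gen_out gP) ?(chain_ple Ps) //; exists a, b.
Qed.

Let out_above s : R s = false -> exists a b, ple a b s Q.
Proof.
move=> Rs; have [Q' [a [b [sQ' Ps]]]] := sink_above G s.
by rewrite -(only sQ') -?(chain_ple Ps) //; exists a, b.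
Qed.

Let dQQ : ple (i + i) (j + j) (dual Q) Q.
Proof.
have dQbe : ple i j (dual Q) be by rewrite -dbe (ple_dual B).
exact: (ple_trans G dQbe beQ).
Qed.

(** The entry is carried back to a source [g] below [t]. Its new target lies in the same part as
    [g], whose only source is [g]; dividing the resulting path to [s] by the path from [g] to [t]
    gives the claim. *)
Lemma even_core1 A : A \in Z -> even_mx A -> A \in core.
Proof.
move=> ZA evA; apply/coreP; split=> // s t Ast.
have [g [c [d [gg gt]]]] := gen_below G t.
have : (A *m mono c d) s g != 0.
  by rewrite (mulmx_coluniq _ _ (pinj_mono G _ _) gt) mulf_neq0.
rewrite (Zmono Zcomm _ _ ZA) => /mulmx_neq0[t' t's At'].
have [a [b gt']] : exists a b, ple a b g t'.
  case: (boolP (R g)) => [Rg|/negbTE Rg].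
    by apply/(belowP G); rewrite {1}(gen_in gg Rg) (evA _ _ At').
  by rewrite (gen_out gg Rg); apply: out_below; rewrite (evA _ _ At').
apply/(belowP G); do 2!eexists.
exact: (ple_from G (leq_addr _ _) (leq_addr _ _) gt (ple_trans G gt' t's)).
Qed.

(** [C] commutes with monomials, so those that kill [r], namely [e2] and [e1^(k+k+1)], also kill
    [s]. *)
Lemma odd_row C s : C \in Z -> odd_mx C -> C s r != 0 -> exists2 a, (a <= k + k)%N & ple a 0 s Q.
Proof.
move=> ZC oC Csr; have Rs : R s = false.
  by apply/negbTE/negP=> Rs; have := oC _ _ Csr; rewrite Rs chain_r.
have [a [b sQ']] := out_above Rs.
have b0 : b = 0%N.
  case: b sQ' => // b sQ'; have [u su _] := ple_splitle G (leq0n a) (ltn0Sn b) sQ'.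
  have := congr1 (fun D : 'M_n => D u r) (Zmono Zcomm 0 1 ZC) => /=.
  rewrite (mulmx_rowuniq _ _ (pinj_mono G _ _) su) mxE big1 => [|v _].
    by move/esym/eqP; rewrite mulf_eq0 (negPf Csr) orbF (negPf su).
  by rewrite mono01 e2r mulr0.
rewrite {}b0 in sQ'; exists a => //; rewrite leqNgt; apply/negP=> ka.
have [u su _] := ple_splitle G ka (leqnn 0) sQ'.
have := congr1 (fun D : 'M_n => D u r) (Zmono Zcomm (k + k).+1 0 ZC) => /=.
rewrite (mulmx_rowuniq _ _ (pinj_mono G _ _) su) mxE big1 => [|v _].
  by move/esym/eqP; rewrite mulf_eq0 (negPf Csr) orbF (negPf su).
have [->|/eqP rv] := mono (k + k).+1 0 v r =P 0; first by rewrite mulr0.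
have := ple_from G (leqnSn _) (leqnn 0) r_r' rv.
by case/(sinkP G sr') => /eqP; rewrite subSnn.
Qed.

(** The alternating wedge of the last [a] steps of the chain, ending at [r'], with the row from [N]
    to [Q]. *)
Lemma row_element a N : (a <= k + k)%N -> ple a 0 N Q -> (forall u, e2 u N = 0) ->
  exists C, [/\ C \in Z, C r' (dual N) != 0 &
    forall u v, C u v != 0 -> X u = X v + (X r' + X Q - a%:R)].
Proof.
move=> ak NQ e2N.
have [M _ Mr'] := ple_splitle G (leq_subr a (k + k)) (leqnn 0) r_r'.
rewrite subKn // subnn in Mr'.
have RM : R M by rewrite (chain_ple Mr') chain_r'.
have RN : R N = false by rewrite (chain_ple NQ).
have e2M u : e2 u M = 0.
  by apply/eqP/negPn/negP=> uM; have := chain_e2 uM; rewrite (chain2 uM) RM.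
have [XM _] := ple_deg G Mr'; have [XN _] := ple_deg G NQ.
exists (alt_wedge J e1 a (delta_mx M 0) (delta_mx N 0)); split.
- by apply: alt1_Z (delta_eq0 e2M) (delta_eq0 e2N) (pow_sink1 sr' Mr') (pow_sink1 sQ NQ).
- rewrite summxE big_ord_recr /= big1 ?add0r => [|b _].
    rewrite mxE wedgeE dK !delta_entry subnn expr0 -idmxE !mxE eqxx.
    have -> : (r' == N) = false by apply/eqP=> E; rewrite -E chain_r' in RN.
    rewrite mul0r subr0 mulr1 !mulf_neq0 ?signr_eq0 ?J_dual // -mono_e1; exact: Mr'.
  rewrite mxE wedgeE dK !delta_entry -!mono_e1.
  have -> : mono b 0 r' M = 0.
    apply/eqP/negPn/negP=> Mb; have [XMb _] := ple_deg G (Mb : ple b 0 M r').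
    move: XMb; rewrite XM => /addrI/eqP; rewrite eqr_nat => /eqP E.
    by have := ltn_ord b; rewrite -E ltnn.
  have -> : mono (a - b) 0 r' N = 0.
    apply/eqP/negPn/negP=> Nb; have := chain_ple (Nb : ple (a - b) 0 N r').
    by rewrite RN chain_r'.
  by rewrite !mul0r subrr mul0r mulr0.
move=> u v; rewrite summxE => nz.
have [b] : exists b : 'I_a.+1, ((-1) ^+ b *: wedge J (e1 ^+ b *m delta_mx M 0)
    (e1 ^+ (a - b) *m delta_mx N 0)) u v != 0.
  apply/existsP; apply: contraNT nz; rewrite negb_exists => /forallP h.
  by rewrite big1 // => b _; apply/eqP; have := h b; rewrite negbK.
rewrite mxE mulf_eq0 negb_or => /andP[_].
have hv c s : hvec X Y (X s + c%:R) (Y s + 0%:R) (e1 ^+ c *m delta_mx s 0 : 'cV_n).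
  by move=> t; rewrite delta_entry -mono_e1 => st; exact: (ple_deg G (st : ple c 0 s t)).
move/(wedge_homog (fd_J F) (hv b M) (hv (a - b)%N N)) => [-> _].
have ba : (b <= a)%N by rewrite -ltnS.
by rewrite XM XN natrB //; lra.
Qed.

(** Both rows have at least two steps, so [a = 0, 1, 2] give three odd elements of different
    degrees. *)
Lemma long_rows_absurd : (0 < k)%N -> (0 < i)%N -> False.
Proof.
move=> k0 i0.
have elt a : (a <= 2)%N -> exists N C, [/\ X N = X Q - a%:R, R N = false, C \in Z,
    C r' (dual N) != 0 & forall u v, C u v != 0 -> X u = X v + (X r' + X Q - a%:R)].
  move=> a2; have ai : (a <= i + i)%N by clear -a2 i0; lia.
  have [N _ NQ] := ple_splitle G (leq_subr a (i + i)) (leqnn (j + j)) dQQ.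
  rewrite subKn // subnn in NQ.
  have [XN YN] := ple_deg G NQ; have RN : R N = false by rewrite (chain_ple NQ).
  have e2N u : e2 u N = 0.
    apply/eqP/negPn/negP=> us; have su : ple 0 1 N u by rewrite pleE mono01.
    have Ru : R u = false by rewrite (chain2 us).
    have [c [d uQ]] := out_above Ru; have [_ Yu] := ple_deg G su.
    by have [_ YY] := ple_deg G uQ; have := ler0n rat d; lra.
  have ak : (a <= k + k)%N by clear -a2 k0; lia.
  have [C [ZC Cn CX]] := row_element ak NQ e2N.
  by exists N, C; split=> //; lra.
have [N0 [C0 [X0 R0 Z0 n0 d0]]] := elt 0%N isT.
have [N1 [C1 [X1 R1 Z1 n1 d1]]] := elt 1%N isT.
have [N2 [C2 [X2 R2 Z2 n2 d2]]] := elt 2%N isT.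
have pos N A : R N = false -> A \in core -> A r' (dual N) = 0.
  move=> RN cA; apply/eqP/negPn/negP=> /(core_even cA).
  by rewrite chain_r' chain_dual RN.
have van a b C N : (forall u v, C u v != 0 -> X u = X v + (X r' + X Q - a)) ->
    X N = X Q - b -> a != b -> C r' (dual N) = 0.
  move=> dC XN ab; apply/eqP/negPn/negP=> /dC; rewrite [X (dual N)]dX XN => E.
  by case/eqP: ab; lra.
apply: (three_absurd Z0 Z1 Z2 (fun A => pos N0 A R0) (fun A => pos N1 A R1)
  (fun A => pos N2 A R2) n0 n1 n2).
- by apply: van d0 X1 _.
- by apply: van d0 X2 _.
- by apply: van d1 X2 _.
Qed.

Lemma odd_single C s : C \in Z -> odd_mx C -> C s r != 0 -> s = Q.
Proof.
move=> ZC oC Csr; have [a ak sQ'] := odd_row ZC oC Csr.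
suff a0 : a = 0%N by move: sQ'; rewrite a0 ple00 => /eqP.
have [k0|k0] := posnP k; first by move: ak; rewrite k0 leqn0 => /eqP.
have [i0|i0] := posnP i; last by case: (long_rows_absurd k0 i0).
have Rs : R s = false by rewrite (chain_ple sQ').
have [c [d ds]] := out_below Rs.
have [X1 _] := ple_deg G (ple_trans G ds sQ'); have [X2 _] := ple_deg G dQQ.
move: X1; rewrite X2 i0 => /addrI/eqP; rewrite eqr_nat addn0 eq_sym addn_eq0.
by case/andP=> /eqP.
Qed.

(** Column [r] determines all columns of the chain by commutation with monomials, and skewness turns
    these into the remaining entries. *)
Lemma odd_zero C : C \in Z -> odd_mx C -> C Q r = 0 -> C = 0.
Proof.
move=> ZC oC C0; have /centrP[gC _ _] := ZC.
have Cr s : C s r = 0.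
  apply/eqP/negPn/negP=> Csr; have E := odd_single ZC oC Csr.
  by rewrite E C0 eqxx in Csr.
have CR s t : R t -> C s t = 0.
  move=> /(belowP G)[c [d rt]].
  have := congr1 (fun D : 'M_n => D s r) (Zmono Zcomm c d ZC) => /=.
  rewrite (mulmx_coluniq _ _ (pinj_mono G _ _) rt) [RHS]mxE big1 => [|u _].
    by move/eqP; rewrite mulf_eq0 [mono c d t r == 0](negPf rt) orbF => /eqP.
  by rewrite Cr mulr0.
apply/matrixP=> s t; rewrite mxE; case: (boolP (R t)) => [/CR //|Rt].
apply/eqP/negPn/negP=> Cst; have Rs : R s.
  by apply: contraT => Rs; case: (oC _ _ Cst); rewrite (negPf Rs) (negPf Rt).
have := gform_entry JT Ju Jp s t gC; rewrite (CR (dual t)) ?chain_dual // mulr0 oppr0.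
by move/eqP; rewrite mulf_eq0 (negPf Cst) (negPf (J_dual Ju s)).
Qed.

Local Notation z0 := (bivJ J 1 r' Q).

Lemma z0_odd : odd_mx z0.
Proof. by move=> u v nz uv; move: nz; rewrite (biv_odd uv RQ) eqxx. Qed.

Lemma z0_entry : z0 Q r != 0.
Proof.
have nQ : r' != Q by apply/eqP=> E; move: RQ; rewrite -E chain_r'.
rewrite (bivJE JT Ju Jp) bivE !eqxx [Q == r']eq_sym (negPf nQ) /= mul1r sub0r mulNr mul1r.
by rewrite oppr_eq0 -{2}[r]dK J_dual.
Qed.

Lemma z0_row t : z0 Q t != 0 -> t = r.
Proof.
have nQ : r' != Q by apply/eqP=> E; move: RQ; rewrite -E chain_r'.
rewrite (bivJE JT Ju Jp) bivE !eqxx [Q == r']eq_sym (negPf nQ) /= sub0r mul1r.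
have [/(dual_inj JT Ju Jp) //|_] := eqVneq (dual t) r'.
by rewrite oppr0 mul0r eqxx.
Qed.

Lemma z0_col t : z0 t r != 0 -> t = Q.
Proof.
have nQ : r' != Q by apply/eqP=> E; move: RQ; rewrite -E chain_r'.
rewrite (bivJE JT Ju Jp) bivE eqxx (negPf nQ) /= andbF sub0r andbT mul1r.
by have [//|_] := eqVneq t Q; rewrite oppr0 mul0r eqxx.
Qed.

(** The commutator is an odd element of [Z], and its entry at [Q], [r] is proportional to
    [A Q Q - A r r]. Both entries vanish: skewness kills the diagonal entries at the self-dual [be]
    and [al], and paths carry these zeros to [Q] and [r'], hence by duality to [r]. *)
Lemma core_z0 A : A \in core -> A *m z0 = z0 *m A.
Proof.
move=> cA; have /coreP[ZA _] := cA; have Zz := sink_wedge_Z sr' sQ.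
have /centrP[gA _ _] := ZA.
apply/eqP; rewrite -admx_eq0; apply/eqP/odd_zero.
- exact: admx_Z.
- move=> s t; rewrite admxE => nz Rst.
  have : ((A *m z0) s t != 0) || ((z0 *m A) s t != 0).
    by apply: contraNT nz; rewrite negb_or !negbK => /andP[/eqP -> /eqP ->]; rewrite subr0.
  case/orP=> /mulmx_neq0[u h1 h2].
    by apply: (z0_odd h2); rewrite -(core_even cA h1).
  by apply: (z0_odd h1); rewrite (core_even cA h2).
have diag0 s t c d : dual s = s -> A s s = 0 -> ple c d s t -> A t t = 0.
  move=> _ As0 st; have := congr1 (fun D : 'M_n => D t s) (Zmono Zcomm c d ZA) => /=.
  rewrite (mulmx_coluniq _ _ (pinj_mono G _ _) st) (mulmx_rowuniq _ _ (pinj_mono G _ _) st).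
  by rewrite As0 mulr0 => /eqP; rewrite mulf_eq0 [mono _ _ _ _ == 0](negPf st) orbF => /eqP.
have self s : dual s = s -> A s s = 0.
  by move=> ds; have := gform_alt char0 B s (erefl 1) gA; rewrite ds.
have AQ : A Q Q = 0 := diag0 _ _ _ _ dbe (self _ dbe) beQ.
have Ar : A r r = 0.
  have al_r' : ple k 0 al r' by rewrite -dal (ple_dual B).
  have Ar' := diag0 _ _ _ _ dal (self _ dal) al_r'.
  have := gform_entry JT Ju Jp r r gA; rewrite Ar' mulr0 oppr0.
  by move/eqP; rewrite mulf_eq0 (negPf (J_dual Ju r)) orbF => /eqP.
rewrite admxE !mxE (bigD1 Q) //= big1 ?addr0 => [|t tQ]; last first.
  have [->|/eqP/z0_col E] := z0 t r =P 0; first by rewrite mulr0.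
  by rewrite E eqxx in tQ.
rewrite (bigD1 r) //= big1 ?addr0 => [|t tr]; last first.
  have [->|/eqP/z0_row E] := z0 Q t =P 0; first by rewrite mul0r.
  by rewrite E eqxx in tr.
by rewrite AQ Ar mul0r mulr0 subrr.
Qed.

Lemma one_sink_abelian : {in Z &, forall A C, A *m C = C *m A}.
Proof.
have dec A : A \in Z -> exists A' a, A' \in core /\ A = A' + a *: z0.
  move=> ZA; have [ev od] := even_odd A; have Zo := odd_part_Z ZA.
  exists (A - odd_part A), (odd_part A Q r / z0 Q r); split.
    by apply: even_core1 => //; apply: rpredB.
  rewrite -[LHS](subrK (odd_part A)); congr (_ + _); apply/eqP; rewrite -subr_eq0; apply/eqP.
  apply: odd_zero.
  - by apply: rpredB => //; apply: rpredZ; apply: sink_wedge_Z.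
  - move=> s t nz Rst; case/eqP: nz; rewrite [LHS]mxE [X in _ + X]mxE [X in - X]mxE.
    have -> : odd_part A s t = 0.
      by apply/eqP/negPn/negP=> h; case: (od _ _ h).
    by rewrite (biv_odd Rst RQ) mulr0 subrr.
  - rewrite [LHS]mxE [X in _ + X]mxE [X in - X]mxE.
    by rewrite divfK ?subrr // z0_entry.
move=> A C /dec[A' [a [cA ->]]] /dec[C' [c [cC ->]]].
have := core_abelian G Zcomm Zcomp cA cC.
move: (core_z0 cA) (core_z0 cC); move: z0 => z Az Cz AC.
rewrite !mulmxDl !mulmxDr -!scalemxAl -!scalemxAr Az Cz AC addrACA.
by rewrite !scalerA (mulrC a).
Qed.

End OneSink.

Lemma split_abelian : {in Z &, forall A C, A *m C = C *m A}.
Proof.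
have [Q1 [i [j [sQ1 beQ1]]]] := sink_above G be.
have RQ1 : R Q1 = false by rewrite -(chain_ple beQ1) chain_be.
have [/existsP[Q2 /and3P[sQ2 /negbTE RQ2 Q12]]|] :=
  boolP [exists Q2, [&& sink Q2, ~~ R Q2 & Q2 != Q1]].
  by case: (two_sinks_absurd sQ1 sQ2 RQ1 RQ2 Q12 beQ1).
rewrite negb_exists => /forallP no; apply: (one_sink_abelian sQ1 RQ1 beQ1) => Q sQ RQ.
by apply/eqP; have := no Q; rewrite sQ RQ /= negbK.
Qed.

End Split.

(** * Changing the basis of the zero weight space *)

Lemma conj_abelian (K : fieldType) n (P J e1 e2 : 'M[K]_n) : P \in unitmx ->
  {in centr (gform (P^T *m J *m P)) (conj_mx P e1) (conj_mx P e2) &,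
    forall A B, A *m B = B *m A} ->
  {in centr (gform J) e1 e2 &, forall A B, A *m B = B *m A}.
Proof.
move=> Pu ab A B ZA ZB; apply: (conj_mx_inj Pu); rewrite !conj_mxM //.
by apply: ab; apply: conj_centr.
Qed.

Lemma homog_invmx (K : fieldType) n (X Y : 'I_n -> rat) (P : 'M[K]_n) : P \in unitmx ->
  homog X Y 0 0 P -> homog X Y 0 0 (invmx P).
Proof.
move=> Pu hP; suff -> : invmx P = hcomp X Y 0 0 (invmx P) by apply: hcomp_homog.
rewrite -[RHS](mulKmx Pu).
have -> : P *m hcomp X Y 0 0 (invmx P) = 1%:M.
  apply/matrixP=> s t; rewrite mxE.
  under eq_bigr => u _ do rewrite [X in _ * X]mxE !addr0.
  have [/andP[/eqP Xst /eqP Yst]|nst] := boolP ((X s == X t) && (Y s == Y t)).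
    rewrite -(mulmxV Pu) [RHS]mxE; apply: eq_bigr => u _.
    have [->|/eqP/hP[]] := P s u =P 0; first by rewrite !mul0r.
    by rewrite !addr0 => <- <-; rewrite Xst Yst !eqxx.
  rewrite mxE big1 => [|u _].
    by have [E|_] := eqVneq s t; first by rewrite E !eqxx in nst.
  have [->|/eqP/hP[]] := P s u =P 0; first by rewrite mul0r.
  by rewrite !addr0 => <- <-; rewrite (negPf nst) mulr0.
by rewrite mulmx1.
Qed.

Lemma fdata_conj (K : fieldType) n (X Y : 'I_n -> rat) (e1 e2 J P : 'M[K]_n) :
  P \in unitmx -> homog X Y 0 0 P -> fdata X Y e1 e2 J 1 ->
  fdata X Y (conj_mx P e1) (conj_mx P e2) (P^T *m J *m P) 1.
Proof.
move=> Pu hP [h1 h2 c12 he JT Ju dJ g1 g2 dZ]; have hQ := homog_invmx Pu hP.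
split.
- move=> s t /mulmx_neq0[b /mulmx_neq0[a /hQ[Xa Ya] /h1[Xab Yab]] /hP[Xb Yb]].
  by rewrite !addr0 in Xa Ya Xb Yb; split; lra.
- move=> s t /mulmx_neq0[b /mulmx_neq0[a /hQ[Xa Ya] /h2[Xab Yab]] /hP[Xb Yb]].
  by rewrite !addr0 in Xa Ya Xb Yb; split; lra.
- by rewrite -!conj_mxM // c12.
- exact: he.
- by rewrite !trmx_mul JT !scale1r trmxK mulmxA.
- by rewrite !unitmx_mul unitmx_tr Pu Ju.
- move=> s t /mulmx_neq0[b /mulmx_neq0[a]]; rewrite mxE => /hP[Xa Ya] /dJ[Xab Yab] /hP[Xb Yb].
  by rewrite !addr0 in Xa Ya Xb Yb; split; lra.
- exact: conj_gform.
- exact: conj_gform.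
- exact: leq_trans (dim_conj_centr _ _ _ Pu) dZ.
Qed.

Lemma pinj_of_col (K : fieldType) n (J A : 'M[K]_n) eps : J^T = eps *: J -> J \in unitmx ->
  pinj J -> A \in gform J ->
  (forall R R' P, A R P != 0 -> A R' P != 0 -> R = R') -> pinj A.
Proof.
move=> JT Ju Jp gA cA; split=> // R P P' h h'.
have aux Q : A R Q != 0 -> A (dual J Q) (dual J R) != 0.
  move=> AQ; apply/eqP=> A0; have := gform_entry JT Ju Jp R Q gA.
  by rewrite A0 mulr0 oppr0 => /eqP; rewrite mulf_eq0 (negPf AQ) (negPf (J_dual Ju R)).
exact: (dual_inj JT Ju Jp (cA _ _ _ (aux _ h) (aux _ h'))).
Qed.

Section Adapt.

Variables (K : fieldType) (n : nat) (X Y : 'I_n -> rat) (e1 e2 J : 'M[K]_n).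
Hypothesis char0 : [pchar K] =i pred0.
Hypothesis F : fdata X Y e1 e2 J 1.
Variables (z0 z1 : 'I_n).
Hypothesis z01 : z0 != z1.
Local Notation zr s := ((s == z0) || (s == z1)).
Hypothesis zrP : forall s, zr s = (X s == 0) && (Y s == 0).
Hypothesis simple : forall s t, X s = X t -> Y s = Y t -> ~~ zr s -> s = t.
Variables (u v : 'cV[K]_n).
Hypothesis su : forall s, u s 0 != 0 -> zr s.
Hypothesis sv : forall s, v s 0 != 0 -> zr s.
Hypothesis det_uv : u z0 0 * v z1 0 - u z1 0 * v z0 0 != 0.

Definition adapted : 'M[K]_n :=
  \matrix_(s, t) if t == z0 then u s 0 else if t == z1 then v s 0 else (s == t)%:R.
Local Notation P := adapted.
Local Notation J' := (P^T *m J *m P).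
Local Notation f1 := (conj_mx P e1).
Local Notation f2 := (conj_mx P e2).

Lemma adapted_mul (x : 'cV[K]_n) s :
  (P *m x) s 0 = u s 0 * x z0 0 + v s 0 * x z1 0 + (if zr s then 0 else x s 0).
Proof.
rewrite mxE (bigD1 z0) //= (bigD1 z1) ?(eq_sym z1) //= addrA !mxE !eqxx.
rewrite (eq_sym z1) (negPf z01); congr (_ + _).
have aux t : (t != z0) && (t != z1) -> P s t * x t 0 = if s == t then x t 0 else 0.
  move=> /andP[/negPf t0 /negPf t1]; rewrite mxE t0 t1.
  by case: eqP; rewrite ?mul1r ?mul0r.
rewrite (eq_bigr _ aux) -big_mkcondr; case: ifP => zs.
  rewrite big_pred0 // => t; have [<-|_] := eqVneq s t; last by rewrite andbF.
  by case/orP: zs => ->; rewrite ?andbF.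
rewrite (big_pred1 s) // => t; rewrite /= [s == t]eq_sym; have [->|_] := eqVneq t s.
  by rewrite andbT -negb_or zs.
by rewrite andbF.
Qed.

Lemma adapted_unit : P \in unitmx.
Proof.
rewrite -unitmx_tr -row_free_unit; apply: inj_row_free => w w0.
have Pw : P *m w^T = 0 by rewrite -[P]trmxK -trmx_mul w0 trmx0.
have E s := congr1 (fun y : 'cV_n => y s 0) Pw.
have out s : ~~ zr s -> w^T s 0 = 0.
  move=> zs; have := E s; rewrite /= adapted_mul (negPf zs) [X in _ = X -> _]mxE.
  have [us|/su] := eqVneq (u s 0) 0; last by rewrite (negPf zs).
  have [vs|/sv] := eqVneq (v s 0) 0; last by rewrite (negPf zs).
  by rewrite us vs !mul0r !add0r.
have := E z1; have := E z0; rewrite /= !adapted_mul !eqxx orbT !addr0 !mxE => E0 E1.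
have k0 : (u z0 0 * v z1 0 - u z1 0 * v z0 0) * w 0 z0 = 0.
  transitivity (v z1 0 * (u z0 0 * w 0 z0 + v z0 0 * w 0 z1)
    - v z0 0 * (u z1 0 * w 0 z0 + v z1 0 * w 0 z1)); first by ring.
  by rewrite E0 E1 !mulr0 subrr.
have k1 : (u z0 0 * v z1 0 - u z1 0 * v z0 0) * w 0 z1 = 0.
  transitivity (u z0 0 * (u z1 0 * w 0 z0 + v z1 0 * w 0 z1)
    - u z1 0 * (u z0 0 * w 0 z0 + v z0 0 * w 0 z1)); first by ring.
  by rewrite E0 E1 !mulr0 subrr.
apply/matrixP=> i s; rewrite ord1 mxE; case: (boolP (zr s)) => [/orP[]/eqP ->|/out].
- by move/eqP: k0; rewrite mulf_eq0 (negPf det_uv) => /eqP.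
- by move/eqP: k1; rewrite mulf_eq0 (negPf det_uv) => /eqP.
- by rewrite mxE.
Qed.

Let Pu := adapted_unit.

Lemma zr_same s t : X s = X t -> Y s = Y t -> zr s = zr t.
Proof. by move=> Xst Yst; rewrite !zrP Xst Yst. Qed.

Lemma zr_eq s t : zr s -> zr t -> X s = X t /\ Y s = Y t.
Proof. by rewrite !zrP => /andP[/eqP -> /eqP ->] /andP[/eqP -> /eqP ->]. Qed.

Lemma adapted_homog : homog X Y 0 0 P.
Proof.
move=> s t; rewrite mxE !addr0; have [->|_] := eqVneq t z0.
  by move=> /su zs; apply: (zr_eq zs); rewrite eqxx.
have [->|_] := eqVneq t z1; first by move=> /sv zs; apply: (zr_eq zs); rewrite eqxx orbT.
by have [->|_] := eqVneq s t; rewrite ?eqxx.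
Qed.

Let F' := fdata_conj Pu adapted_homog F.

Lemma adapted_col s : ~~ zr s -> P *m delta_mx s 0 = delta_mx s 0 :> 'cV_n.
Proof.
rewrite negb_or => /andP[/negPf s0 /negPf s1]; rewrite -colE.
by apply/matrixP=> t i; rewrite ord1 !mxE s0 s1 eqxx andbT.
Qed.

Lemma adapted_colu : P *m delta_mx z0 0 = u.
Proof. by rewrite -colE; apply/matrixP=> t i; rewrite ord1 !mxE eqxx. Qed.

Lemma adapted_colv : P *m delta_mx z1 0 = v.
Proof. by rewrite -colE; apply/matrixP=> t i; rewrite ord1 !mxE eqxx (eq_sym z1) (negPf z01). Qed.

Lemma conj_col (A : 'M[K]_n) s (w : 'cV_n) : ~~ zr s -> A *m delta_mx s 0 = P *m w ->
  conj_mx P A *m delta_mx s 0 = w.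
Proof. by move=> zs Aw; rewrite /conj_mx -!mulmxA (adapted_col zs) Aw mulKmx. Qed.

Lemma conj_row (A : 'M[K]_n) s : ~~ zr s -> (forall t, A s t = 0) ->
  forall t, conj_mx P A s t = 0.
Proof.
move=> zs As t; apply/eqP/negPn/negP=> /mulmx_neq0[b /mulmx_neq0[a]].
move=> /(homog_invmx Pu adapted_homog); rewrite !addr0 => -[Xa Ya].
by rewrite -(simple Xa Ya zs) As eqxx.
Qed.

(** For homogeneous [e] of nonzero degree, this leaves at most one nonzero entry per column in the
    basis adapted to [u] and [v]. *)
Definition good_cols (e : 'M[K]_n) := forall s, ~~ zr s ->
  [\/ exists c, e *m delta_mx s 0 = c *: u, exists c, e *m delta_mx s 0 = c *: v
    | forall i, zr i -> e i s = 0].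

Lemma conj_col0 (e : 'M[K]_n) R S : ~~ zr S -> (forall i, zr i -> e i S = 0) -> zr R ->
  conj_mx P e R S = 0.
Proof.
move=> zS e0 zR; apply/eqP/negPn/negP; rewrite /conj_mx -mulmxA => /mulmx_neq0[a].
move=> /(homog_invmx Pu adapted_homog); rewrite !addr0 => -[Xa Ya].
have -> : (e *m P) a S = e a S.
  rewrite -[LHS](_ : (e *m P *m delta_mx S 0 : 'cV_n) a 0 = _); last by rewrite -colE mxE.
  by rewrite -mulmxA (adapted_col zS) -colE mxE.
by rewrite e0 ?eqxx // -(zr_same Xa Ya).
Qed.

Lemma conj_col_unique e p q : homog X Y p q (conj_mx P e) -> (p != 0) || (q != 0) ->
  homog X Y p q e -> good_cols e ->
  forall R R' S, conj_mx P e R S != 0 -> conj_mx P e R' S != 0 -> R = R'.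
Proof.
move=> hf pq he gc R R' S h h'; have [XR YR] := hf _ _ h; have [XR' YR'] := hf _ _ h'.
have [XX YY] : X R = X R' /\ Y R = Y R' by rewrite XR XR' YR YR'.
case: (boolP (zr R)) => zR; last exact: simple.
have zR' : zr R' by rewrite -(zr_same XX YY).
have zS : ~~ zr S.
  apply/negP=> /(zr_eq zR)[E1 E2]; move: pq; rewrite -E1 in XR; rewrite -E2 in YR.
  by apply/negP; rewrite negb_or !negbK; apply/andP; split; apply/eqP; lra.
have only z (w : 'cV[K]_n) : e *m delta_mx S 0 = P *m w -> (forall i, w i 0 != 0 -> i = z) -> R = R'.
  move=> /(conj_col zS) Ew hw.
  have hR i : conj_mx P e i S != 0 -> i = z.
    by move=> nz; apply: hw; rewrite -Ew -colE mxE.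
  by rewrite (hR _ h) (hR _ h').
case: (gc S zS) => [[c ec]|[c ec]|e0].
- apply: (only z0 (c *: delta_mx z0 0)); first by rewrite ec -scalemxAr adapted_colu.
  by move=> i; rewrite !mxE eqxx andbT; have [//|_] := eqVneq i z0; rewrite mulr0 eqxx.
- apply: (only z1 (c *: delta_mx z1 0)); first by rewrite ec -scalemxAr adapted_colv.
  by move=> i; rewrite !mxE eqxx andbT; have [//|_] := eqVneq i z1; rewrite mulr0 eqxx.
by move: h; rewrite conj_col0 ?eqxx.
Qed.

(** The adapted zero-weight basis is isotropic or orthogonal; either makes [J'] a partial
    permutation matrix. *)
Definition block_form := (J' z0 z0 = 0 /\ J' z1 z1 = 0) \/ J' z0 z1 = 0.

Lemma block_sym : J' z1 z0 = J' z0 z1.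
Proof. by have := congr1 (fun A : 'M_n => A z0 z1) (fd_JT F'); rewrite scale1r [LHS]mxE. Qed.

Hypothesis bf : block_form.
Hypothesis gc1 : good_cols e1.
Hypothesis gc2 : good_cols e2.

Lemma adapted_pinjJ : pinj J'.
Proof.
have col R R' S : J' R S != 0 -> J' R' S != 0 -> R = R'.
  move=> h h'; have [XR YR] := fd_J F' h; have [XR' YR'] := fd_J F' h'.
  have XX : X R = X R' by lra.
  have YY : Y R = Y R' by lra.
  case: (boolP (zr R)) => zR; last exact: simple.
  have zR' : zr R' by rewrite -(zr_same XX YY).
  have zS : zr S.
    move: zR; rewrite !zrP => /andP[/eqP X0 /eqP Y0].
    by apply/andP; split; apply/eqP; lra.
  move: h h'; case/orP: zR => /eqP ->; case/orP: zR' => /eqP ->;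
    case/orP: zS => /eqP -> //; case: bf => [[E1 E2]|E];
    rewrite ?block_sym ?E1 ?E2 ?E ?eqxx //.
split=> // R S S'; have sym a b : J' a b = J' b a.
  by have := congr1 (fun A : 'M_n => A a b) (fd_JT F'); rewrite scale1r [LHS]mxE.
by rewrite [J' R S]sym [J' R S']sym; apply: col.
Qed.

Lemma adapted_pinj1 : pinj f1.
Proof.
apply: pinj_of_col (fd_JT F') (fd_Ju F') adapted_pinjJ (fd_e1 F') _.
by apply: conj_col_unique (fd_h1 F') _ (fd_h1 F) gc1; rewrite oner_eq0.
Qed.

Lemma adapted_pinj2 : pinj f2.
Proof.
apply: pinj_of_col (fd_JT F') (fd_Ju F') adapted_pinjJ (fd_e2 F') _.
by apply: conj_col_unique (fd_h2 F') _ (fd_h2 F) gc2; rewrite oner_eq0 orbT.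
Qed.

Lemma adapted_dual s t : t \in wopp X Y s -> ~~ zr s -> t = dual J' s.
Proof.
move=> /woppP[Xt Yt] zs; have [Xd Yd] := fd_J F' (J_dual (fd_Ju F') s).
have Xtd : X t = X (dual J' s) by lra.
have Ytd : Y t = Y (dual J' s) by lra.
apply: simple => //; apply: contra zs; rewrite !zrP => /andP[/eqP X0 /eqP Y0].
by apply/andP; split; apply/eqP; lra.
Qed.

Lemma dual_zr s : zr s -> zr (dual J' s).
Proof.
have [Xd Yd] := fd_J F' (J_dual (fd_Ju F') s).
by rewrite !zrP => /andP[/eqP X0 /eqP Y0]; apply/andP; split; apply/eqP; lra.
Qed.

Lemma wopp_zr s t : zr s -> t \in wopp X Y s -> zr t.
Proof.
rewrite !zrP => /andP[/eqP X0 /eqP Y0] /woppP[Xt Yt].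
by apply/andP; split; apply/eqP; lra.
Qed.

Lemma isotropic_abelian : (2 < n)%N -> J' z0 z0 = 0 -> J' z1 z1 = 0 ->
  {in centr (gform J) e1 e2 &, forall A B, A *m B = B *m A}.
Proof.
move=> n2 J00 J11; apply: (conj_abelian Pu); apply: commute_dec => nab.
apply: (form_abelian_absurd char0 (fgrid_of_pinj char0 F' adapted_pinj1 adapted_pinj2
  adapted_pinjJ _ nab) (fun _ => n2)).
move=> s t st; case: (boolP (zr s)) => zs; last by move=> _; apply: adapted_dual.
case=> [nst|e]; last first.
  have : 2%:R == 0 :> K by rewrite mulr2n {1}e addNr.
  by rewrite ((pcharf0P K).1 char0).
have zt := wopp_zr zs st; have zd := dual_zr zs.
have nd : dual J' s != s.
  apply/eqP=> ds; have := J_dual (fd_Ju F') s; rewrite ds.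
  by case/orP: zs => /eqP ->; rewrite ?J00 ?J11 eqxx.
move: (dual J' s) zd nd => d zd nd; move: nst nd.
by case/orP: zs => /eqP ->; case/orP: zt => /eqP ->; case/orP: zd => /eqP -> //; rewrite eqxx.
Qed.

Lemma orthogonal_abelian r k : J' z0 z1 = 0 -> gen f1 f2 r -> ple f1 f2 k 0 r z0 ->
  (forall s, f2 s r = 0) ->
  {in centr (gform J) e1 e2 &, forall A B, A *m B = B *m A}.
Proof.
move=> J01 gr rz f2r; apply: (conj_abelian Pu).
have dz s : zr s -> dual J' s = s.
  move=> zs; have := J_dual (fd_Ju F') s; move: zs (dual_zr zs).
  by case/orP=> /eqP -> /orP[]/eqP ->; rewrite ?block_sym ?J01 ?eqxx.
have := zrP z0; rewrite eqxx /= => /esym/andP[/eqP X0 /eqP Y0].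
have := zrP z1; rewrite eqxx orbT => /esym/andP[/eqP X1 /eqP Y1].
have d0 : dual J' z0 = z0 by apply: dz; rewrite eqxx.
have d1 : dual J' z1 = z1 by apply: dz; rewrite eqxx orbT.
apply: (split_abelian char0 F' adapted_pinj1 adapted_pinj2 adapted_pinjJ z01 d0 d1
  X0 X1 Y1 _ gr rz f2r) => s t st nst.
case: (boolP (zr s)) => zs; last by constructor 1; apply: adapted_dual.
have zt := wopp_zr zs st; move: nst; case/orP: zs => /eqP ->; case/orP: zt => /eqP ->;
  rewrite ?eqxx // => _; [by constructor 2|by constructor 3].
Qed.

End Adapt.

Lemma conj_mxX (K : fieldType) n (P A : 'M[K]_n) m : P \in unitmx ->
  conj_mx P A ^+ m = conj_mx P (A ^+ m).
Proof.
move=> Pu; elim: m => [|m IH]; last by rewrite !exprS IH -!mulmxE conj_mxM.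
by rewrite !expr0 -idmxE /conj_mx mulmx1 mulVmx.
Qed.

Lemma abs_le_bound n (X : 'I_n -> rat) : exists m : nat, forall s, `|X s| <= m%:R.
Proof.
exists (\sum_s Num.bound `|X s|)%N => s; apply: le_trans (ltW (archi_boundP (normr_ge0 _))) _.
by rewrite ler_nat (bigD1 s) //= leq_addr.
Qed.

(** * Case analysis for a double zero weight *)

Section DoubleZero.

Variables (K : fieldType) (n : nat) (X Y : 'I_n -> rat) (e1 e2 J : 'M[K]_n).
Hypothesis char0 : [pchar K] =i pred0.
Hypothesis F : fdata X Y e1 e2 J 1.
Variables (z0 z1 : 'I_n).
Hypothesis z01 : z0 != z1.
Local Notation zr s := ((s == z0) || (s == z1)).
Hypothesis zrP : forall s, zr s = (X s == 0) && (Y s == 0).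
Hypothesis simple : forall s t, X s = X t -> Y s = Y t -> ~~ zr s -> s = t.
Implicit Types (a b u v w : 'cV[K]_n).
Local Notation Z := (centr (gform J) e1 e2).
Local Notation dl s := (delta_mx s 0 : 'cV[K]_n).
Local Notation det u v := (u z0 0 * v z1 0 - u z1 0 * v z0 0).

Definition in_V0 u := forall s, u s 0 != 0 -> zr s.

Let JT1 : J^T = J. Proof. by rewrite (fd_JT F) scale1r. Qed.

Lemma hvec_single x y w i : hvec X Y x y w -> w i 0 != 0 -> ~~ zr i -> w = w i 0 *: dl i.
Proof.
move=> hw wi zi; apply/matrixP=> s t; rewrite ord1 mxE mxE eqxx andbT.
have [->|si] := eqVneq s i; first by rewrite mulr1.
rewrite mulr0; apply/eqP/negPn/negP=> ws; case/eqP: si.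
have [[Xs Ys] [Xi Yi]] := (hw _ ws, hw _ wi).
by apply/esym/simple; rewrite ?Xs ?Ys.
Qed.

Lemma col_neq0 w : w != 0 -> exists i, w i 0 != 0.
Proof.
move=> w0; apply/existsP; apply: contraNT w0; rewrite negb_exists => /forallP h.
by apply/eqP/matrixP=> i j; rewrite ord1 mxE; apply/eqP; have := h i; rewrite negbK.
Qed.

Lemma parallel u v : in_V0 u -> in_V0 v -> u != 0 -> det u v = 0 -> exists c, v = c *: u.
Proof.
move=> su sv /col_neq0[i ui] /eqP; rewrite subr_eq0 => /eqP d0.
exists (v i 0 / u i 0); apply/matrixP=> s t; rewrite ord1 mxE; apply: (mulIf ui).
rewrite mulrAC divfK //; have [zs|zs] := boolP (zr s); last first.
  have -> : v s 0 = 0 by apply/eqP; apply: contraNT zs => /sv.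
  by have -> : u s 0 = 0; [apply/eqP; apply: contraNT zs => /su|rewrite mul0r mulr0].
case/orP: (su _ ui) => /eqP -> ; case/orP: zs => /eqP -> //; first by rewrite mulrC d0 mulrC.
by rewrite mulrC -d0 mulrC.
Qed.

(** The weight sent to zero by a homogeneous [e] of nonzero degree is simple, so a single column [a]
    enters the zero weight space; [a] is zero if none does. *)
Definition zero_col (e : 'M[K]_n) a := in_V0 a /\
  forall s, (exists2 i, zr i & e i s != 0) -> e *m dl s = a.

Lemma zero_colP e p q : homog X Y p q e -> (p != 0) || (q != 0) ->
  exists2 a, zero_col e a & a != 0 -> exists s, [/\ X s = - p, Y s = - q, ~~ zr s & e *m dl s = a].
Proof.
move=> he pq.
have wt s i : zr i -> e i s != 0 -> [/\ X s = - p, Y s = - q & ~~ zr s].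
  rewrite !zrP => /andP[/eqP Xi /eqP Yi] /he[Xis Yis].
  have Xs : X s = - p by lra.
  have Ys : Y s = - q by lra.
  by rewrite Xs Ys !oppr_eq0 negb_and.
have [s /existsP[i /andP[zi eis]]|no] :=
    pickP [pred s | [exists i, (zr i) && (e i s != 0)]]; last first.
  exists 0; last by rewrite eqxx.
  split=> [s|s [i zi ei]]; first by rewrite mxE eqxx.
  by have /= /existsP[] := no s; exists i; rewrite zi ei.
have [Xs Ys zs] := wt _ _ zi eis; exists (e *m dl s); last by exists s.
split=> [t|t [i' zi' eit]].
  rewrite -colE mxE => /he[Xt Yt]; rewrite zrP Xt Yt Xs Ys.
  by rewrite !addNr !eqxx.
have [Xt Yt zt] := wt _ _ zi' eit.
by rewrite (simple _ _ zt (t := s)) ?Xs ?Ys.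
Qed.

Lemma good_colsl e a u v c : zero_col e a -> a = c *: u -> good_cols z0 z1 u v e.
Proof.
move=> [_ ha] ac s zs; have [/existsP[i /andP[zi ei]]|] := boolP [exists i, zr i && (e i s != 0)].
  by constructor 1; exists c; rewrite -ac; apply: ha; exists i.
rewrite negb_exists => /forallP h; constructor 3 => i zi.
by apply/eqP; have := h i; rewrite zi /= negbK.
Qed.

Lemma good_colsr e a u v c : zero_col e a -> a = c *: v -> good_cols z0 z1 u v e.
Proof.
move=> ha ac s zs; case: (good_colsl u ha ac zs) => [[d ed]|[d ed]|h].
- by constructor 2; exists d.
- by constructor 1; exists d.
- by constructor 3.
Qed.

Definition qf u v := (u^T *m J *m v) 0 0.

Lemma qf_sym u v : qf u v = qf v u.
Proof.
rewrite /qf; have -> : u^T *m J *m v = (v^T *m J *m u)^T by rewrite !trmx_mul JT1 trmxK mulmxA.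
by rewrite mxE.
Qed.

Lemma qfD u v w c : qf u (v + c *: w) = qf u v + c * qf u w.
Proof. by rewrite /qf mulmxDr -scalemxAr [LHS]mxE [X in _ + X]mxE. Qed.

Lemma conj_formE (P : 'M[K]_n) i j : (P^T *m J *m P) i j = qf (P *m dl i) (P *m dl j).
Proof.
rewrite /qf trmx_mul trmx_delta !mulmxA -colE [RHS]mxE -!mulmxA -rowE [RHS]mxE.
by [].
Qed.

Lemma qf_nondeg u : in_V0 u -> u != 0 -> exists2 t, zr t & qf (dl t) u != 0.
Proof.
move=> su u0; have /col_neq0[t Jt] : J *m u != 0.
  by apply: contraNneq u0 => J0; rewrite -(mulKmx (fd_Ju F) u) J0 mulmx0.
exists t; last by rewrite /qf -mulmxA trmx_delta -rowE mxE.
move: Jt; rewrite mxE => nz; have [s] : exists s, J t s * u s 0 != 0.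
  apply/existsP; apply: contraNT nz; rewrite negb_exists => /forallP h.
  by rewrite big1 // => s _; apply/eqP; have := h s; rewrite negbK.
rewrite mulf_eq0 negb_or => /andP[/(fd_J F)[Xt Yt] /su]; rewrite !zrP => /andP[/eqP Xs /eqP Ys].
by apply/andP; split; apply/eqP; lra.
Qed.

Lemma in_V0_delta t : zr t -> in_V0 (dl t).
Proof. by move=> zt s; rewrite mxE eqxx andbT; have [->|_] := eqVneq s t; rewrite ?eqxx. Qed.

Lemma in_V0_comb v w c : in_V0 v -> in_V0 w -> in_V0 (v + c *: w).
Proof.
move=> hv hw s; rewrite !mxE; have [v0|/hv //] := eqVneq (v s 0) 0.
by rewrite v0 add0r mulf_eq0 negb_or => /andP[_ /hw].
Qed.

(** If [u] is isotropic, it is completed to an isotropic basis. Otherwise a vector orthogonal to [u]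
    is reached by neither [e1] nor [e2], hence by skewness killed by both, and forms a chain of
    length zero, whence [k = 0]. *)
Lemma dependent_abelian a b u c d : (2 < n)%N -> zero_col e1 a -> zero_col e2 b ->
  in_V0 u -> u != 0 -> a = c *: u -> b = d *: u ->
  {in Z &, forall A B, A *m B = B *m A}.
Proof.
move=> n2 ha hb su u0 ac bd.
have det_sym v w : det v w != 0 -> det w v != 0.
  by apply: contraNneq => E; rewrite -oppr_eq0 opprB -E; apply/eqP; ring.
have [quu|quu] := eqVneq (qf u u) 0.
  have [t zt qtu] := qf_nondeg su u0.
  have two : 2%:R != 0 :> K by rewrite ((pcharf0P K).1 char0).
  (* Chosen so that [dl t + k *: u] is isotropic, given that [u] is. *)
  pose k := - (qf (dl t) (dl t) / (2%:R * qf (dl t) u)).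
  pose v := dl t + k *: u.
  have sv : in_V0 v by apply: in_V0_comb => //; apply: in_V0_delta.
  have quv : qf u v = qf (dl t) u by rewrite qfD quu mulr0 addr0 qf_sym.
  have qvv : qf v v = 0.
    rewrite qfD [qf v u]qf_sym quv /v qf_sym qfD -/v (qf_sym (dl t)) /k.
    rewrite -/v [qf u (dl t)]qf_sym; field.
    by rewrite two qtu.
  have duv : det u v != 0.
    apply/eqP=> /(parallel su sv u0)[m vm].
    by case/eqP: qtu; rewrite -quv vm -[m *: u]add0r qfD quu mulr0 /qf mulmx0 mxE addr0.
  apply: (isotropic_abelian char0 F z01 zrP simple su sv duv _ _ _ n2).
  - by left; rewrite !conj_formE (adapted_colu) // (adapted_colv z01).
  - exact: (good_colsl v ha ac).
  - exact: (good_colsl v hb bd).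
  - by rewrite conj_formE adapted_colu.
  - by rewrite conj_formE (adapted_colv z01).
have [t zt duy] : exists2 t, zr t & det (dl t) u != 0.
  have [u00|u00] := eqVneq (u z0 0) 0; last first.
    exists z1; first by rewrite eqxx orbT.
    by rewrite !mxE !eqxx (negPf z01) /= mul0r sub0r mul1r oppr_eq0.
  exists z0; first by rewrite eqxx.
  rewrite !mxE !eqxx [z1 == z0]eq_sym (negPf z01) /= mul1r mul0r subr0.
  have [i ui] := col_neq0 u0.
  by case/orP: (su _ ui) => /eqP E; move: ui; rewrite E ?u00 ?eqxx.
pose k := - (qf u (dl t) / qf u u); pose v := dl t + k *: u.
have sv : in_V0 v by apply: in_V0_comb => //; apply: in_V0_delta.
have quv : qf u v = 0 by rewrite qfD /k mulNr divfK // subrr.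
have dvu : det v u != 0.
  rewrite (_ : det v u = det (dl t) u) // /v; move: (dl t) => y.
  by rewrite !mxE; ring.
have gc1 := good_colsr v ha ac; have gc2 := good_colsr v hb bd.
have bf : block_form J z0 z1 v u.
  by right; rewrite conj_formE adapted_colu (adapted_colv z01) qf_sym.
have Pu := adapted_unit z01 sv su dvu.
have F' := fdata_conj Pu (adapted_homog zrP sv su) F.
have J01 : ((adapted z0 z1 v u)^T *m J *m adapted z0 z1 v u) z0 z1 = 0.
  by rewrite conj_formE adapted_colu (adapted_colv z01) qf_sym.
have zz0 : zr z0 by rewrite eqxx.
have frow e p q : homog X Y p q e -> (p != 0) || (q != 0) -> good_cols z0 z1 v u e ->
    (exists a d, zero_col e a /\ a = d *: u) ->
    forall s, conj_mx (adapted z0 z1 v u) e z0 s = 0.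
  move=> he pq gc [a' [d' [ha' ad']]] s; apply/eqP/negPn/negP=> nz.
  have hf : homog X Y p q (conj_mx (adapted z0 z1 v u) e).
    move=> i j /mulmx_neq0[y /mulmx_neq0[x]].
    move=> /(homog_invmx Pu (adapted_homog zrP sv su))[Xx Yx] /he[Xxy Yxy].
    move=> /(adapted_homog zrP sv su)[Xy Yy].
    by rewrite !addr0 in Xx Yx Xy Yy; split; lra.
  have zs : ~~ zr s.
    have [XX YY] := hf _ _ nz; apply/negP; rewrite zrP => /andP[/eqP Xs /eqP Ys].
    have := zrP z0; rewrite zz0 => /esym/andP[/eqP X0 /eqP Y0].
    by move: pq; apply/negP; rewrite negb_or !negbK; apply/andP; split; apply/eqP; lra.
  have [/existsP[i /andP[zi ei]]|] := boolP [exists i, zr i && (e i s != 0)].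
    have es : e *m dl s = a' by apply: (ha'.2); exists i.
    have := conj_col (w := d' *: dl z1) z01 sv su dvu zs.
    move=> /(_ e); rewrite -scalemxAr (adapted_colv z01) -ad' => /(_ es) E.
    move/eqP: nz; apply; have := congr1 (fun w : 'cV_n => w z0 0) E => /=.
    by rewrite -colE !mxE (negPf z01) mulr0.
  rewrite negb_exists => /forallP h; move/eqP: nz; apply.
  apply: (conj_col0 z01 zrP sv su dvu zs _ zz0) => i zi.
  by apply/eqP; have := h i; rewrite zi /= negbK.
have f1r := frow _ _ _ (fd_h1 F) _ gc1; have f2r := frow _ _ _ (fd_h2 F) _ gc2.
have {}f1r : forall s, conj_mx (adapted z0 z1 v u) e1 z0 s = 0.
  by apply: f1r; [rewrite oner_eq0|exists a, c].
have {}f2r : forall s, conj_mx (adapted z0 z1 v u) e2 z0 s = 0.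
  by apply: f2r; [rewrite oner_eq0 orbT|exists b, d].
have Jp := adapted_pinjJ F z01 zrP simple sv su dvu bf.
apply: (orthogonal_abelian char0 F z01 zrP simple sv su dvu bf gc1 gc2 (r := z0) (k := 0) J01).
- by apply/forallP=> s; rewrite f1r f2r eqxx.
- by rewrite ple00.
move=> s; apply/eqP/negPn/negP=> nz.
have := gform_entry (fd_JT F') (fd_Ju F') Jp s z0 (fd_e2 F').
have dz : dual ((adapted z0 z1 v u)^T *m J *m adapted z0 z1 v u) z0 = z0.
  have := J_dual (fd_Ju F') z0; have := dual_zr F z01 zrP sv su dvu zz0.
  by case/orP=> /eqP ->; rewrite ?J01 ?eqxx.
rewrite dz f2r mulr0 oppr0 => /eqP; rewrite mulf_eq0 (negPf nz).
by rewrite (negPf (J_dual (fd_Ju F') s)).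
Qed.

Lemma hvec_pow e p q s m : homog X Y p q e ->
  hvec X Y (X s + p *+ m) (Y s + q *+ m) (e ^+ m *m dl s).
Proof. by move=> he; apply: hvec_mul (homogX he) _; apply: hvec_delta. Qed.

Lemma mulmx_col0 (e : 'M[K]_n) s : (forall t, e t s = 0) -> e *m dl s = 0.
Proof. by move=> h; apply/matrixP=> t i; rewrite ord1 -colE !mxE h. Qed.

Lemma powC m : e1 ^+ m *m e2 = e2 *m e1 ^+ m.
Proof. by apply: esym; apply: (@commrX _ e2 e1 m); apply/esym/(fd_comm F). Qed.

(** The weights are bounded, so there is a largest [k], which excludes a preimage of [s] under [e1].
    A preimage under [e2] would make a nonzero multiple of [a] an image of [e2], hence a multiple of
    [b], against independence. *)
Lemma row_generator a b s1 : zero_col e2 b -> det a b != 0 ->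
  X s1 = -1 -> Y s1 = 0 -> e1 *m dl s1 = a ->
  exists s k, [/\ (0 < k)%N, X s = - k%:R /\ Y s = 0, forall t, e1 s t = 0,
    forall t, e2 s t = 0 & exists2 c, c != 0 & e1 ^+ k *m dl s = c *: a].
Proof.
move=> hb dab Xs1 Ys1 es1.
have a0 : a != 0.
  by apply: contraNneq dab => ->; rewrite !mxE !mul0r subrr.
have zs1 : ~~ zr s1 by rewrite zrP Xs1 oppr_eq0 oner_eq0.
pose Q k := (0 < k)%N &&
  [exists s, [&& X s == - k%:R, Y s == 0 & e1 ^+ k *m dl s != 0]].
have Q1 : exists k, Q k.
  by exists 1%N; apply/existsP; exists s1; rewrite Xs1 Ys1 !eqxx expr1 es1 a0.
have [m bound] := abs_le_bound X.
have Qm k : Q k -> (k <= m)%N.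
  case/andP=> _ /existsP[s /and3P[/eqP Xs _ _]]; rewrite -(ler_nat rat).
  by have := bound s; rewrite Xs normrN ger0_norm.
case: (ex_maxnP Q1 Qm) => k /andP[k0 /existsP[s /and3P[/eqP Xs /eqP Ys nz]]] kmax.
have zs : ~~ zr s by rewrite zrP Xs oppr_eq0 pnatr_eq0 eqn0Ngt k0.
have [c c0 ec] : exists2 c, c != 0 & e1 ^+ k *m dl s = c *: a.
  case: k k0 Xs nz kmax => // k _ Xs nz _; move: nz; rewrite exprS -mulmxE -mulmxA.
  have hw := hvec_pow (s := s) (m := k) (fd_h1 F); set w := e1 ^+ k *m dl s in hw * => nz.
  have [i wi] : exists i, w i 0 != 0.
    by apply: col_neq0; apply: contraNneq nz => ->; rewrite mulmx0.
  have [Xi Yi] := hw _ wi; rewrite mul0rn addr0 Ys in Yi; rewrite Xs in Xi.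
  have si : i = s1.
    by apply/esym/simple; rewrite ?Xs1 ?Ys1 ?Yi // Xi -natr1; ring.
  exists (w i 0) => //; rewrite [w in LHS](hvec_single hw wi) ?si //.
  by rewrite -scalemxAr es1.
exists s, k; split=> //; last by exists c.
- move=> t; apply/eqP/negPn/negP=> st; have [Xt Yt] := fd_h1 F st.
  suff : (k.+1 <= k)%N by rewrite ltnn.
  apply: kmax; apply/existsP; exists t; apply/and3P; split.
  + by apply/eqP; rewrite -natr1; lra.
  + by apply/eqP; lra.
  have et : e1 *m dl t = e1 s t *: dl s.
    have hw := hvec_mul (fd_h1 F) (@hvec_delta K n X Y t).
    have nzs : (e1 *m dl t) s 0 != 0 by rewrite -colE mxE.
    by rewrite [LHS](hvec_single hw nzs zs) -colE mxE.
  rewrite exprSr -mulmxE -mulmxA et -scalemxAr ec scalerA.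
  by rewrite scaler_eq0 negb_or mulf_neq0.
move=> t; apply/eqP/negPn/negP=> st; have [Xt Yt] := fd_h2 F st.
have et : e2 *m dl t = e2 s t *: dl s.
  have hw := hvec_mul (fd_h2 F) (@hvec_delta K n X Y t).
  have nzs : (e2 *m dl t) s 0 != 0 by rewrite -colE mxE.
  by rewrite [LHS](hvec_single hw nzs zs) -colE mxE.
have E : e2 *m (e1 ^+ k *m dl t) = (e2 s t * c) *: a.
  by rewrite mulmxA -powC -mulmxA et -scalemxAr ec scalerA.
have hw := hvec_pow (s := t) (m := k) (fd_h1 F); set w := e1 ^+ k *m dl t in hw E.
have nE : (e2 s t * c) *: a != 0 by rewrite scaler_eq0 negb_or a0 andbT mulf_neq0.
have [i wi] : exists i, w i 0 != 0.
  by apply: col_neq0; apply: contraNneq nE => w0; rewrite -E w0 mulmx0.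
have [Xi Yi] := hw _ wi; rewrite mul0rn addr0 in Yi.
have zi : ~~ zr i by rewrite zrP negb_and; apply/orP; right; apply/eqP; lra.
rewrite (hvec_single hw wi zi) -scalemxAr in E.
have [j aj] := col_neq0 a0.
have ej : e2 j i != 0.
  apply: contraNneq nE => ej; move/matrixP/(_ j 0): E; rewrite [LHS]mxE -colE [X in _ * X]mxE.
  rewrite ej mulr0 mxE => /esym/eqP; rewrite mulf_eq0 (negPf aj) orbF.
  by move=> /eqP ->; rewrite scale0r.
have zj : zr j.
  have [Xj Yj] := fd_h2 F ej; rewrite zrP; apply/andP; split; apply/eqP; last by lra.
  have := Xi; rewrite -mulr_natl mulr1; lra.
have ei : e2 *m dl i = b by apply: hb.2; exists j.
move: E; rewrite ei => E; case/eqP: dab.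
have ab t' : (e2 s t * c) * a t' 0 = w i 0 * b t' 0.
  by move/matrixP/(_ t' 0): E; rewrite !mxE => ->.
apply: (mulfI (mulf_neq0 st c0)); rewrite mulr0 mulrBr !mulrA !ab -!mulrA.
by rewrite (mulrC (b z0 0)) subrr.
Qed.

(** The dual [Q] of [s] is a sink, and the dual [N] of the basis vector reached by [e2] from [s] is
    sent by [e2] to a multiple of [Q]. Wedge [Q] with the last nonzero [e1^l] image of [N]: [e1]
    kills both factors, and [e2] makes them proportional. *)
Lemma negative_element s k : (0 < k)%N -> X s = - k%:R -> Y s = 0 -> (forall t, e1 s t = 0) ->
  (forall t, e2 s t = 0) -> e2 *m dl s != 0 ->
  exists C d, [/\ C \in Z, C != 0, homog X Y d (-1) C & 0 <= d].
Proof.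
move=> k0 Xs Ys e1s e2s e2n.
have Ju := fd_Ju F.
have kn0 : k%:R != 0 :> rat by rewrite pnatr_eq0 -lt0n.
have [Q JsQ] := unitmx_row s Ju; have [XQ YQ] := fd_J F JsQ.
have zs : ~~ zr s by rewrite zrP Xs oppr_eq0 (negPf kn0).
have zQ : ~~ zr Q.
  by rewrite zrP negb_and; apply/orP; left; apply/eqP=> XQ0; case/eqP: kn0; lra.
have sQ e : e \in gform J -> (forall t, e s t = 0) -> e *m dl Q = 0.
  move=> /gformP ge es; suff J0 : J *m (e *m dl Q) = 0 by rewrite -(mulKmx Ju (e *m dl Q)) J0 mulmx0.
  rewrite mulmxA; have -> : J *m e = - (e^T *m J) by rewrite ge opprK.
  rewrite mulNmx; apply/eqP; rewrite oppr_eq0; apply/eqP; apply: mulmx_col0 => t.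
  rewrite mxE big1 // => u _; rewrite mxE.
  have [->|/eqP /(fd_J F)[Xu Yu]] := J u Q =P 0; first by rewrite mulr0.
  have us : s = u by apply: simple => //; lra.
  by rewrite -us es mul0r.
have [e1Q e2Q] := (sQ _ (fd_e1 F) e1s, sQ _ (fd_e2 F) e2s).
have [w] := col_neq0 e2n; rewrite -colE mxE => ws.
have [Xw Yw] := fd_h2 F ws.
have zw : ~~ zr w by rewrite zrP negb_and; apply/orP; right; apply/eqP; lra.
have [N JwN] := unitmx_row w Ju; have [XN YN] := fd_J F JwN.
have e2QN : e2 Q N != 0.
  have : (e2^T *m J) s N != 0.
    rewrite mxE (bigD1 w) //= big1 ?addr0 => [|u uw]; first by rewrite mxE mulf_neq0.
    rewrite mxE; have [->|/eqP/(fd_h2 F)[Xu Yu]] := e2 u s =P 0; first by rewrite mul0r.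
    by case/eqP: uw; apply/esym/simple; rewrite ?Xu ?Yu.
  have /gformP -> := fd_e2 F; rewrite mxE oppr_eq0 => /mulmx_neq0[u /(fd_J F)[Xu Yu]].
  by have -> : Q = u by apply: simple => //; lra.
have e2N : e2 *m dl N = e2 Q N *: dl Q.
  have hw := hvec_mul (fd_h2 F) (@hvec_delta K n X Y N).
  have nzs : (e2 *m dl N) Q 0 != 0 by rewrite -colE mxE.
  by rewrite [LHS](hvec_single hw nzs zQ) -colE mxE.
have [m bound] := abs_le_bound X.
have ex : exists l, e1 ^+ l *m dl N == 0.
  exists (m + m).+1; apply/negPn/negP=> /col_neq0[i /(hvec_pow (fd_h1 F))[Xi _]].
  have := bound i; have := bound N; rewrite !ler_norml => /andP[? ?] /andP[? ?].
  by move: Xi; rewrite -mulr_natl mulr1 -natr1 natrD; lra.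
case: (ex_minnP ex) => l /eqP el lmin.
case: l el lmin => [|l] el lmin.
  by move/matrixP/(_ N 0): el; rewrite expr0 -idmxE mul1mx !mxE !eqxx => /eqP; rewrite oner_eq0.
have vn : e1 ^+ l *m dl N != 0 by apply/negP=> /lmin; rewrite ltnn.
have hv := hvec_pow (s := N) (m := l) (fd_h1 F); set v := e1 ^+ l *m dl N in vn hv.
have e1v : e1 *m v = 0 by rewrite mulmxA mulmxE -exprS.
have [c e2v] : exists c, e2 *m v = c *: dl Q.
  have E : e2 *m v = e2 Q N *: (e1 ^+ l *m dl Q).
    by rewrite mulmxA -powC -mulmxA e2N -scalemxAr.
  case: l {el lmin vn hv e1v} @v E => [|l] v ->.
    by exists (e2 Q N); rewrite expr0 -idmxE mul1mx.
  by exists 0; rewrite exprSr -mulmxE -mulmxA e1Q mulmx0 scaler0 scale0r.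
have XQk : X Q = k%:R by lra.
clearbody v; exists (wedge J (dl Q) v), (X Q + (X N + 1 *+ l)); split.
- have a1 : admx e1 (wedge J (dl Q) v) = 0.
    by rewrite wedge_act ?(fd_e1 F) // e1Q e1v wedge0l wedge0r addr0.
  have a2 : admx e2 (wedge J (dl Q) v) = 0.
    by rewrite wedge_act ?(fd_e2 F) // e2Q e2v wedge_scale wedge0l addr0.
  apply/centrP; split; first exact: wedge_gform.
    by apply/eqP; rewrite eq_sym -admx_eq0 a1.
  by apply/eqP; rewrite eq_sym -admx_eq0 a2.
- have [i vi] := col_neq0 vn; have [Xi Yi] := hv _ vi.
  apply/negP=> /eqP/(congr1 (mulmxr (invmx J))); rewrite /= mul0mx /wedge mulmxK //.
  have vQ : v Q 0 = 0.
    apply/eqP/negPn/negP=> /hv[XX YY]; have := ler0n rat l; rewrite mul0rn addr0 in YY.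
    by lra.
  move/matrixP/(_ Q i); rewrite [LHS]mxE [X in X + _]mxE [X in _ + X]mxE [X in - X]mxE.
  rewrite !big_ord1 !mxE !eqxx vQ mul1r mul0r subr0 => E.
  by rewrite E eqxx in vi.
- have := wedge_homog (fd_J F) (@hvec_delta K n X Y Q) hv; rewrite mul0rn addr0.
  by rewrite (_ : Y Q + Y N = -1); [|lra].
have := ler0n rat l; have := ler0n rat k; rewrite -mulr_natl mulr1; lra.
Qed.

(* Leading terms of the form algebra restricted to the entries of nonnegative
   degree already have dimension [n./2] in [Z]. *)
Lemma two_negative_absurd C1 C2 d1 d2 : C1 \in Z -> C2 \in Z -> C1 != 0 -> C2 != 0 ->
  homog X Y d1 (-1) C1 -> homog X Y (-1) d2 C2 -> 0 <= d1 -> False.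
Proof.
move=> Z1 Z2 n1 n2 h1 h2 d10.
pose S (t s : 'I_n) := (X t <= X s) && (Y t <= Y s).
pose A := (gform J :&: lker (linfun (@offpart K n S)))%VS.
have AP B : B \in A -> B \in gform J /\ forall s t, B s t != 0 -> X t <= X s /\ Y t <= Y s.
  rewrite memv_cap => /andP[->]; rewrite memv_ker lfunE /= => /offpart_eq0 h.
  by split=> // s t /h/andP.
have AI B : B \in gform J -> (forall s t, B s t != 0 -> X t <= X s /\ Y t <= Y s) -> B \in A.
  move=> gB h; rewrite memv_cap gB memv_ker lfunE /=; apply/offpart_eq0=> s t /h[? ?].
  by apply/andP.
have stable e p q : homog X Y p q e -> 0 <= p -> 0 <= q -> e \in gform J ->
    forall B, B \in A -> admx e B \in A.
  move=> he p0 q0 ge B /AP[gB hB]; apply: AI; first exact: gform_admx.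
  move=> s t; rewrite admxE => nz.
  have : ((e *m B) s t != 0) || ((B *m e) s t != 0).
    by apply: contraNT nz; rewrite negb_or !negbK => /andP[/eqP -> /eqP ->]; rewrite subr0.
  by case/orP=> /mulmx_neq0[u]; [move=> /he[? ?] /hB[? ?]|move=> /hB[? ?] /he[? ?]]; split; lra.
have dA := fd_symbol char0 F (subxx _) (capvSl _ _ : (A <= gform J)%VS) _
  (stable _ _ _ (fd_h1 F) ler01 (lexx _) (fd_e1 F)) (stable _ _ _ (fd_h2 F) (lexx _) ler01 (fd_e2 F)).
have {}dA : (n./2 <= \dim (A :&: Z))%N.
  apply: leq_trans (fd_half_pairs_ge F) (dA _) => u; rewrite inE => /andP[/woppP[Xu Yu] _].
  apply: AI; first exact: (bivJ_in_gform F).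
  by move=> s t /(bivJ_homog_gr F)[-> ->]; rewrite Xu Yu !addr0.
have nzP (B : 'M[K]_n) : B != 0 -> exists s t, B s t != 0.
  move=> nB; have [[s t] /= st|no] := pickP (fun u : 'I_n * 'I_n => B u.1 u.2 != 0).
    by exists s, t.
  case/eqP: nB; apply/matrixP=> s t; rewrite mxE; apply/eqP.
  by have := no (s, t); rewrite /= => /negbFE.
have [[s1 [t1 st1]] [s2 [t2 st2]]] := (nzP _ n1, nzP _ n2).
have v1 B : B \in (A :&: Z)%VS -> B s1 t1 = 0.
  rewrite memv_cap => /andP[/AP[_ hB] _]; apply/eqP/negPn/negP=> /hB[_ Y1].
  by have [_ Y2] := h1 _ _ st1; lra.
have v2 B : B \in (A :&: Z)%VS -> B s2 t2 = 0.
  rewrite memv_cap => /andP[/AP[_ hB] _]; apply/eqP/negPn/negP=> /hB[X1 _].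
  by have [X2 _] := h2 _ _ st2; lra.
have v12 : C1 s2 t2 = 0.
  by apply/eqP/negPn/negP=> /h1[X1 _]; have [X2 _] := h2 _ _ st2; lra.
have sub : ((A :&: Z) + <[C1]> + <[C2]> <= Z)%VS.
  by rewrite !subv_add -!memvE Z1 Z2 !andbT; apply: capvSr.
have := leq_trans (dimvS sub) (fd_dim F).
rewrite (dim_add_line (entry_add_line v2 v12) st2) (dim_add_line v1 st1) ltnS.
by move/leq_trans/(_ dA); rewrite ltnn.
Qed.

(** [e2] kills [s], hence [a]; as [b] is in the image of the skew [e2], the vectors [a] and [b] are
    orthogonal, and the row from [s] is the chain that splits off. *)
Lemma column_split_abelian a b s k c t1 : zero_col e1 a -> zero_col e2 b -> det a b != 0 ->
  e2 *m dl t1 = b -> (0 < k)%N -> X s = - k%:R -> (forall t, e1 s t = 0) ->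
  (forall t, e2 s t = 0) -> c != 0 -> e1 ^+ k *m dl s = c *: a -> e2 *m dl s = 0 ->
  {in Z &, forall A B, A *m B = B *m A}.
Proof.
move=> ha hb dab et1 k0 Xs e1s e2s c0 ec e2n.
have zs : ~~ zr s by rewrite zrP Xs oppr_eq0 pnatr_eq0 eqn0Ngt k0.
have [su sv] := (ha.1, hb.1).
have e2a : e2 *m a = 0.
  have : c *: (e2 *m a) = 0 by rewrite scalemxAr -ec mulmxA -powC -mulmxA e2n mulmx0.
  by move/eqP; rewrite scaler_eq0 (negPf c0) => /eqP.
have qab : qf a b = 0.
  rewrite /qf -et1 -mulmxA; have /gformP g2 := fd_e2 F.
  have -> : J *m (e2 *m dl t1) = - (e2^T *m J *m dl t1) by rewrite g2 mulNmx opprK mulmxA.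
  by rewrite mulmxN !mulmxA -trmx_mul e2a trmx0 !mul0mx oppr0 mxE.
have Pu := adapted_unit z01 su sv dab.
have gc1 : good_cols z0 z1 a b e1 by apply: (good_colsl (c := 1) b ha); rewrite scale1r.
have gc2 : good_cols z0 z1 a b e2 by apply: (good_colsr (c := 1) a hb); rewrite scale1r.
have J01 : ((adapted z0 z1 a b)^T *m J *m adapted z0 z1 a b) z0 z1 = 0.
  by rewrite conj_formE adapted_colu (adapted_colv z01).
apply: (orthogonal_abelian char0 F z01 zrP simple su sv dab (or_intror J01) gc1 gc2
  (r := s) (k := k) J01).
- apply/forallP=> t; rewrite (conj_row z01 zrP simple su sv dab zs e1s).
  by rewrite (conj_row z01 zrP simple su sv dab zs e2s) eqxx.
- rewrite pleE monoE expr0 mulmx1 conj_mxX //.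
  have ec' : e1 ^+ k *m dl s = adapted z0 z1 a b *m (c *: dl z0).
    by rewrite -scalemxAr adapted_colu.
  have := congr1 (fun w : 'cV_n => w z0 0) (conj_col z01 su sv dab zs ec') => /=.
  by rewrite -colE mxE => ->; rewrite !mxE !eqxx mulr1.
move=> t; have e0 : e2 *m dl s = adapted z0 z1 a b *m 0 by rewrite mulmx0.
have := congr1 (fun w : 'cV_n => w t 0) (conj_col z01 su sv dab zs e0) => /=.
by rewrite -colE mxE => ->; rewrite mxE.
Qed.

End DoubleZero.

Lemma double_zero_abelian (K : fieldType) n (X Y : 'I_n -> rat) (e1 e2 J : 'M[K]_n)
    (z0 z1 : 'I_n) :
  [pchar K] =i pred0 -> fdata X Y e1 e2 J 1 -> (2 < n)%N -> z0 != z1 ->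
  (forall s, (s == z0) || (s == z1) = (X s == 0) && (Y s == 0)) ->
  (forall s t, X s = X t -> Y s = Y t -> ~~ ((s == z0) || (s == z1)) -> s = t) ->
  {in centr (gform J) e1 e2 &, forall A B, A *m B = B *m A}.
Proof.
move=> char0 F n2 z01 zrP simple; have F' := fdataC F.
have zrP' s : (s == z0) || (s == z1) = (Y s == 0) && (X s == 0) by rewrite zrP andbC.
have simple' s t : Y s = Y t -> X s = X t -> ~~ ((s == z0) || (s == z1)) -> s = t.
  by move=> ? ?; apply: simple.
have n1 : (1 != 0 :> rat) || (0 != 0 :> rat) by rewrite oner_eq0.
have n1' : (0 != 0 :> rat) || (1 != 0 :> rat) by rewrite oner_eq0 orbT.
have [a ha hs] := zero_colP zrP simple (fd_h1 F) n1.
have [b hb ht] := zero_colP zrP simple (fd_h2 F) n1'.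
have [d0|dab] := eqVneq (a z0 0 * b z1 0 - a z1 0 * b z0 0) 0.
  have dep := dependent_abelian char0 F z01 zrP simple n2 ha hb.
  have [a0|a0] := eqVneq a 0; last first.
    have [d bd] := parallel ha.1 hb.1 a0 d0.
    by apply: (dep a 1 d ha.1 a0 _ bd); rewrite scale1r.
  have [b0|b0] := eqVneq b 0; last first.
    by apply: (dep b 0 1 hb.1 b0); rewrite ?scale0r ?scale1r.
  have zz : (z0 == z0) || (z0 == z1) by rewrite eqxx.
  apply: (dep _ 0 0 (in_V0_delta zz)); rewrite ?scale0r //.
  by apply/eqP=> /matrixP/(_ z0 0)/eqP; rewrite !mxE !eqxx oner_eq0.
have dba : b z0 0 * a z1 0 - b z1 0 * a z0 0 != 0.
  by apply: contraNneq dab => E; rewrite -oppr_eq0 -E; apply/eqP; ring.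
have a0 : a != 0 by apply: contraNneq dab => ->; rewrite !mxE !mul0r subrr.
have b0 : b != 0 by apply: contraNneq dab => ->; rewrite !mxE !mulr0 subrr.
have [s1 [Xs1 Ys1 _ es1]] := hs a0; have [t1 [Xt1 Yt1 _ et1]] := ht b0.
rewrite oppr0 in Ys1 Xt1.
have [s [k [k0 [Xs Ys] e1s e2s [c c0 ec]]]] := row_generator F zrP simple hb dab Xs1 Ys1 es1.
have [t [l [l0 [Yt Xt] e2t e1t [d dn ed]]]] := row_generator F' zrP' simple' ha dba Yt1 Xt1 et1.
have [e2n|e2n] := eqVneq (e2 *m (delta_mx s 0 : 'cV_n)) 0.
  exact: (column_split_abelian char0 F z01 zrP simple ha hb dab et1 k0 Xs e1s e2s c0 ec e2n).
have [e1n|e1n] := eqVneq (e1 *m (delta_mx t 0 : 'cV_n)) 0.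
  rewrite centrC.
  exact: (column_split_abelian char0 F' z01 zrP' simple' hb ha dba es1 l0 Yt e2t e1t dn ed e1n).
have [C1 [d1 [Z1 n1C h1 d10]]] := negative_element F zrP simple k0 Xs Ys e1s e2s e2n.
have [C2 [d2 [Z2 n2C h2 d20]]] := negative_element F' zrP' simple' l0 Yt Xt e2t e1t e1n.
rewrite centrC in Z2; have h2' : homog X Y (-1) d2 C2 by move=> i j /h2[].
by case: (two_negative_absurd char0 F Z1 Z2 n1C n2C h1 h2' d10).
Qed.

Lemma fdata_abelian (K : fieldType) n (X Y : 'I_n -> rat) (e1 e2 J : 'M[K]_n) eps :
  [pchar K] =i pred0 -> fdata X Y e1 e2 J eps -> (eps = 1 -> (2 < n)%N) ->
  {in centr (gform J) e1 e2 &, forall A B, A *m B = B *m A}.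
Proof.
move=> char0 F n2; case: (weights_cases char0 F) => [inj|[e S2 simple]].
  exact: (form_injective_abelian char0 F n2 inj).
move: F n2; rewrite e => F /(_ erefl) n2.
have /cards2P[z0 [z1 [z01 SE]]] : #|[set s | s \in wopp X Y s]| == 2%N by rewrite S2.
have S0E s : (s \in [set s | s \in wopp X Y s]) = (s == z0) || (s == z1).
  by rewrite SE !inE.
apply: (double_zero_abelian char0 F n2 z01) => [s|s t Xst Yst].
  by rewrite -S0E !inE -!mulr2n !mulrn_eq0.
by rewrite -S0E; apply: simple.
Qed.

(** * From the Lie algebra to matrices *)

Section RationalScalars.

Variable K : fieldType.
Hypothesis char0 : [pchar K] =i pred0.

Lemma char0_intr_eq0 (z : int) : (z%:~R == 0 :> K) = (z == 0).
Proof.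
case: z => n; first exact: ((pcharf0P K).1 char0).
by rewrite NegzE rmorphN /= !oppr_eq0; apply: ((pcharf0P K).1 char0).
Qed.

Lemma char0_ratrD (x y : rat) : ratr (x + y) = ratr x + ratr y :> K.
Proof.
have d0 (z : rat) : (denq z)%:~R != 0 :> K by rewrite char0_intr_eq0 denq_neq0.
have d0' (z : rat) : (denq z)%:~R != 0 :> rat by rewrite intr_eq0 denq_neq0.
have E : numq (x + y) * (denq x * denq y)
    = (numq x * denq y + numq y * denq x) * denq (x + y).
  apply: (@intr_inj rat); rewrite !(rmorphM, rmorphD) /=.
  have q z : (numq z)%:~R = z * (denq z)%:~R :> rat.
    by rewrite -[X in _ = X * _]divq_num_den divfK.
  by rewrite !q; ring.
rewrite /ratr addf_div //; apply/eqP; rewrite eqr_div ?mulf_neq0 //; apply/eqP.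
by rewrite -!rmorphM -rmorphD -rmorphM /= -E.
Qed.

Lemma char0_ratr_inj : injective (@ratr K).
Proof.
move=> x y xy; apply/eqP; rewrite -subr_eq0.
have : ratr (x - y) = 0 :> K.
  by apply: (addrI (ratr y)); rewrite -char0_ratrD addrC subrK xy addr0.
rewrite /ratr => /eqP; rewrite mulf_eq0 invr_eq0 !char0_intr_eq0 (negPf (denq_neq0 _)) orbF.
by rewrite numq_eq0.
Qed.

Lemma char0_ratrMn (x : rat) m : ratr (x *+ m) = ratr x *+ m :> K.
Proof.
elim: m => [|m IH]; last by rewrite !mulrS char0_ratrD IH.
exact: (ratr_nat K 0).
Qed.

Definition rational (a : K) := exists q : rat, a = ratr q.

Lemma rationalD a b : rational a -> rational b -> rational (a + b).
Proof. by move=> [p ->] [q ->]; exists (p + q); rewrite char0_ratrD. Qed.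

Lemma rationalN a : rational a -> rational (- a).
Proof.
move=> [p ->]; exists (- p); apply: (addrI (ratr p)).
by rewrite -char0_ratrD !subrr (ratr_nat K 0).
Qed.

Lemma rational_sum (I : Type) (r : seq I) (F : I -> K) :
  (forall i, rational (F i)) -> rational (\sum_(i <- r) F i).
Proof.
move=> hF; elim/big_ind: _ => //; first by exists 0; rewrite (ratr_nat K 0).
exact: rationalD.
Qed.

Lemma rational_divn a m : (0 < m)%N -> rational (a *+ m) -> rational a.
Proof.
move=> m0 [q aq]; exists (q / m%:R); apply: (mulIf (x := m%:R)).
  by rewrite ((pcharf0P K).1 char0) -lt0n.
rewrite !mulr_natr aq -char0_ratrMn; congr ratr.
by rewrite -[RHS]mulr_natr divfK // pnatr_eq0 -lt0n.
Qed.

End RationalScalars.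

(** * Diagonalizability in the natural module *)

Section Semisimple.

Variables (K : closedFieldType) (n : nat) (H : 'M[K]_n).

Definition eigen_seq : seq K := undup (sval (closed_field_poly_normal (char_poly H))).

Definition eigen_sum : 'M[K]_n := (\sum_(r <- eigen_seq) eigenspace H r)%MS.

Lemma eigenspace_eigen_sum a : (eigenspace H a <= eigen_sum)%MS.
Proof.
have [->|nz] := eqVneq (eigenspace H a) 0; first exact: sub0mx.
have ar : a \in eigen_seq.
  rewrite mem_undup; case: closed_field_poly_normal => rs /= E.
  have : root (char_poly H) a by rewrite -eigenvalue_root_char.
  by rewrite E rootZ ?root_prod_XsubC // (monicP (char_poly_monic H)) oner_eq0.
by rewrite /eigen_sum (big_rem a) //=; apply: addsmxSl.
Qed.

Lemma eigen_sum_sub m (B : 'M[K]_(m, n)) : (forall a, (eigenspace H a <= B)%MS) ->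
  (eigen_sum <= B)%MS.
Proof.
move=> hB; rewrite /eigen_sum; elim/big_ind: _ => // [|C D CB DB]; first exact: sub0mx.
by rewrite addsmx_sub CB DB.
Qed.

Lemma eigenvector_exists : (0 < n)%N -> exists2 v : 'rV[K]_n, v != 0 & exists a, v *m H = a *: v.
Proof.
move=> n0; have /closed_rootP[a ra] : size (char_poly H) != 1%N.
  by rewrite size_char_poly eqSS -lt0n.
have /eigenvalueP[v vH v0] : eigenvalue H a by rewrite eigenvalue_root_char.
by exists v => //; exists a.
Qed.

Variable g : {vspace 'M[K]_n}.
Hypothesis ad_span : forall A, A \in g -> exists (m : nat) (k : 'I_m -> K) (B : 'I_m -> 'M[K]_n),
  A = \sum_i k i *: B i /\ forall i, exists c, H *m B i - B i *m H = c *: B i.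

(* An eigenvector of [ad H] moves eigenvectors of [H] to eigenvectors of [H]. *)
Lemma eigen_act (v : 'rV[K]_n) a A : v *m H = a *: v -> A \in g -> (v *m A <= eigen_sum)%MS.
Proof.
move=> vH /ad_span[m [k [B [-> hB]]]]; rewrite mulmx_sumr; apply: summx_sub => i _.
rewrite -scalemxAr scalemx_sub //; have [c hc] := hB i.
apply: submx_trans (eigenspace_eigen_sum (a - c)); apply/eigenspaceP.
have -> : v *m B i *m H = v *m (H *m B i) - v *m (H *m B i - B i *m H).
  by rewrite mulmxBr opprB addrC subrK mulmxA.
by rewrite hc mulmxA vH -scalemxAl -scalemxAr scalerBl.
Qed.

Lemma eigen_sum_diagonalizable : (forall c : 'cV[K]_n, c != 0 -> eigen_sum *m c = 0 -> False) ->
  diagonalizable H.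
Proof.
move=> full; apply/diagonalizablePeigen; exists eigen_seq; first exact: undup_uniq.
apply/eqmxP; rewrite submx1 /= submxE mul1mx.
apply/eqP/matrixP=> i j; rewrite [RHS]mxE; apply/eqP/negPn/negP=> cij.
apply: (full (col j (cokermx eigen_sum))).
  by apply: contraNneq cij => /matrixP/(_ i 0); rewrite !mxE => ->.
by rewrite colE mulmxA mulmx_coker mul0mx.
Qed.

End Semisimple.

(** Let [c] be a functional vanishing on all eigenvectors and [v] an eigenvector. Elementary
    matrices give [v_i * c_j = 0] for distinct indices; with [c_j] nonzero, [v] is concentrated at
    [j], and [v *m c = 0] kills it. *)
Lemma sl_diagonalizable (K : closedFieldType) n (H : 'M[K]_n) (g : {vspace 'M[K]_n}) : (0 < n)%N ->
  (forall i j, i != j -> delta_mx i j \in g) ->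
  (forall A, A \in g -> exists (m : nat) (k : 'I_m -> K) (B : 'I_m -> 'M[K]_n),
    A = \sum_i k i *: B i /\ forall i, exists c, H *m B i - B i *m H = c *: B i) ->
  diagonalizable H.
Proof.
move=> n0 gd ad_span; apply: eigen_sum_diagonalizable => c c0 Wc.
have [v v0 [a vH]] := eigenvector_exists H n0.
have kill (w : 'rV_n) : (w <= eigen_sum H)%MS -> w *m c = 0.
  by case/submxP=> D ->; rewrite -mulmxA Wc mulmx0.
have [j cj] : exists j, c j 0 != 0.
  apply/existsP; apply: contraNT c0; rewrite negb_exists => /forallP h.
  by apply/eqP/matrixP=> i j; rewrite ord1 mxE; apply/eqP; have := h i; rewrite negbK.
have vi i : i != j -> v 0 i = 0.
  move=> ij; have := kill _ (eigen_act ad_span vH (gd _ _ ij)).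
  move/matrixP/(_ 0 0); rewrite [RHS]mxE -mulmxA mxE (bigD1 i) //= big1 ?addr0 => [|u ui].
    rewrite mxE (bigD1 j) //= big1 ?addr0 => [|u uj]; last by rewrite mxE (negPf uj) andbF mul0r.
    by rewrite mxE !eqxx mul1r => /eqP; rewrite mulf_eq0 (negPf cj) orbF => /eqP.
  rewrite [X in _ * X]mxE big1 ?mulr0 // => w _; by rewrite mxE (negPf ui) mul0r.
have := kill v; rewrite (submx_trans _ (eigenspace_eigen_sum H a)); last exact/eigenspaceP.
move=> /(_ isT)/matrixP/(_ 0 0); rewrite [RHS]mxE mxE (bigD1 j) //= big1 ?addr0 => [|u uj].
  move/eqP; rewrite mulf_eq0 (negPf cj) orbF => /eqP vj; case/eqP: v0; apply/matrixP=> i k.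
  by rewrite ord1 mxE; have [->//|/vi] := eqVneq k j.
by rewrite vi // mul0r.
Qed.

(** With [d = J *m c] for a functional [c] vanishing on eigenvectors, bivectors give
    [v_i * d_k = eps * v_k * d_i]. For [eps = -1], equal indices kill [v]. For [eps = 1] every
    eigenvector is proportional to [d]. *)
Lemma form_diagonalizable (K : closedFieldType) n (H J : 'M[K]_n) eps :
  [pchar K] =i pred0 -> (0 < n)%N -> eps = 1 /\ J = 1%:M /\ (2 < n)%N \/ eps = -1 ->
  J \in unitmx -> J^T = eps *: J ->
  (forall A, A \in gform J -> exists (m : nat) (k : 'I_m -> K) (B : 'I_m -> 'M[K]_n),
    A = \sum_i k i *: B i /\ forall i, exists c, H *m B i - B i *m H = c *: B i) ->
  diagonalizable H.
Proof.
move=> char0 n0 he Ju JT ad_span; apply: eigen_sum_diagonalizable => c c0 Wc.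
have eps2 : eps * eps = 1 by case: he => [[-> _]| ->]; rewrite ?mulrNN mulr1.
have kill (w : 'rV_n) : (w <= eigen_sum H)%MS -> w *m c = 0.
  by case/submxP=> D ->; rewrite -mulmxA Wc mulmx0.
pose d := J *m c.
have [j dj] : exists j, d j 0 != 0.
  apply/existsP; apply: contraNT c0; rewrite negb_exists => /forallP h.
  have d0 : d = 0.
    by apply/matrixP=> i k; rewrite ord1 [RHS]mxE; apply/eqP; have := h i; rewrite negbK.
  by rewrite -[c](mulKmx Ju) -/d d0 mulmx0.
have act (v : 'rV[K]_n) p q : v *m delta_mx p q = v 0 p *: delta_mx 0 q.
  apply/matrixP=> u s; rewrite ord1 !mxE (bigD1 p) //= big1 ?addr0 => [|w wp].
    by rewrite mxE eqxx.
  by rewrite mxE (negPf wp) mulr0.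
have eig (v : 'rV[K]_n) a : v *m H = a *: v -> forall i k, v 0 i * d k 0 = eps * (v 0 k * d i 0).
  move=> vH i k; have := kill _ (eigen_act ad_span vH (bivJ_gform eps2 JT i k)).
  rewrite /bivJ -!mulmxA -/d; clearbody d; rewrite /biv mulmxBl mulmxBr -scalemxAl -scalemxAr !mulmxA !act.
  rewrite -!scalemxAl -!rowE => /matrixP/(_ 0 0).
  by rewrite !mxE => /eqP; rewrite subr_eq0 => /eqP.
clearbody d; have [v v0 [a vH]] := eigenvector_exists H n0.
have vj (u : 'rV[K]_n) b : u *m H = b *: u -> u 0 j = 0 -> u = 0.
  move=> uH uj; apply/matrixP=> i k; rewrite ord1 mxE; apply: (mulIf dj).
  by rewrite (eig _ _ uH) uj !mul0r mulr0.
case: he => [[e [J1 n2]]|e]; last first.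
  case/eqP: v0; apply: (vj _ _ vH); apply/eqP; have := eig _ _ vH j j; rewrite e mulN1r => /eqP.
  by rewrite -addr_eq0 -mulr2n -mulr_natl !mulf_eq0 ((pcharf0P K).1 char0) (negPf dj) orbF.
have Wd : (eigen_sum H <= d^T)%MS.
  apply: eigen_sum_sub => b; apply/row_subP=> i; apply/sub_rVP.
  have /eigenspaceP := row_sub i (eigenspace H b); move: (row i _) => u uH.
  exists (u 0 j / d j 0); apply/matrixP=> k l; rewrite ord1 !mxE; apply: (mulIf dj).
  by rewrite (eig _ _ uH) e mul1r mulrAC divfK.
have vjn0 : v 0 j != 0 by apply: contraNneq v0 => /(vj _ _ vH) ->.
(* The image of [v] under the bivector of [j] and [i] must stay on the line of [d], while its
   coordinates at [i] and [i'] are [v_j] and zero. Exchanging [i] and [i'] gives a contradiction. *)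
have key i i' : i != j -> i' != j -> i != i' -> d i 0 != 0 /\ d i' 0 = 0.
  move=> ij i'j ii'.
  have := submx_trans (eigen_act ad_span vH (bivJ_gform eps2 JT j i)) Wd.
  rewrite /bivJ J1 mulmx1 /biv e scale1r mulmxBr !act => /sub_rVP[k /matrixP E].
  have := E 0 i'; have := E 0 i.
  rewrite !mxE !eqxx [i == j](negPf ij) [i' == j](negPf i'j) [i' == i]eq_sym (negPf ii').
  rewrite !mulr0 mulr1 !subr0 => Ei /esym/eqP; rewrite mulf_eq0 => /orP[/eqP k0|/eqP di'].
    by move: Ei; rewrite k0 mul0r => /eqP; rewrite (negPf vjn0).
  by split=> //; apply: contraNneq vjn0 => di; rewrite Ei di mulr0.
have : (1 < #|[set~ j]|)%N by rewrite cardsC1 card_ord -ltnS prednK.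
case/card_gt1P=> i [i' [+ + ii']]; rewrite !inE => ij i'j.
have [di di'] := key _ _ ij i'j ii'; have [] := key _ _ i'j ij _; first by rewrite eq_sym.
by rewrite di' eqxx.
Qed.

Lemma diag_mull (K : fieldType) n (D A : 'M[K]_n) s t : is_diag_mx D ->
  (D *m A) s t = D s s * A s t.
Proof.
move=> /is_diag_mxP dD; rewrite mxE (bigD1 s) //= big1 ?addr0 // => u us.
by rewrite dD ?mul0r // eq_sym.
Qed.

Lemma diag_mulr (K : fieldType) n (D A : 'M[K]_n) s t : is_diag_mx D ->
  (A *m D) s t = A s t * D t t.
Proof.
move=> /is_diag_mxP dD; rewrite mxE (bigD1 t) //= big1 ?addr0 // => u us.
by rewrite dD ?mulr0.
Qed.

Lemma diag_gform (K : fieldType) n (D J : 'M[K]_n) s t : is_diag_mx D -> D \in gform J ->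
  J s t != 0 -> D s s + D t t = 0.
Proof.
move=> dD /gformP/(congr1 (fun B : 'M_n => B s t)) /= + Jst.
have dT : is_diag_mx D^T by apply/is_diag_mxP=> i j ij; rewrite mxE (is_diag_mxP dD) // eq_sym.
rewrite (diag_mull _ _ _ dT) [RHS]mxE (diag_mulr _ _ _ dD) mxE => E.
by apply: (mulIf Jst); rewrite mul0r mulrDl E mulrC addNr.
Qed.

(** * Transfer between the Lie algebra and its matrices *)

Section MatrixModel.

Variables (K : closedFieldType) (L : lieAlgType K) (n : nat) (f : {linear L -> 'M[K]_n}).
Variable g : {vspace 'M[K]_n}.
Hypothesis char0 : [pchar K] =i pred0.
Hypothesis f_inj : injective f.
Hypothesis f_im : forall A, A \in g <-> exists x, f x = A.
Hypothesis f_bracket : forall x y, f (bracket x y) = f x *m f y - f y *m f x.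

Lemma f_in x : f x \in g. Proof. by apply/f_im; exists x. Qed.

Lemma semisimple_span x : semisimple_elt x ->
  forall A, A \in g -> exists (m : nat) (k : 'I_m -> K) (B : 'I_m -> 'M[K]_n),
    A = \sum_i k i *: B i /\ forall i, exists c, f x *m B i - B i *m f x = c *: B i.
Proof.
move=> [b bb hb] A /f_im[y <-].
exists (size b), (fun i => coord (in_tuple b) i y), (fun i => f b`_i); split.
  rewrite {1}(coord_basis (X := in_tuple b) bb (memvf y)) linear_sum.
  by apply: eq_bigr => i _; rewrite linearZ.
move=> i; have [a ba] := hb _ (mem_nth 0 (ltn_ord i)).
by exists a; rewrite -f_bracket ba linearZ.
Qed.

Lemma eigen_rational h c (B : 'M[K]_n) : rational_eigenvalues h -> B \in g -> B != 0 ->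
  f h *m B - B *m f h = c *: B -> rational c.
Proof.
move=> rh /f_im[y <-] y0 hy; apply: rh; rewrite /passmx.leigenvalue /passmx.leigenspace.
apply/eqP=> /vspaceP/(_ y); rewrite memv0 memv_ker add_lfunE opp_lfunE scale_lfunE id_lfunE adE.
have -> : bracket h y = c *: y by apply: f_inj; rewrite f_bracket hy linearZ.
rewrite subrr eqxx => /esym/eqP y00; by rewrite y00 linear0 eqxx in y0.
Qed.

Hypothesis diagonalize : forall x, semisimple_elt x -> diagonalizable (f x).

Lemma codiagonalize (xs : seq L) : {in xs &, forall x y, bracket x y = 0} ->
  {in xs, forall x, semisimple_elt x} ->
  exists2 Q : 'M[K]_n, Q \in unitmx & {in xs, forall x, is_diag_mx (conj_mx Q (f x))}.
Proof.
move=> comm ss; have /codiagonalizableP[P Pu /allP dP] :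
    {in map f xs &, forall A B, comm_mx A B} /\ {in map f xs, forall A, diagonalizable A}.
  split=> [A B /mapP[x xx ->] /mapP[y yy ->]|A /mapP[x xx ->]]; last by apply/diagonalize/ss.
  by apply/eqP; rewrite -subr_eq0 -f_bracket comm // linear0.
exists (invmx P); first by rewrite unitmx_inv.
move=> x xx; have := dP _ (map_f f xx); rewrite /simmx_to_for => dx.
by rewrite /conj_mx invmxK -conjumx.
Qed.

Lemma toral_diagonal (H : {vspace L}) : toral H ->
  exists2 Q : 'M[K]_n, Q \in unitmx & {in H, forall x, is_diag_mx (conj_mx Q (f x))}.
Proof.
move=> [abH ssH].
have [x y xb yb|x xb|Q Qu dQ] := @codiagonalize (vbasis H).
- by apply: abH; apply: vbasis_mem.
- by apply: ssH; apply: vbasis_mem.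
exists Q => // x xH; apply/is_diag_mxP=> i j ij.
rewrite (coord_vbasis xH) !linear_sum summxE big1 // => k _.
have /dQ/is_diag_mxP/(_ _ _ ij) E : (vbasis H)`_k \in vbasis H by rewrite mem_nth ?size_tuple.
by rewrite !linearZ mxE E mulr0.
Qed.

Lemma toral_matrix (H : {vspace L}) (Q : 'M[K]_n) : Q \in unitmx ->
  {in H, forall x, is_diag_mx (conj_mx Q (f x))} ->
  row_free (\matrix_(k < \dim H, s < n) conj_mx Q (f (vbasis H)`_k) s s).
Proof.
move=> Qu dQ; apply: inj_row_free => w /matrixP w0.
pose x := \sum_k w 0 k *: (vbasis H)`_k.
have xH : x \in H.
  by apply: memv_suml => k _; apply/memvZ/vbasis_mem; rewrite mem_nth ?size_tuple.
have x0 : x = 0.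
  apply: f_inj; apply: (conj_mx_inj Qu); rewrite linear0 linear0.
  apply/matrixP=> i j; rewrite [RHS]mxE; have [<-|ij] := eqVneq i j; last first.
    by apply: (is_diag_mxP (dQ _ xH)).
  have := w0 0 i; rewrite [LHS]mxE [RHS]mxE => <-.
  rewrite !linear_sum summxE; apply: eq_bigr => k _.
  by rewrite !linearZ [LHS]mxE [in RHS]mxE.
apply/rowP=> k; rewrite [RHS]mxE.
have /freeP/(_ (fun k => w 0 k)) := basis_free (vbasisP H).
by apply.
Qed.

Lemma dim_centr_le e : (\dim (centr g (f e.1) (f e.2)) <= \dim (centralizer e))%N.
Proof.
rewrite -(limg_ker_dim (linfun f) (centralizer e)).
apply: leq_trans (leq_addl _ _); apply: dimvS; apply/subvP=> A /centrP[/f_im[x <-] c1 c2].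
apply/memv_imgP; exists x; last by rewrite lfunE.
by apply/mem_centralizer; split; apply: f_inj; rewrite f_bracket ?c1 ?c2 subrr linear0.
Qed.

Lemma centralizer_abelian e (g' : {vspace 'M[K]_n}) : (g <= g')%VS ->
  {in centr g' (f e.1) (f e.2) &, forall A B, A *m B = B *m A} ->
  abelian_subspace (centralizer e).
Proof.
move=> gg' ab x y /mem_centralizer[x1 x2] /mem_centralizer[y1 y2].
have inZ z : bracket z e.1 = 0 -> bracket z e.2 = 0 -> f z \in centr g' (f e.1) (f e.2).
  move=> z1 z2; apply/centrP; split; first by apply: (subvP gg'); apply: f_in.
    by apply/eqP; rewrite -subr_eq0 -f_bracket z1 linear0.
  by apply/eqP; rewrite -subr_eq0 -f_bracket z2 linear0.
by apply: f_inj; rewrite f_bracket ab ?inZ // subrr linear0.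
Qed.

Lemma graded_element h x (k : K) : is_diag_mx (f h) -> bracket h x = k *: x ->
  forall s t, f x s t != 0 -> f h s s = f h t t + k.
Proof.
move=> dh hx s t xst; have := congr1 (fun A : 'M_n => A s t) (f_bracket h x).
rewrite hx linearZ /= [LHS]mxE [RHS]mxE [X in _ + X]mxE (diag_mull _ _ _ dh) (diag_mulr _ _ _ dh).
rewrite [_ * f h t t]mulrC -mulrBl => /(mulIf xst) ->.
by rewrite addrC subrK.
Qed.

End MatrixModel.

(* [p] matches opposite diagonal entries; the pivots of a basis of [H] and their
   images under [p] are disjoint, whence [2 \dim H <= n]. *)
Lemma toral_form_bound (K : closedFieldType) (L : lieAlgType K) n (f : {linear L -> 'M[K]_n})
    (J : 'M[K]_n) (H : {vspace L}) : [pchar K] =i pred0 -> injective f -> J \in unitmx ->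
  (forall A, A \in gform J <-> exists x, f x = A) ->
  (forall x y, f (bracket x y) = f x *m f y - f y *m f x) ->
  (forall x, semisimple_elt x -> diagonalizable (f x)) -> toral H -> (\dim H <= n./2)%N.
Proof.
move=> char0 f_inj Ju f_im f_br dg tH.
have [Q Qu dQ] := toral_diagonal f_br dg tH.
have [p Jp] : exists p : 'S_n, forall s, (Q^T *m J *m Q) s (p s) != 0.
  by apply: unitmx_transversal; rewrite !unitmx_mul unitmx_tr Qu Ju.
have free := toral_matrix f_inj Qu dQ; set M := \matrix_(k, s) _ in free.
have Mp k s : M k (p s) = - M k s.
  have xH : (vbasis H)`_k \in H by apply: vbasis_mem; rewrite mem_nth ?size_tuple.
  have gx : conj_mx Q (f (vbasis H)`_k) \in gform (Q^T *m J *m Q).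
    by apply: conj_gform => //; apply/f_im; exists (vbasis H)`_k.
  have := diag_gform (dQ _ xH) gx (Jp s); rewrite !mxE => /eqP.
  by rewrite addrC addr_eq0 => /eqP.
have rM : \rank M^T = \dim H by rewrite mxrank_tr; apply/eqP.
pose piv := maxrankfun M^T; have piv_free := maxrowsub_free M^T.
have disj i j : piv i <> p (piv j).
  move=> ij; have : (delta_mx 0 i + delta_mx 0 j : 'rV_ _) *m rowsub piv M^T = 0.
    rewrite mulmxDl -!rowE; apply/rowP=> k; rewrite !mxE.
    by rewrite -/(piv i) -/(piv j) ij -!/(M _ _); have := Mp k (piv j); rewrite !mxE => ->; rewrite addNr.
  move/eqP; rewrite mulmx_free_eq0 // => /eqP/rowP/(_ i); rewrite !mxE !eqxx /= => /eqP.
  by case: (i == j); rewrite ?addr0 ?oner_eq0 // -mulr2n ((pcharf0P K).1 char0).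
pose A := [set piv i | i : 'I_(\rank M^T)].
have cA : #|A| = \dim H by rewrite card_imset ?card_ord //; apply: maxrankfun_inj.
have AD : [disjoint A & p @: A].
  apply/pred0P=> s; apply/negP=> /andP[/imsetP[i _ ->] /imsetP[t /imsetP[j _ ->]]].
  exact: disj.
have := max_card (mem (A :|: p @: A)); rewrite card_ord cardsU.
rewrite (_ : A :&: p @: A = set0); last by apply/eqP; rewrite setI_eq0.
have cpA : #|p @: A| = #|A| by apply: card_imset; apply: perm_inj.
by rewrite cards0 subn0 cpA cA; clear; lia.
Qed.

Lemma two_others n (i : 'I_n) : (2 < n)%N -> exists j k, [/\ j != i, k != i & j != k].
Proof.
move=> n2; have : (1 < #|[set~ i]|)%N by rewrite cardsC1 card_ord -ltnS prednK // (ltn_trans _ n2).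
by case/card_gt1P=> j [k []]; rewrite !inE => ji ki jk; exists j, k.
Qed.

Lemma rational_weights (K : fieldType) n (l : 'I_n -> K) : (forall s, rational (l s)) ->
  exists X : 'I_n -> rat, forall s, l s = ratr (X s).
Proof. by move=> h; apply: (fin_all_exists (P := fun s q => l s = ratr q)) h. Qed.

Lemma conj_gformV (K : fieldType) n (P J A : 'M[K]_n) : P \in unitmx ->
  A \in gform (P^T *m J *m P) -> conj_mx (invmx P) A \in gform J.
Proof.
move=> Pu; have Pu' : invmx P \in unitmx by rewrite unitmx_inv.
move/(conj_gform Pu'); rewrite trmx_inv -!mulmxA mulmxV // mulmx1.
by rewrite mulmxA -trmx_inv -trmx_mul mulmxV // trmx1 mul1mx.
Qed.

Lemma weights_homog (K : closedFieldType) (L : lieAlgType K) n (f : {linear L -> 'M[K]_n})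
    (X Y : 'I_n -> rat) h1 h2 x (p q : nat) : [pchar K] =i pred0 ->
  (forall x y, f (bracket x y) = f x *m f y - f y *m f x) ->
  is_diag_mx (f h1) -> is_diag_mx (f h2) ->
  (forall s, f h1 s s = ratr (X s)) -> (forall s, f h2 s s = ratr (Y s)) ->
  bracket h1 x = p%:R *: x -> bracket h2 x = q%:R *: x -> homog X Y p%:R q%:R (f x).
Proof.
move=> char0 f_br d1 d2 hX hY b1 b2 s t st; split; apply: (char0_ratr_inj char0).
  by rewrite char0_ratrD // ratr_nat -!hX; apply: (graded_element f_br d1 b1).
by rewrite char0_ratrD // ratr_nat -!hY; apply: (graded_element f_br d2 b2).
Qed.

Section FormCase.

Variables (K : closedFieldType) (L : lieAlgType K) (n : nat) (f : {linear L -> 'M[K]_n}).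
Variables (J : 'M[K]_n) (eps : K).
Hypothesis char0 : [pchar K] =i pred0.
Hypothesis he : eps = 1 \/ eps = -1.
Hypothesis n2 : eps = 1 -> (2 < n)%N.
Hypothesis Ju : J \in unitmx.
Hypothesis JT : J^T = eps *: J.
Hypothesis f_inj : injective f.
Hypothesis f_im : forall A, A \in gform J <-> exists x, f x = A.
Hypothesis f_br : forall x y, f (bracket x y) = f x *m f y - f y *m f x.

(** Eigenvalues of [ad h] are sums of two weights, with distinct indices when [eps = 1]; then twice
    a weight is a combination of three such sums, which needs three indices. *)
Lemma form_weights h : rational_eigenvalues h -> is_diag_mx (f h) ->
  exists X : 'I_n -> rat, forall s, f h s s = ratr (X s).
Proof.
move=> rh dh; apply: rational_weights => s.
have eps2 := eps_sqr he.
have gh : f h \in gform J by apply/f_im; exists h.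
have pair a b : a != b \/ eps = -1 -> rational (f h a a + f h b b).
  move=> ab; apply: (eigen_rational f_inj f_im f_br rh (B := bivJ J eps a b)).
  - exact: bivJ_gform.
  - apply/negP=> /eqP/(congr1 (mulmxr (invmx J))); rewrite /= mul0mx /bivJ mulmxK //.
    move/matrixP/(_ a b)/eqP; rewrite [X in _ == X]mxE bivE !eqxx /=.
    have [E|nab] := eqVneq a b; last by rewrite mulr0 subr0 oner_eq0.
    case: ab => [|e]; first by rewrite E eqxx.
    by rewrite e mulr1 opprK -mulr2n ((pcharf0P K).1 char0).
  rewrite -/(admx _ _) bivJ_act // big_split /=.
  rewrite (bigD1 a) //= big1 ?addr0 => [|u ua]; last by rewrite (is_diag_mxP dh) ?scale0r.
  rewrite (bigD1 b) //= big1 ?addr0 => [|u ub]; last by rewrite (is_diag_mxP dh) ?scale0r.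
  by rewrite -scalerDl.
case: he => e; last first.
  by apply: (rational_divn char0 (m := 2)) => //; rewrite mulr2n; apply: pair; right.
have [j [k [js ks jk]]] := two_others s (n2 e).
apply: (rational_divn char0 (m := 2)) => //.
have -> : f h s s *+ 2 = (f h s s + f h j j) + (f h s s + f h k k) + - (f h j j + f h k k).
  by rewrite mulr2n; ring.
apply: (rationalD char0); last by apply/(rationalN char0)/pair; left.
by apply: (rationalD char0); apply: pair; left; rewrite eq_sym.
Qed.

Lemma form_diagonal_case e h1 h2 : bracket e.1 e.2 = 0 ->
  rational_eigenvalues h1 -> rational_eigenvalues h2 -> is_diag_mx (f h1) -> is_diag_mx (f h2) ->
  bracket h1 e.1 = e.1 -> bracket h1 e.2 = 0 -> bracket h2 e.1 = 0 -> bracket h2 e.2 = e.2 ->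
  (\dim (centralizer e) <= (n./2).+1)%N -> abelian_subspace (centralizer e).
Proof.
move=> e12 r1 r2 d1 d2 b11 b12 b21 b22 dZ.
have [X hX] := form_weights r1 d1; have [Y hY] := form_weights r2 d2.
have fg x : f x \in gform J by apply/f_im; exists x.
have hom1 : homog X Y 1%:R 0%:R (f e.1).
  by apply: (weights_homog char0 f_br d1 d2 hX hY); rewrite ?b11 ?b21 ?scale1r ?scale0r.
have hom2 : homog X Y 0%:R 1%:R (f e.2).
  by apply: (weights_homog char0 f_br d1 d2 hX hY); rewrite ?b12 ?b22 ?scale1r ?scale0r.
have sum0 (l : 'I_n -> rat) h s t : is_diag_mx (f h) -> (forall s, f h s s = ratr (l s)) ->
    J s t != 0 -> l s + l t = 0.
  move=> dh hl Jst; apply: (char0_ratr_inj char0); rewrite char0_ratrD // -!hl.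
  by rewrite (diag_gform dh (fg h) Jst) (ratr_nat K 0).
apply: (centralizer_abelian f_inj f_im f_br (subvv _)).
apply: (fdata_abelian (eps := eps) (X := X) (Y := Y) char0 _ n2); split=> //.
- by apply/eqP; rewrite -subr_eq0 -f_br e12 linear0.
- by move=> s t Jst; split; [apply: sum0 d1 hX Jst|apply: sum0 d2 hY Jst].
- exact: leq_trans (dim_centr_le f_inj f_im f_br e) dZ.
Qed.

End FormCase.

Lemma form_case (K : closedFieldType) (L : lieAlgType K) n (f : {linear L -> 'M[K]_n})
    (J : 'M[K]_n) eps (e : L * L) : [pchar K] =i pred0 -> (0 < n)%N ->
  eps = 1 /\ J = 1%:M /\ (2 < n)%N \/ eps = -1 -> J \in unitmx -> J^T = eps *: J ->
  injective f -> (forall A, A \in gform J <-> exists x, f x = A) ->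
  (forall x y, f (bracket x y) = f x *m f y - f y *m f x) ->
  almost_principal_nilpotent_pair e -> abelian_subspace (centralizer e).
Proof.
move=> char0 n0 he Ju JT f_inj f_im f_br.
move=> [[e12 _ _ [h1 [h2 [h12 [ss1 ss2] [r1 r2] [b11 b12] [b21 b22]]]]] [r [H [tH _] dH] dZ]].
have dg x : semisimple_elt x -> diagonalizable (f x).
  move=> sx; apply: (form_diagonalizable char0 n0 he Ju JT).
  exact: (semisimple_span f_im f_br sx).
have rH := toral_form_bound char0 f_inj Ju f_im f_br dg tH.
have [x y|x|Q Qu dQ] := @codiagonalize _ _ _ f f_br dg [:: h1; h2].
- rewrite !inE => /orP[]/eqP -> /orP[]/eqP ->; rewrite ?bracketxx //.
  by rewrite bracketC h12 oppr0.
- by rewrite !inE => /orP[]/eqP ->.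
pose f' : {linear L -> 'M[K]_n} := conj_mx Q \o f.
have f'_br x y : f' (bracket x y) = f' x *m f' y - f' y *m f' x.
  by rewrite /= f_br linearB /= !conj_mxM.
have f'_im A : A \in gform (Q^T *m J *m Q) <-> exists x, f' x = A.
  split=> [/(conj_gformV Qu)/f_im[x fx]|[x <-]].
    by exists x; rewrite /= fx -{1}[Q]invmxK conj_mxK // unitmx_inv.
  by apply: conj_gform => //; apply/f_im; exists x.
apply: (@form_diagonal_case _ _ _ f' (Q^T *m J *m Q) eps char0 _ _ _ _ _ f'_im f'_br e h1 h2) => //.
- by case: he => [[]|]; [left|right].
- move=> e1; case: he => [[_ [_ //]]|e1']; exfalso.
  have : 2%:R == 0 :> K by rewrite mulr2n -{1}e1 e1' addNr.
  by rewrite ((pcharf0P K).1 char0).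
- by rewrite !unitmx_mul unitmx_tr Qu Ju.
- by rewrite !trmx_mul JT trmxK -scalemxAl -scalemxAr mulmxA.
- by move=> x y /(conj_mx_inj Qu)/f_inj.
- by apply: dQ; rewrite !inE eqxx.
- by apply: dQ; rewrite !inE eqxx orbT.
by rewrite dZ ltnS -dH.
Qed.

(** * The special linear algebra *)

Section SpecialLinear.

Variables (K : closedFieldType) (n : nat).

Definition trace_mx (A : 'M[K]_n) : 'M[K]_1 := (\tr A)%:M.

Lemma trace_mx_is_linear : linear trace_mx.
Proof.
by move=> a A B; apply/matrixP=> i j; rewrite !ord1 !mxE mxtraceD mxtraceZ !mulr1n.
Qed.

HB.instance Definition _ :=
  GRing.isLinear.Build K 'M[K]_n 'M[K]_1 _ trace_mx trace_mx_is_linear.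

Definition sl_space : {vspace 'M[K]_n} := lker (linfun trace_mx).

Lemma sl_spaceP A : (A \in sl_space) = (\tr A == 0).
Proof.
rewrite memv_ker lfunE /= /trace_mx; apply/eqP/eqP=> [/matrixP/(_ 0 0)|->].
  by rewrite !mxE mulr1n.
by apply/matrixP=> i j; rewrite !mxE mul0rn.
Qed.

Lemma sl_delta i j : i != j -> delta_mx i j \in sl_space.
Proof.
move=> ij; rewrite sl_spaceP; apply/eqP/big1 => s _; rewrite mxE.
by have [->|_] := eqVneq s i; rewrite ?(negPf ij).
Qed.

Lemma dim_centr_gl e1 e2 : (\dim (centr fullv e1 e2) <= (\dim (centr sl_space e1 e2)).+1)%N.
Proof.
rewrite -(limg_ker_dim (linfun trace_mx) (centr fullv e1 e2)) -[leqRHS]addn1; apply: leq_add.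
  apply: dimvS; apply/subvP=> A; rewrite memv_cap => /andP[/centrP[_ c1 c2] kA].
  by apply/centrP.
by apply: leq_trans (dimvS (subvf _)) _; rewrite dimvf.
Qed.

Lemma conj_trace (Q A : 'M[K]_n) : Q \in unitmx -> \tr (conj_mx Q A) = \tr A.
Proof. by move=> Qu; rewrite /conj_mx mxtrace_mulC mulmxA mulmxV // mul1mx. Qed.

End SpecialLinear.

Lemma sl_case (K : closedFieldType) (L : lieAlgType K) n (f : {linear L -> 'M[K]_n})
    (e : L * L) : [pchar K] =i pred0 -> (0 < n)%N -> injective f ->
  (forall A, A \in sl_space K n <-> exists x, f x = A) ->
  (forall x y, f (bracket x y) = f x *m f y - f y *m f x) ->
  almost_principal_nilpotent_pair e -> abelian_subspace (centralizer e).
Proof.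
move=> char0 n0 f_inj f_im f_br.
move=> [[e12 _ _ [h1 [h2 [h12 [ss1 ss2] [r1 r2] [b11 b12] [b21 b22]]]]] [r [H [tH _] dH] dZ]].
have dg x : semisimple_elt x -> diagonalizable (f x).
  move=> sx; apply: (sl_diagonalizable n0 (@sl_delta K n)).
  exact: (semisimple_span f_im f_br sx).
(* The diagonals of a toral subalgebra are independent vectors annihilated by the all-ones vector,
   since traces vanish. *)
have rn : (r < n)%N.
  have [Q Qu dQ] := toral_diagonal f_br dg tH.
  have free := toral_matrix f_inj Qu dQ; set M := \matrix_(k, s) _ in free.
  have M1 : M *m (const_mx 1 : 'cV_n) = 0.
    apply/matrixP=> k j; rewrite [RHS]mxE mxE.
    have tr0 : \tr (f (vbasis H)`_k) = 0.
      by apply/eqP; rewrite -sl_spaceP; apply/f_im; exists (vbasis H)`_k.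
    rewrite -[RHS]tr0 -(conj_trace _ Qu) /mxtrace; apply: eq_bigr => s _.
    by rewrite [X in X * _]mxE [X in _ * X]mxE mulr1.
  have := mulmx0_rank_max M1; rewrite (eqP free) dH -mxrank_tr trmx_const rank_rV.
  have -> : (const_mx 1 : 'rV[K]_n) != 0.
    by apply/eqP=> /rowP/(_ (Ordinal n0))/eqP; rewrite !mxE oner_eq0.
  by rewrite addn1.
have [x y|x|Q Qu dQ] := @codiagonalize _ _ _ f f_br dg [:: h1; h2].
- rewrite !inE => /orP[]/eqP -> /orP[]/eqP ->; rewrite ?bracketxx //.
  by rewrite bracketC h12 oppr0.
- by rewrite !inE => /orP[]/eqP ->.
pose f' : {linear L -> 'M[K]_n} := conj_mx Q \o f.
have f'_br x y : f' (bracket x y) = f' x *m f' y - f' y *m f' x.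
  by rewrite /= f_br linearB /= !conj_mxM.
have f'_inj : injective f' by move=> x y /(conj_mx_inj Qu)/f_inj.
have f'_im A : A \in sl_space K n <-> exists x, f' x = A.
  rewrite sl_spaceP; split=> [tA|[x <-]].
    have Qu' : invmx Q \in unitmx by rewrite unitmx_inv.
    have /f_im[x fx] : conj_mx (invmx Q) A \in sl_space K n by rewrite sl_spaceP conj_trace.
    by exists x; rewrite /= fx -{1}[Q]invmxK conj_mxK.
  by rewrite /= conj_trace // -sl_spaceP; apply/f_im; exists x.
have d1 : is_diag_mx (f' h1) by apply: dQ; rewrite !inE eqxx.
have d2 : is_diag_mx (f' h2) by apply: dQ; rewrite !inE eqxx orbT.
have weights h : rational_eigenvalues h -> is_diag_mx (f' h) ->
    exists X : 'I_n -> rat, forall s, f' h s s = ratr (X s).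
  (* Differences of weights are eigenvalues of [ad h], and the weights sum to zero, so [n] times
     each weight is rational. *)
  move=> rh dh; apply: rational_weights => s; apply: (rational_divn char0 n0).
  have tr0 : \sum_i f' h i i = 0.
    by apply/eqP; rewrite -[_ == 0]/(\tr (f' h) == 0) -sl_spaceP; apply/f'_im; exists h.
  have -> : f' h s s *+ n = \sum_i (f' h s s - f' h i i).
    by rewrite sumrB tr0 subr0 sumr_const card_ord.
  apply: (rational_sum char0) => i; have [->|si] := eqVneq s i.
    by exists 0; rewrite subrr; apply/esym: (ratr_nat K 0).
  apply: (eigen_rational f'_inj f'_im f'_br rh (sl_delta K si)).
    by apply/eqP=> /matrixP/(_ s i)/eqP; rewrite !mxE !eqxx oner_eq0.
  apply/matrixP=> a b; rewrite -/(admx _ _) admxE (diag_mull _ _ _ dh) (diag_mulr _ _ _ dh).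
  have dE : delta_mx s i a b = ((a == s) && (b == i))%:R :> K by rewrite mxE.
  rewrite [RHS]mxE dE; have [/andP[/eqP -> /eqP ->]|_] := boolP (_ && _).
    by rewrite mulr1 mul1r mulr1.
  by rewrite !mulr0 mul0r subrr.
have [X hX] := weights _ r1 d1; have [Y hY] := weights _ r2 d2.
have hom1 : homog X Y 1%:R 0%:R (f' e.1).
  by apply: (weights_homog char0 f'_br d1 d2 hX hY); rewrite ?b11 ?b21 ?scale1r ?scale0r.
have hom2 : homog X Y 0%:R 1%:R (f' e.2).
  by apply: (weights_homog char0 f'_br d1 d2 hX hY); rewrite ?b12 ?b22 ?scale1r ?scale0r.
apply: (centralizer_abelian f'_inj f'_im f'_br (subvf _)).
apply: (typeA_graded_abelian char0 hom1 hom2).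
  by apply/eqP; rewrite -subr_eq0 -f'_br e12 linear0.
apply: leq_trans (dim_centr_gl _ _) _; rewrite ltnS.
by apply: leq_trans (dim_centr_le f'_inj f'_im f'_br e) _; rewrite dZ.
Qed.

Lemma symp_form_unit (K : fieldType) l : symp_form K l \in unitmx.
Proof.
suff : symp_form K l *m - symp_form K l = 1%:M by case/mulmx1_unit.
rewrite /symp_form mulmxN mulmx_block !mul0mx !mulmx0 !mulmx1 !mul1mx !addr0 !add0r.
by rewrite opp_block_mx !opprK !oppr0 -scalar_mx_block.
Qed.

Lemma symp_form_tr (K : fieldType) l : (symp_form K l)^T = -1 *: symp_form K l.
Proof.
rewrite /symp_form tr_block_mx !trmx0 trmx1 linearN /= trmx1 scaleN1r opp_block_mx.
by rewrite !oppr0 opprK.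
Qed.

Theorem theorem7p2 (K : closedFieldType) (char0 : [pchar K] =i pred0)
  (L : lieAlgType K) (hL : classical_simple L)
  (e : L * L) (he : almost_principal_nilpotent_pair e) :
  abelian_subspace (centralizer e).
Proof.
have so_case n : (2 < n)%N -> isomorphic_to_matrix_lie L (@so_mx K n) ->
    abelian_subspace (centralizer e).
  move=> n2 [f [f_inj f_im f_br]].
  apply: (form_case (f := f) (J := 1%:M) (eps := 1) char0) => //.
  - exact: ltn_trans n2.
  - by left.
  - exact: unitmx1.
  - by rewrite trmx1 scale1r.
  move=> A; rewrite -f_im inE; split=> [/gformP|/eqP E]; first by rewrite mulmx1 mul1mx => ->.
  by apply/gformP; rewrite mulmx1 mul1mx.
case: hL => l l1 iso.
- have [f [f_inj f_im f_br]] := iso.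
  by apply: (sl_case (f := f) char0) => // A; rewrite -f_im sl_spaceP.
- by apply: so_case iso; rewrite ltnS -mul2n (leq_mul2l 2 1).
- have [f [f_inj f_im f_br]] := iso.
  apply: (form_case (f := f) (J := symp_form K l) (eps := -1) char0) => //.
  + by rewrite addn_gt0 l1.
  + by right.
  + exact: symp_form_unit.
  + exact: symp_form_tr.
  move=> A; rewrite -f_im inE addr_eq0; split=> [/gformP/eqP //|/eqP E].
  exact/gformP.
- by apply: so_case iso; rewrite -mul2n; move: l1; clear; lia.
Qed.
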